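(* Let $M$ be a special almost Hermitian $2n$-manifold, $n\ge 4$, with Kähler form $\omega$ and complex volume form $\Psi=\psi_++i\psi_-$. Then $$\nabla\psi_+\in\mathcal W^{\Xi}_1+\mathcal W^{\Xi}_2+\mathcal W^{\Xi}_3+\mathcal W^{\Xi}_4+\mathcal W^-_5,\qquad \nabla\psi_-\in\mathcal W^{\Xi}_1+\mathcal W^{\Xi}_2+\mathcal W^{\Xi}_3+\mathcal W^{\Xi}_4+\mathcal W^+_5,$$ where $\mathcal W^{\Xi}_i=\Xi_+(\mathcal W_i)=\Xi_-(\mathcal W_i)$ for $i=1,\dots,4$, $\mathcal W_5^+=T^*M\otimes\psi_+$ and $\mathcal W_5^-=T^*M\otimes\psi_-$. The modules $\mathcal W_i^{\Xi}$ are explicitly described by $$\mathcal W^{\Xi}_1=\{e_i\otimes Ie_i\wedge b\wedge\omega+e_i\otimes e_i\wedge I_{(1)}b\wedge\omega \mid b\in[\![\lambda^{n-3,0}]\!]\},$$ $$\mathcal W^{\Xi}_2=\{b\in\mathcal W^{\Xi}\mid \mathcal L(b)=(n-2)b\ \text{ and }\ \widetilde a(b)\wedge\omega=0\},$$ $$\mathcal W^{\Xi}_1+\mathcal W^{\Xi}_2=\{b\in\mathcal W^{\Xi}\mid\mathcal L(b)=(n-2)b\},$$ $$\mathcal W^{\Xi}_3=\{b\in\mathcal W^{\Xi}\mid\widetilde a(b)=0\},$$ $$\mathcal W^{\Xi}_4=\{e_i\otimes((x\wedge e_i)\lrcorner\psi_+)\wedge\omega\mid x\in TM\}=\{e_i\otimes((x\wedge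 e_i)\lrcorner\psi_-)\wedge\omega\mid x\in TM\},$$ $$\mathcal W^{\Xi}_3+\mathcal W^{\Xi}_4=\{b\in\mathcal W^{\Xi}\mid\mathcal L(b)=-(n-2)b\}.$$
   Context: A special almost Hermitian $2n$-manifold ($SU(n)$-structure) is a $2n$-manifold $M$ with a Riemannian metric $\langle\cdot,\cdot\rangle$, an orthogonal almost complex structure $I$, and a complex volume form $\Psi=\psi_++i\psi_-$ of unit length; vectors are identified with one-forms by $x\mapsto\langle\cdot,x\rangle$, and locally there are orthonormal (adapted) frames $e_1,\dots,e_n,Ie_1,\dots,Ie_n$ with $\Psi=(e_1+iIe_1)\wedge\dots\wedge(e_n+iIe_n)$. Kähler form: $\omega(x,y)=\langle x,Iy\rangle$. $\nabla$ is the Levi-Civita connection. Statements about modules are fibrewise; $+$ between modules denotes direct sum; repeated indices in $e_i$ are summed over an orthonormal basis of the real tangent space (all $2n$ vectors). For a $(0,s)$-tensor $b$: $I_{(i)}b(X_1,\dots,X_s)=-b(X_1,\dots,IX_i,\dots,X_s)$. $\lrcorner$ is interior product, and $((x\wedge y)\lrcorner b)(x_1,\dots,x_{p-2})=b(x,y,x_1,\dots,x_{p-2})$. $[\![\lambda^{p,0}]\!]$ is the space of real parts of complex $p$-forms of type $(p,0)$: $[\![\lambda^{0,0}]\!]=\mathbb R$, $[\![\lambda^{1,0}]\!]=T^*M$, and for $p\ge2$, $[\![\lambda^{p,0}]\!]=\{b\in\Lambda^pT^*M\mid I_{(i)}I_{(j)}b=-b,\ 1\le i<j\le p\}$. $\mathfrak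 u(n)^\perp$ is the orthogonal complement of $\mathfrak u(n)$ in $\mathfrak{so}(2n)\cong\Lambda^2T^*M$, i.e. $\mathfrak u(n)^\perp=[\![\lambda^{2,0}]\!]$. $T^*M\otimes\mathfrak u(n)^\perp=\mathcal W_1+\mathcal W_2+\mathcal W_3+\mathcal W_4$ is the Gray–Hervella decomposition into irreducible $U(n)$-modules: for $a\in T^*M\otimes\mathfrak u(n)^\perp$, $a\in\mathcal W_1$ iff $a$ is totally skew; $a\in\mathcal W_2$ iff the cyclic sum of $a(X,Y,Z)$ vanishes; $a\in\mathcal W_3$ iff $a(IX,IY,Z)=a(X,Y,Z)$ and $a(e_i,e_i,Z)=0$; $\mathcal W_4=\{e_i\otimes(e_i\wedge\mu-Ie_i\wedge I\mu)\mid\mu\in T^*M\}$ where $(I\mu)(X)=-\mu(IX)$. $\Xi_\pm:T^*M\otimes\mathfrak u(n)^\perp\to T^*M\otimes\Lambda^nT^*M$ are defined by $\Xi_+(a)_X=\frac12(e_i\lrcorner a_X)\wedge(e_i\lrcorner\psi_-)$ and $\Xi_-(a)_X=-\frac12(e_i\lrcorner a_X)\wedge(e_i\lrcorner\psi_+)$, where $a_X=a(X,\cdot,\cdot)$. $\mathcal W^{\Xi}=T^*M\otimes[\![\lambda^{n-2,0}]\!]\wedge\omega$. $\mathcal L:T^*M\otimes\Lambda^nT^*M\to T^*M\otimes\Lambda^nT^*M$ is $\mathcal L(b)=I_{(1)}(I_{(2)}+\dots+I_{(n+1)})b$. $\widetilde a:T^*M\otimes\Lambda^nT^*M\to\Lambda^{n+1}T^*M$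 is the alternation map $\alpha\otimes\beta\mapsto\alpha\wedge\beta$. *)

(* Defs.v *)
From HB Require Import structures.
From mathcomp Require Import all_boot all_order all_algebra all_fingroup.
From mathcomp Require Import all_classical all_reals all_analysis.
From mathcomp.real_closed Require Import complex.

Set Implicit Arguments.
Unset Strict Implicit.
Unset Printing Implicit Defensive.

Import Order.TTheory GRing.Theory Num.Theory.
Import numFieldNormedType.Exports.

Local Open Scope classical_set_scope.
Local Open Scope ring_scope.

Section Tensors.
Context {R : realType} {V : lmodType R}.

(* A (0,s)-tensor on V is a function of an infinite sequence of vectors that   *)
(* depends on the first s of them only (see [multilinear]); this avoids casts  *)
(* between degrees such as n and (n - 2) + 2. Slots are numbered from 0.       *)
Definition tensor : Type := (nat -> V) -> R.

Definition vcons (x : V) (v : nat -> V) : nat -> V :=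
  fun k => if k is k'.+1 then v k' else x.

Definition vset (v : nat -> V) (i : nat) (x : V) : nat -> V :=
  fun k => if k == i then x else v k.

Definition vshift (p : nat) (v : nat -> V) : nat -> V := fun k => v (p + k)%N.

Definition vperm (N : nat) (s : 'S_N) (v : nat -> V) : nat -> V :=
  fun k => if insub k is Some i then v (s i : 'I_N) else v k.

Definition multilinear (s : nat) (b : tensor) : Prop :=
  (forall v w : nat -> V, (forall k, (k < s)%N -> v k = w k) -> b v = b w) /\
  (forall (i : nat) (v : nat -> V) (c : R) (x y : V), (i < s)%N ->
     b (vset v i (c *: x + y)) = c * b (vset v i x) + b (vset v i y)).

Definition alternating_slots (s : nat) (b : tensor) : Prop :=
  forall (v : nat -> V) (i j : nat), (i < j)%N -> (j < s)%N ->
    v i = v j -> b v = 0.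

Definition skew_form (p : nat) : set tensor :=
  [set b | multilinear p b /\ alternating_slots p b].

Definition iprod (x : V) (b : tensor) : tensor := fun v => b (vcons x v).

(* alpha (x) beta, for a one-form alpha. *)
Definition otimes (alpha beta : tensor) : tensor :=
  fun v => alpha v * beta (vshift 1 v).

(* Normalised so that (a_1 /\ ... /\ a_p)(v_1, ..., v_p) = det (a_i(v_j)) for  *)
(* one-forms a_1, ..., a_p.                                                    *)
Definition wedge (p q : nat) (a b : tensor) : tensor := fun v =>
  ((p`! * q`!)%:R)^-1 *
  \sum_(s : 'S_(p + q)) (-1) ^+ s * a (vperm s v) * b (vshift p (vperm s v)).

(* The linear extension of alpha (x) beta |-> wedge 1 n alpha beta.            *)
Definition alternation (n : nat) (b : tensor) : tensor := fun v =>
  (n`!%:R)^-1 * \sum_(s : 'S_n.+1) (-1) ^+ s * b (vperm s v).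

(* T^* (x) U, for a space U of (0,s)-tensors.                                  *)
Definition cotimes (s : nat) (U : set tensor) : set tensor :=
  [set b | multilinear s.+1 b /\ forall x : V, U (iprod x b)].

Definition sum_modules (Ws : seq (set tensor)) : set tensor :=
  [set b | exists2 f : nat -> tensor,
     (forall i, (i < size Ws)%N -> nth set0 Ws i (f i)) &
     b = fun v => \sum_(i < size Ws) f i v].

Definition direct_modules (Ws : seq (set tensor)) : Prop :=
  forall f g : nat -> tensor,
    (forall i, (i < size Ws)%N -> nth set0 Ws i (f i) /\ nth set0 Ws i (g i)) ->
    (forall v, \sum_(i < size Ws) f i v = \sum_(i < size Ws) g i v) ->
    forall i, (i < size Ws)%N -> f i = g i.

End Tensors.
Arguments tensor {R} V.

(* The values at one point of the tensors of a special almost Hermitian        *)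
(* structure: metric, almost complex structure, and real and imaginary parts   *)
(* of the complex volume form.                                                 *)
Record su_data (R : realType) (V : lmodType R) := SuData {
  ip : V -> V -> R;
  Jc : V -> V;
  psip : tensor V;
  psim : tensor V }.

Section Fibre.
Context {R : realType} {V : lmodType R} (n : nat) (F : su_data V).

Local Notation g := (ip F).
Local Notation J := (Jc F).

Definition inner_product : Prop :=
  [/\ forall (c : R) (x y z : V), g (c *: x + y) z = c * g x z + g y z,
      forall x y : V, g x y = g y x &
      forall x : V, x != 0 -> 0 < g x x].

Definition orthogonal_complex_structure : Prop :=
  [/\ forall (c : R) (x y : V), J (c *: x + y) = c *: J x + J y,
      forall x : V, J (J x) = - x &
      forall x y : V, g (J x) (J y) = g x y].

(* f_1, ..., f_n, I f_1, ..., I f_n is orthonormal and                         *)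
(* Psi = (f_1 + i I f_1) /\ ... /\ (f_n + i I f_n), where a vector x stands    *)
(* for the one-form <., x>. This fixes both the type (n,0) of Psi and the      *)
(* normalisation of its unit length.                                           *)
Definition adapted_frame (f : 'I_n -> V) : Prop :=
  [/\ forall j k, g (f j) (f k) = (j == k)%:R,
      forall j k, g (f j) (J (f k)) = 0 &
      forall v : nat -> V,
        (psip F v +i* psim F v)%C =
        \det (\matrix_(j < n, k < n) (g (v k) (f j) +i* g (v k) (J (f j)))%C)].

Definition su_structure : Prop :=
  [/\ inner_product, orthogonal_complex_structure &
      exists f : 'I_n -> V, adapted_frame f].

Definition flat (x : V) : tensor V := fun v => g (v 0%N) x.

Definition kahler : tensor V := fun v => g (v 0%N) (J (v 1%N)).

(* I_(i+1) in one-based notation.                                              *)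
Definition Islot (i : nat) (b : tensor V) : tensor V :=
  fun v => - b (vset v i (J (v i))).

(* [[lambda^{p,0}]]; for p = 0 and p = 1 the condition on slots is void.       *)
Definition lam (p : nat) : set (tensor V) :=
  [set b | skew_form p b /\
     forall i j, (i < j)%N -> (j < p)%N ->
       Islot i (Islot j b) = fun v => - b v].

Definition T_uperp : set (tensor V) := cotimes 2 (lam 2).

Definition calL (b : tensor V) : tensor V :=
  Islot 0 (fun v => \sum_(1 <= k < n.+1) Islot k b v).

Definition W_Xi : set (tensor V) :=
  cotimes n [set b | exists2 c, lam (n - 2) c & b = wedge (n - 2) 2 c kahler].

Definition W5 (psi : tensor V) : set (tensor V) :=
  cotimes n [set b | exists c : R, b = fun v => c * psi v].

(* Sums over repeated indices run over the orthonormal basis e of the real     *)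
(* 2n-dimensional space V.                                                     *)
Variable e : 'I_n.*2 -> V.

Definition orthonormal_basis : Prop := forall i j, g (e i) (e j) = (i == j)%:R.

Definition GH1 : set (tensor V) := [set a | T_uperp a /\ alternating_slots 3 a].

Definition GH2 : set (tensor V) :=
  [set a | T_uperp a /\ forall (x y z : V) (v : nat -> V),
     a (vcons x (vcons y (vcons z v))) + a (vcons y (vcons z (vcons x v)))
     + a (vcons z (vcons x (vcons y v))) = 0].

Definition GH3 : set (tensor V) :=
  [set a | [/\ T_uperp a,
     forall (x y z : V) (v : nat -> V),
       a (vcons (J x) (vcons (J y) (vcons z v)))
       = a (vcons x (vcons y (vcons z v))) &
     forall (z : V) (v : nat -> V),
       \sum_i a (vcons (e i) (vcons (e i) (vcons z v))) = 0]].

Definition GH4 : set (tensor V) :=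
  [set a | exists2 mu, skew_form 1 mu &
     a = fun v => \sum_i otimes (flat (e i))
           (fun w => wedge 1 1 (flat (e i)) mu w
                     - wedge 1 1 (flat (J (e i))) (Islot 0 mu) w) v].

Definition Xi (c : R) (psi a : tensor V) : tensor V := fun v =>
  c * \sum_i wedge 1 (n - 1) (iprod (e i) (iprod (v 0%N) a))
                             (iprod (e i) psi) (vshift 1 v).

Definition Xip : tensor V -> tensor V := Xi 2^-1 (psim F).
Definition Xim : tensor V -> tensor V := Xi (- 2^-1) (psip F).

Definition W1_Xi := Xip @` GH1.
Definition W2_Xi := Xip @` GH2.
Definition W3_Xi := Xip @` GH3.
Definition W4_Xi := Xip @` GH4.

(* e_i (x) I e_i /\ b /\ omega + e_i (x) e_i /\ I_(1) b /\ omega               *)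
Definition elt_W1 (b : tensor V) : tensor V := fun v =>
  \sum_i otimes (flat (e i))
    (wedge (n - 2) 2 (wedge 1 (n - 3) (flat (J (e i))) b) kahler) v
  + \sum_i otimes (flat (e i))
    (wedge (n - 2) 2 (wedge 1 (n - 3) (flat (e i)) (Islot 0 b)) kahler) v.

(* e_i (x) ((x /\ e_i) _| psi) /\ omega                                        *)
Definition elt_W4 (psi : tensor V) (x : V) : tensor V := fun v =>
  \sum_i otimes (flat (e i))
    (wedge (n - 2) 2 (iprod (e i) (iprod x psi)) kahler) v.

End Fibre.

Section Charts.
Context {R : realType} {m : nat}.
Local Notation E := 'rV[R]_m.

Definition coord_vec (i : 'I_m) : E := delta_mx 0 i.

Fixpoint Ck_on (k : nat) (U : set E) (f : E -> R) : Prop :=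
  (forall x, U x -> {for x, continuous f}) /\
  (if k is k'.+1 then
     forall i : 'I_m, (forall x, U x -> derivable f x (coord_vec i)) /\
                      Ck_on k' U ('D_(coord_vec i) f)
   else True).

Definition smooth_on (U : set E) (f : E -> R) : Prop := forall k, Ck_on k U f.

(* Levi-Civita connection of the metric g in a coordinate chart:               *)
(* Gamma^k_ij = 1/2 g^kl (d_i g_jl + d_j g_il - d_l g_ij), evaluated on the    *)
(* vectors u^i and v^j.                                                        *)
Definition christoffel (g : E -> E -> E -> R) (x u v : E) : E :=
  (\row_l (2^-1 * ('D_u (fun y => g y v (coord_vec l)) x
                   + 'D_v (fun y => g y u (coord_vec l)) x
                   - 'D_(coord_vec l) (fun y => g y u v) x)))
  *m invmx (\matrix_(k, l) g x (coord_vec k) (coord_vec l)).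

(* Covariant derivative of a field b of (0,s)-tensors; the direction of        *)
(* differentiation is slot 0 of the result.                                    *)
Definition nabla (g : E -> E -> E -> R) (s : nat) (b : E -> tensor E) (x : E) :
    tensor E := fun v =>
  'D_(v 0%N) (fun y => b y (vshift 1 v)) x
  - \sum_(i < s) b x (vset (vshift 1 v) i (christoffel g x (v 0%N) (v i.+1))).

End Charts.

Record smooth_manifold (R : realType) (m : nat) := SmoothManifold {
  carrier :> topologicalType;
  chart : Type;
  chart_dom : chart -> set carrier;
  chart_map : chart -> carrier -> 'rV[R]_m;
  chart_inv : chart -> 'rV[R]_m -> carrier;
  _ : hausdorff_space carrier;
  _ : @second_countable carrier;
  _ : forall p : carrier, exists c, chart_dom c p;
  _ : forall c, open (chart_dom c);
  _ : forall c, open (chart_map c @` chart_dom c);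
  _ : forall c p, chart_dom c p -> chart_inv c (chart_map c p) = p;
  _ : forall c p, chart_dom c p -> {for p, continuous (chart_map c)};
  _ : forall c x, (chart_map c @` chart_dom c) x ->
      {for x, continuous (chart_inv c)};
  _ : forall c d j, smooth_on (chart_map c @` (chart_dom c `&` chart_dom d))
                              (fun x => chart_map d (chart_inv c x) 0 j) }.

(* Tensor fields are given by their coordinate expressions in all charts: the  *)
(* tangent space at p is identified with R^2n by any chart at p, and           *)
(* expressions in two charts correspond under the differential of the          *)
(* transition map.                                                             *)
Record special_almost_hermitian (R : realType) (n : nat)
    (M : smooth_manifold R n.*2) := SpecialAlmostHermitian {
  sah :> chart M -> 'rV[R]_n.*2 -> su_data 'rV[R]_n.*2;
  _ : forall c x, (chart_map c @` chart_dom c) x -> su_structure n (sah c x);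
  _ : forall c u v, smooth_on (chart_map c @` chart_dom c)
      (fun x => ip (sah c x) u v);
  _ : forall c u j, smooth_on (chart_map c @` chart_dom c)
      (fun x => Jc (sah c x) u 0 j);
  _ : forall c v, smooth_on (chart_map c @` chart_dom c)
      (fun x => psip (sah c x) v);
  _ : forall c v, smooth_on (chart_map c @` chart_dom c)
      (fun x => psim (sah c x) v);
  _ : forall c d p, chart_dom c p -> chart_dom d p ->
      let Fc := sah c (chart_map c p) in
      let Fd := sah d (chart_map d p) in
      let dtau := fun u => 'D_u (chart_map d \o chart_inv c) (chart_map c p) in
      [/\ forall u v, ip Fc u v = ip Fd (dtau u) (dtau v),
          forall u, dtau (Jc Fc u) = Jc Fd (dtau u),
          forall v, psip Fc v = psip Fd (dtau \o v) &
          forall v, psim Fc v = psim Fd (dtau \o v)] }.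

Section Derivatives.
Context {R : realType} {n : nat} {M : smooth_manifold R n.*2}.
Variable U : special_almost_hermitian M.

Definition nabla_psip (c : chart M) (p : M) : tensor 'rV[R]_n.*2 :=
  nabla (fun y => ip (U c y)) n (fun y => psip (U c y)) (chart_map c p).

Definition nabla_psim (c : chart M) (p : M) : tensor 'rV[R]_n.*2 :=
  nabla (fun y => ip (U c y)) n (fun y => psim (U c y)) (chart_map c p).

End Derivatives.

(* Main.v *)
(* All identities are proved by contraction: a form is determined by its       *)
(* interior products, and every operator used has a commutation rule with      *)
(* them.                                                                       *)
(*                                                                             *)
(* Contracting omega /\ psi_+ = 0 twice gives Xi_+(a)_X = -1/4 omega /\ c(a_X), *)
(* where c(al) = al(e_i,e_j) psi_+(e_i,e_j,...). The map c is an isomorphism   *)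
(* from u(n)^perp to [[lambda^{n-2,0}]]: its inverse is obtained by wedging    *)
(* twice with (1,0)-forms and evaluating on an adapted frame. Since wedging    *)
(* with omega is injective in these degrees, Xi_+ is an isomorphism from       *)
(* T^* (x) u(n)^perp to W^Xi, and every description of W^Xi_i is a statement   *)
(* about the Gray-Hervella condition on a. For instance, L is the derivation   *)
(* by I in the last n slots after applying I to the first one, and it acts as  *)
(* n-2 or -(n-2) according as a(IX,IY,Z) is -a(X,Y,Z) or a(X,Y,Z); the         *)
(* alternation of Xi_+(a) is a multiple of omega /\ K, K the alternation of c,  *)
(* and [Lambda, omega /\ .] is used to cancel omega.                           *)
(*                                                                             *)
(* For the covariant derivative, put a(X,Y,Z) = -<(nabla_X I)Y,Z>, so that     *)
(* 2 Xi_+(a)_X is the derivation by nabla_X I applied to psi_-.                *)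
(* Differentiating the identity I_(i) psi_+ = psi_- then shows that            *)
(* nabla_X psi_+ - Xi_+(a)_X has type (n,0), hence lies in the span of psi_+   *)
(* and psi_-; its psi_+ component vanishes because |Psi(v_1,...,v_n)|^2 is     *)
(* the determinant of the Hermitian Gram matrix of v_1, ..., v_n.              *)

Require Import Defs.
From HB Require Import structures.
From mathcomp Require Import all_boot all_order all_algebra all_fingroup.
From mathcomp Require Import all_classical all_reals all_analysis.
From mathcomp.real_closed Require Import complex.
From mathcomp Require Import ring lra zify.

Set Implicit Arguments.
Unset Strict Implicit.
Unset Printing Implicit Defensive.

Import Order.TTheory GRing.Theory Num.Theory.
Import numFieldNormedType.Exports.

Local Open Scope classical_set_scope.
Local Open Scope ring_scope.

(** The map Xi_+ is an isomorphism from T^* tensor u(n)^perp onto W^Xi, so each description of a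
    module of forms becomes a linear condition on a tensor a(X,Y,Z).

    The isomorphism is a composition of two. By [iprod_Xip], Xi_+(a)_X = -1/4 omega /\ c(a_X) with c
    = [cont]. The contraction c is inverted by wedging twice with the operators [Th] ([Th_Th_cont],
    [cont_rec]), because a form of type (n,0) is known from its two values on an adapted frame
    ([lam_top]). The factor omega is cancelled by Lambda, since forms of pure type are primitive
    ([Lam_lam]) and hence Lambda(omega /\ c) = -4 c in degree n-2 ([Lam_Lo_lam]). This gives
    [Xip_inj] and [W_Xi_E].

    L becomes a |-> -(n-2) a(IX,IY,Z) by [calL_Xip]; its two eigenspaces are W_1 + W_2 and W_3 +
    W_4. The alternation becomes -1/4 omega /\ [KK a]. If [KK a] vanishes then a has the type of W_3
    + W_4 ([KK0_Janti]), and for that type [KK a] is the trace of a contracted with psi_+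
    ([KK_Janti]); this describes W_3. One more factor omega turns the alternation into a multiple of
    the cyclic sum of a wedged with psi_+ ([Lo_Lo_KK]), which is zero on W_2 and injective on W_1
    ([GH1_Lo_Lo]). For W_1 and W_4 the form c(a_X) is computed outright ([Th_cont3], [cont_quad]).

    For the derivatives, nabla psi_+ and nabla psi_- minus the images under Xi_+ and Xi_- of one
    tensor [na], built from nabla I, are of type (n,0) in the last n slots. [rp_fseq], which rests
    on the constant length of Psi, removes the psi_+ part of the first and the psi_- part of the
    second. *)

Section Sequences.
Context {R : realType} {V : lmodType R}.
Implicit Types (D E : tensor V) (v w : nat -> V) (x y z : V) (c : R) (p k : nat).

(** * Tensors on sequences of vectors, contraction with the first slot, skew forms *)

Lemma tensorD D E v : (D + E) v = D v + E v. Proof. by []. Qed.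
Lemma tensorZ c D v : (c *: D) v = c * D v. Proof. by []. Qed.
Lemma tensorN D v : (- D) v = - D v. Proof. by []. Qed.
Lemma tensor0 v : (0 : tensor V) v = 0. Proof. by []. Qed.
Lemma tensor_sum (I : Type) (r : seq I) (P : pred I) (F : I -> tensor V) v :
  (\sum_(i <- r | P i) F i) v = \sum_(i <- r | P i) F i v.
Proof. by rewrite fct_sumE. Qed.
Definition tensorE := (tensorD, tensorN, tensorZ, tensor0).

Definition vdel k v : nat -> V := fun j => v (bump k j).

Lemma vcons_eta v : vcons (v 0%N) (vshift 1 v) = v.
Proof. by apply/funext => -[|k]. Qed.

Lemma vshift1_cons x v : vshift 1 (vcons x v) = v.
Proof. by apply/funext. Qed.

Lemma vset_cons0 x v y : vset (vcons x v) 0 y = vcons y v.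
Proof. by apply/funext => -[|k]. Qed.

Lemma vset_consS x v i y : vset (vcons x v) i.+1 y = vcons x (vset v i y).
Proof. by apply/funext => -[|k]. Qed.

Lemma vdel0 v : vdel 0 v = vshift 1 v.
Proof. by apply/funext. Qed.

Lemma vdel_cons k x v : vdel k.+1 (vcons x v) = vcons x (vdel k v).
Proof. by apply/funext => -[|j]; rewrite /vdel /vcons //= bumpS. Qed.

Lemma tensor_ext D E : (forall x, iprod x D = iprod x E) -> D = E.
Proof.
move=> h; apply/funext => v; rewrite -(vcons_eta v).
exact: (congr1 (@^~ (vshift 1 v)) (h (v 0%N))).
Qed.

Lemma iprod_is_linear x : linear (iprod x : tensor V -> tensor V).
Proof. by []. Qed.
HB.instance Definition _ x :=
  GRing.isLinear.Build R (tensor V) (tensor V) *:%R (iprod x) (iprod_is_linear x).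

Lemma ipD x D E : iprod x (D + E) = iprod x (D) + iprod x (E). Proof. exact: linearD. Qed.
Lemma ipN x D : iprod x (- D) = - iprod x (D). Proof. exact: linearN. Qed.
Lemma ipB x D E : iprod x (D - E) = iprod x (D) - iprod x (E). Proof. exact: linearB. Qed.
Lemma ipZ x c D : iprod x (c *: D) = c *: iprod x (D). Proof. exact: linearZ. Qed.
Lemma ip0 x : iprod x (0) = 0. Proof. exact: linear0. Qed.
Lemma ip_sum x (I : Type) (r : seq I) (P : pred I) (G : I -> tensor V) :
 iprod x (\sum_(i <- r | P i) G i) = \sum_(i <- r | P i) iprod x (G i). Proof. exact: linear_sum. Qed.

Lemma multilinear0 D : multilinear 0 D <-> forall v w, D v = D w.
Proof. by split=> [[h _] v w|h]; [exact: h | split=> // v w _; exact: h]. Qed.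

Definition lin0 D := forall c x y,
  iprod (c *: x + y) D = c *: iprod x D + iprod y D.

(** Recursion on the degree through the first slot. Together with [skew_formS] it allows identities
    between forms to be proved by induction, contracting once at each step. *)
Lemma multilinearS p D :
  multilinear p.+1 D <-> lin0 D /\ forall x, multilinear p (iprod x D).
Proof.
split=> [[h1 h2]|[h1 h2]].
  split=> [c x y|x].
    apply/funext => v; move: (h2 0%N (vcons 0 v) c x y isT).
    by rewrite !vset_cons0.
  split=> [v w e|i v c y z ip].
    by apply: h1 => -[|k] //=; exact: e.
  by move: (h2 i.+1 (vcons x v) c y z ip); rewrite !vset_consS.
split=> [v w e|[|i] v c x y ip].
- rewrite -(vcons_eta v) -(vcons_eta w) -(e 0%N isT).
  by apply: (h2 (v 0%N)).1 => k kp; exact: (e k.+1).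
- rewrite -(vcons_eta v) !vset_cons0.
  exact: (congr1 (@^~ (vshift 1 v)) (h1 c x y)).
- rewrite -(vcons_eta v) !vset_consS.
  exact: (h2 (v 0%N)).2.
Qed.

Lemma lin0D D x y : lin0 D -> iprod (x + y) D = iprod x D + iprod y D.
Proof. by move=> h; have := h 1 x y; rewrite !scale1r. Qed.

Lemma lin00 D : lin0 D -> iprod 0 D = 0.
Proof.
move=> h; have := h (-1) 0 0; rewrite scaleN1r addr0 oppr0 => ->.
by rewrite scaleN1r addNr.
Qed.

Lemma lin0Z D c x : lin0 D -> iprod (c *: x) D = c *: iprod x D.
Proof. by move=> h; have := h c x 0; rewrite lin00 // !addr0. Qed.

Lemma lin0N D x : lin0 D -> iprod (- x) D = - iprod x D.
Proof. by move=> h; rewrite -scaleN1r lin0Z // scaleN1r. Qed.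

Lemma lin0_sum D (I : Type) (r : seq I) (P : pred I) (F : I -> V) : lin0 D ->
  iprod (\sum_(i <- r | P i) F i) D = \sum_(i <- r | P i) iprod (F i) D.
Proof.
move=> h; elim/big_rec2: _ => [|i x E _ <-]; first exact: lin00.
by rewrite lin0D.
Qed.

Lemma alternating_iprod p D x :
  alternating_slots p.+1 D -> alternating_slots p (iprod x D).
Proof. by move=> h v i j ij jp e; apply: (h _ i.+1 j.+1). Qed.

(** Polarisation of the vanishing double contraction at [x + y]. *)
Lemma iprod2_anti D x y : lin0 D -> (forall x, lin0 (iprod x D)) ->
  (forall x, iprod x (iprod x D) = 0) ->
  iprod x (iprod y D) = - iprod y (iprod x D).
Proof.
move=> h1 h2 h3; have := h3 (x + y).
rewrite (lin0D x y h1) linearD /= !(lin0D _ _ (h2 _)) !h3 add0r addr0 addrC.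
by move=> /eqP; rewrite addr_eq0 => /eqP.
Qed.

Lemma skew_formS p D : skew_form p.+1 D <->
  [/\ lin0 D, forall x, skew_form p (iprod x D) &
      (0 < p)%N -> forall x, iprod x (iprod x D) = 0].
Proof.
split=> [[/multilinearS[h1 h2] h3]|[h1 h2 h3]].
  split=> // [x|p0 x]; first by split=> //; exact: alternating_iprod.
  by apply/funext => v; exact: (h3 (vcons x (vcons x v)) 0%N 1%N).
split; first by apply/multilinearS; split=> // x; have [] := h2 x.
move=> v [|i] [|j] // ij jp e; last first.
  rewrite -(vcons_eta v); have [_ h] := h2 (v 0%N).
  exact: (h (vshift 1 v) i j).
rewrite ltnS in jp; have p0 : (0 < p)%N by exact: leq_ltn_trans jp.
rewrite -(vcons_eta v) -(vcons_eta (vshift 1 v)) -/(iprod _ _ _) -/(iprod _ _ _).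
case: j jp e {ij} => [|j] jp e.
  have -> : vshift 1 v 0 = v 0%N by [].
  by rewrite h3.
have hl x : lin0 (iprod x D).
  by have [m _] := h2 x; move: p0 m; case: (p) => // q _ /multilinearS[].
(* Slot 0 coincides with a slot beyond 1: after exchanging the first two vectors, the coincidence
   lies inside a contraction. *)
have := iprod2_anti (vshift 1 v 0) (v 0%N) h1 hl (h3 p0).
move/(congr1 (@^~ (vshift 1 (vshift 1 v)))) => ->.
have [_ h] := h2 (vshift 1 v 0); rewrite tensorN.
rewrite /iprod -/(iprod (vshift 1 v 0) D).
apply/eqP; rewrite oppr_eq0; apply/eqP.
exact: (h (vcons (v 0%N) (vshift 1 (vshift 1 v))) 0%N j.+1).
Qed.

Lemma multilinear_lin0 p D : multilinear p.+1 D -> lin0 D.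
Proof. by move=> /multilinearS[]. Qed.

Lemma skew_lin0 p D : skew_form p.+1 D -> lin0 D.
Proof. by case/skew_formS. Qed.

Lemma skew_iprod p D x : skew_form p.+1 D -> skew_form p (iprod x D).
Proof. by case/skew_formS. Qed.

Lemma skew_iprod2 p D x : skew_form p.+2 D -> iprod x (iprod x D) = 0.
Proof. by case/skew_formS => _ _; exact. Qed.

Lemma skew_anti p D x y : skew_form p.+2 D ->
  iprod x (iprod y D) = - iprod y (iprod x D).
Proof.
move=> s; apply: iprod2_anti => [|z|z]; first exact: skew_lin0 s.
- exact: skew_lin0 (skew_iprod z s).
- exact: skew_iprod2 s.
Qed.

Lemma multilinear_lc p c D E :
  multilinear p D -> multilinear p E -> multilinear p (c *: D + E).
Proof.
move=> [d1 d2] [e1 e2]; split=> [v w h|i v a x y ip].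
  by rewrite !tensorE (d1 v w h) (e1 v w h).
by rewrite !tensorE d2 // e2 //; ring.
Qed.

Lemma multilinear_0 p : multilinear p (0 : tensor V).
Proof. by split=> // *; rewrite !tensorE mulr0 addr0. Qed.

Lemma skew_lc p c D E : skew_form p D -> skew_form p E -> skew_form p (c *: D + E).
Proof.
move=> [d1 d2] [e1 e2]; split; first exact: multilinear_lc.
move=> v i j ij jp e; rewrite !tensorE.
by rewrite (d2 v i j) // (e2 v i j) // mulr0 addr0.
Qed.

Lemma skew_0 p : skew_form p (0 : tensor V).
Proof. by split; [exact: multilinear_0|]. Qed.

End Sequences.

Ltac tring := apply/funext => ?; rewrite /= ?tensorE; ring.

Section Linear.
Context {R : realType} {V : lmodType R}.
Variable S : set (tensor V).
Hypothesis S0 : S 0.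
Hypothesis Slc : forall c D E, S D -> S E -> S (c *: D + E).

Lemma lc_add D E : S D -> S E -> S (D + E).
Proof. by move=> d e; have := Slc 1 d e; rewrite scale1r. Qed.
Lemma lc_scale c D : S D -> S (c *: D).
Proof. by move=> d; have := Slc c d S0; rewrite addr0. Qed.
Lemma lc_opp D : S D -> S (- D).
Proof. by rewrite -scaleN1r; exact: lc_scale. Qed.
Lemma lc_sub D E : S D -> S E -> S (D - E).
Proof. by move=> d e; apply: lc_add => //; exact: lc_opp. Qed.
Lemma lc_sum (I : Type) (r : seq I) (P : pred I) (F : I -> tensor V) :
  (forall i, P i -> S (F i)) -> S (\sum_(i <- r | P i) F i).
Proof. by move=> h; apply: big_rec => // i D Pi; apply: lc_add; exact: h. Qed.
End Linear.

(** * Wedge product with a one-form and derivations of forms *)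

Section Skew.
Context {R : realType} {V : lmodType R}.
Implicit Types (D E : tensor V) (x y z : V) (c : R) (p k : nat).

Lemma skew_add p D E : skew_form p D -> skew_form p E -> skew_form p (D + E).
Proof. exact: lc_add (skew_lc (p:=p)) _ _. Qed.
Lemma skew_scale p c D : skew_form p D -> skew_form p (c *: D).
Proof. exact: lc_scale (skew_0 p) (skew_lc (p:=p)) _ _. Qed.
Lemma skew_opp p D : skew_form p D -> skew_form p (- D).
Proof. exact: lc_opp (skew_0 p) (skew_lc (p:=p)) _. Qed.
Lemma skew_sub p D E : skew_form p D -> skew_form p E -> skew_form p (D - E).
Proof. exact: lc_sub (skew_0 p) (skew_lc (p:=p)) _ _. Qed.
Lemma skew_sum p (I : Type) (r : seq I) (P : pred I) (F : I -> tensor V) :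
  (forall i, P i -> skew_form p (F i)) -> skew_form p (\sum_(i <- r | P i) F i).
Proof. exact: lc_sum (skew_0 p) (skew_lc (p:=p)) _ _ _ _. Qed.

(* The wedge product al /\ D with a one-form al, for D of degree p.            *)
Definition w1 (al : V -> R) p D : tensor V := fun v =>
  \sum_(k < p.+1) (-1) ^+ k * al (v k) * D (vdel k v).

Lemma w1_is_linear al p : linear (w1 al p).
Proof.
move=> c D E; apply/funext => v.
rewrite !tensorE /w1 mulr_sumr -big_split /=.
by apply: eq_bigr => k _; rewrite !tensorE; ring.
Qed.
HB.instance Definition _ al p :=
  GRing.isLinear.Build R (tensor V) (tensor V) *:%R (w1 al p) (w1_is_linear al p).

(** The antiderivation rule; the case split on [p] removes the second term in degree 0, where there
    is nothing left to contract. *)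
Lemma iprod_w1 al p D y :
  iprod y (w1 al p D) = al y *: D - (if p is q.+1 then w1 al q (iprod y D) else 0).
Proof.
apply/funext => v; rewrite /iprod /w1 big_ord_recl /= expr0 mul1r vdel0 vshift1_cons.
rewrite !tensorE; congr (_ + _).
case: p => [|q]; first by rewrite big_ord0 !tensorE oppr0.
rewrite /w1 -sumrN; apply: eq_bigr => k _; rewrite /bump /= add1n vdel_cons.
by rewrite exprS mulN1r !mulNr.
Qed.

Lemma iprod_w1S al p D y :
  iprod y (w1 al p.+1 D) = al y *: D - w1 al p (iprod y D).
Proof. exact: iprod_w1. Qed.
Lemma iprod_w10 al D y : iprod y (w1 al 0 D) = al y *: D.
Proof. by rewrite iprod_w1 subr0. Qed.

Definition linform al := forall (c : R) (x y : V), al (c *: x + y) = c * al x + al y.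

Lemma skew_w1 al p D : linform al -> skew_form p D -> skew_form p.+1 (w1 al p D).
Proof.
move=> lal; elim: p D => [|p IH] D s.
  apply/skew_formS; split=> // [c x y|x]; rewrite !iprod_w10.
    by rewrite lal scalerDl scalerA.
  exact: skew_scale.
apply/skew_formS; split=> [c x y|x|_ x]; rewrite !iprod_w1S.
- rewrite lal (skew_lin0 s) linearP /= scalerDl -!scalerA scalerBr.
  by rewrite opprD addrACA.
- by apply: skew_sub; [exact: skew_scale | exact: IH (skew_iprod x s)].
- rewrite linearB linearZ /=; case: p IH s => [|p] IH s.
    by rewrite iprod_w10 subrr.
  by rewrite iprod_w1S (skew_iprod2 x s) linear0 subr0 subrr.
Qed.

Lemma w1_lin al be c p D :
  w1 (fun v => c * al v + be v) p D = c *: w1 al p D + w1 be p D.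
Proof.
apply/funext => v; rewrite !tensorE /w1 mulr_sumr -big_split /=.
by apply: eq_bigr => k _; ring.
Qed.

Lemma w1_anti al be p D :
  w1 al p.+1 (w1 be p D) = - w1 be p.+1 (w1 al p D).
Proof.
elim: p D => [|p IH] D; apply: tensor_ext => y; rewrite linearN /= !iprod_w1S.
  rewrite !iprod_w10 !linearZ /=; apply/funext => v.
  rewrite !tensorE /w1 !big_ord1 /= !vdel0; ring.
rewrite !linearB !linearZ /= IH; tring.
Qed.

(* The derivation of p-forms induced by A.                                     *)
Definition der p (A : V -> V) D : tensor V := fun v =>
  \sum_(k < p) D (vset v k (A (v k))).

Lemma der_is_linear p A : linear (der p A).
Proof.
move=> c D E; apply/funext => v.
by rewrite !tensorE /der mulr_sumr -big_split.
Qed.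
HB.instance Definition _ p A :=
  GRing.isLinear.Build R (tensor V) (tensor V) *:%R (der p A) (der_is_linear p A).

Lemma derD p A D E : der p A (D + E) = der p A (D) + der p A (E). Proof. exact: linearD. Qed.
Lemma derZ p A c D : der p A (c *: D) = c *: der p A (D). Proof. exact: linearZ. Qed.
Lemma der_sum p A (I : Type) (r : seq I) (P : pred I) (G : I -> tensor V) :
 der p A (\sum_(i <- r | P i) G i) = \sum_(i <- r | P i) der p A (G i). Proof. exact: linear_sum. Qed.

Lemma iprod_der p A D y :
  iprod y (der p.+1 A D) = iprod (A y) D + der p A (iprod y D).
Proof.
apply/funext => v; rewrite /iprod /der big_ord_recl /= vset_cons0.
rewrite [RHS]tensorE; congr (_ + _).
by apply: eq_bigr => k _; rewrite /bump /= add1n vset_consS.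
Qed.

Lemma der0 A D : der 0 A D = 0.
Proof. by apply/funext => v; rewrite /der big_ord0. Qed.

Lemma der_w1 al p A D :
  der p.+1 A (w1 al p D) = w1 (al \o A) p D + w1 al p (der p A D).
Proof.
elim: p D => [|p IH] D; apply: tensor_ext => y; rewrite iprod_der linearD /=.
  by rewrite iprod_w10 !der0 linear0 !addr0 iprod_w10.
rewrite !iprod_w1S !linearB linearZ /= IH iprod_der !linearD /=.
tring.
Qed.

End Skew.

Lemma w1_def {R : realType} {V : lmodType R} (al : V -> R) p (D : tensor V) v :
  w1 al p D v = \sum_(k < p.+1) (-1) ^+ k * al (v k) * D (vdel k v).
Proof. by []. Qed.
Lemma der_def {R : realType} {V : lmodType R} p (A : V -> V) (D : tensor V) v :
  der p A D v = \sum_(k < p) D (vset v k (A (v k))).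
Proof. by []. Qed.
#[global] Opaque w1 der.

(** * Wedge and alternation: from sums over permutations to expansions along slots *)

Section Perms.
Context {R : realType} {V : lmodType R}.
Implicit Types (b : tensor V) (v : nat -> V).

Lemma vpermE N (s : 'S_N) v (k : 'I_N) : vperm s v k = v (s k).
Proof. by rewrite /vperm valK. Qed.

Lemma vperm_out N (s : 'S_N) v k : (N <= k)%N -> vperm s v k = v k.
Proof. by move=> h; rewrite /vperm insubF // ltnNge h. Qed.

Lemma vpermM N (s t : 'S_N) v : vperm (s * t) v = vperm s (vperm t v).
Proof.
apply/funext => k; case: (ltnP k N) => kN; last by rewrite !vperm_out.
by rewrite -[k]/(nat_of_ord (Ordinal kN)) !vpermE permM.
Qed.

Lemma vperm1 N v : vperm (1 : 'S_N) v = v.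
Proof.
apply/funext => k; case: (ltnP k N) => kN; last by rewrite !vperm_out.
by rewrite -[k]/(nat_of_ord (Ordinal kN)) !vpermE perm1.
Qed.

Lemma vset_same v i : vset v i (v i) = v.
Proof. by apply/funext => k; rewrite /vset; case: eqP => // ->. Qed.

Lemma skew_swap p b v i j x y : skew_form p b -> (i < p)%N -> (j < p)%N ->
  i != j -> b (vset (vset v i x) j y) = - b (vset (vset v i y) j x).
Proof.
move=> [[_ m] a] ip jp ij.
have com z w : vset (vset v i z) j w = vset (vset v j w) i z.
  apply/funext => k; rewrite /vset; case: (eqVneq k j) => // ->.
  by rewrite eq_sym (negbTE ij).
have z0 z : b (vset (vset v i z) j z) = 0.
  wlog lij : i j ip jp ij com / (i < j)%N => [hw|].
    case: (ltnP i j) => [lij|]; first exact: (hw i j ip jp ij com lij).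
    rewrite leq_eqVlt eq_sym (negbTE ij) /= => lji; rewrite com.
    have ji : j != i by rewrite eq_sym.
    by apply: (hw j i jp ip ji _ lji) => z' w'; rewrite com.
  by apply: (a _ i j) => //; rewrite /vset !eqxx (negbTE ij).
have := z0 (x + y).
have m1 z z' w i' : (i' < p)%N -> b (vset w i' (z + z')) = b (vset w i' z) + b (vset w i' z').
  by move=> h; have := m i' w 1 z z' h; rewrite scale1r mul1r.
rewrite m1 // !com !m1 // -!com !z0 add0r addr0 addrC => /eqP.
by rewrite addr_eq0 => /eqP.
Qed.

Lemma skew_tperm p b v (i j : 'I_p) : skew_form p b -> i != j ->
  b (vperm (tperm i j) v) = - b v.
Proof.
move=> s ij; have -> : b v = b (vset (vset v i (v i)) j (v j)) by rewrite !vset_same.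
rewrite (skew_swap v _ _ s) // opprK; congr (b _); apply/funext => k.
rewrite /vset -!val_eqE /= in ij *.
case: (ltnP k p) => kp; last first.
  by rewrite vperm_out // !gtn_eqF //; exact: leq_trans (ltn_ord _) kp.
rewrite -[k]/(nat_of_ord (Ordinal kp)) vpermE permE /= -!val_eqE /=.
have ji := ij; rewrite eq_sym in ji.
case: (eqVneq k j) => [kj|kj]; case: (eqVneq k i) => [ki|ki] //=.
by move: ji; rewrite -kj ki eqxx.
Qed.

Lemma skew_perm p b v (s : 'S_p) : skew_form p b ->
  b (vperm s v) = (-1) ^+ s * b v.
Proof.
move=> sk; case: (prod_tpermP s) => ts -> {s}.
elim: ts v => [|t ts IH] v /=.
  by rewrite big_nil vperm1 odd_perm1 expr0 mul1r.
case/andP=> t12 /IH{}IH; rewrite big_cons vpermM skew_tperm // IH.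
by rewrite odd_permM odd_tperm t12 signr_addb expr1 mulN1r mulNr.
Qed.

(** Laplace expansion along the image [k] of [i0]. The choice [ord0] peels off a one-form on the
    left, the choice [ord_max] a two-form on the right. *)
Lemma sum_lift_perm N (i0 : 'I_N.+1) (G : 'S_N.+1 -> R) :
  \sum_(s : 'S_N.+1) (-1) ^+ s * G s =
  \sum_(k < N.+1) (-1) ^+ (i0 + k) *
     \sum_(t : 'S_N) (-1) ^+ t * G (lift_perm i0 k t).
Proof.
have inj : injective (fun kt : 'I_N.+1 * 'S_N => lift_perm i0 kt.1 kt.2).
  move=> [k t] [k' t'] /= e.
  have ek : k = k' by rewrite -(lift_perm_id i0 k t) e lift_perm_id.
  rewrite -{k'}ek in e *; congr (_, _); apply/permP => j; apply: (@lift_inj _ k).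
  by rewrite -!(lift_perm_lift i0) e.
rewrite (reindex (fun kt : 'I_N.+1 * 'S_N => lift_perm i0 kt.1 kt.2)) /=; last first.
  by apply/onW_bij/(inj_card_bij inj); rewrite card_prod card_ord !card_Sn factS.
rewrite -(pair_bigA _ (fun k t => (-1) ^+ (lift_perm i0 k t) * G (lift_perm i0 k t))).
apply: eq_bigr => k _; rewrite mulr_sumr; apply: eq_bigr => t _.
by rewrite odd_lift_perm signr_addb signr_addb !signr_odd -exprD mulrA.
Qed.

Lemma vperm_lift0 N (k : 'I_N.+1) (t : 'S_N) v :
  vperm (lift_perm ord0 k t) v = vcons (v k) (vperm t (vdel k v)).
Proof.
apply/funext => -[|j] /=.
  by rewrite -[0%N]/(nat_of_ord (@ord0 N)) vpermE lift_perm_id.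
case: (ltnP j N) => jN.
  rewrite -[j.+1]/(nat_of_ord (lift ord0 (Ordinal jN))) vpermE lift_perm_lift.
  by rewrite -[j]/(nat_of_ord (Ordinal jN)) vpermE.
have kj : (k <= j)%N by rewrite -ltnS (leq_trans (ltn_ord k)).
by rewrite !vperm_out // /vdel /bump kj.
Qed.

Lemma vperm_lift_max_lt N (k : 'I_N.+1) (t : 'S_N) v j : (j < N)%N ->
  vperm (lift_perm ord_max k t) v j = vperm t (vdel k v) j.
Proof.
move=> jN; have -> : j = lift ord_max (Ordinal jN) :> nat by rewrite lift_max.
by rewrite vpermE lift_perm_lift lift_max vpermE.
Qed.

Lemma vperm_lift_max N (k : 'I_N.+1) (t : 'S_N) v :
  vperm (lift_perm ord_max k t) v N = v k.
Proof. by rewrite -[N]/(nat_of_ord (@ord_max N)) vpermE lift_perm_id. Qed.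

Lemma card_sum_perm N (x : R) : \sum_(t : 'S_N) x = N`!%:R * x.
Proof. by rewrite sumr_const card_Sn mulr_natl. Qed.

Lemma fact_neq0 N : N`!%:R != 0 :> R.
Proof. by rewrite pnatr_eq0 -lt0n fact_gt0. Qed.

Lemma sign_cancel (s : bool) (x : R) : (-1) ^+ s * ((-1) ^+ s * x) = x.
Proof. by case: s; rewrite ?mul1r ?mulN1r ?opprK. Qed.

Lemma sign_cancel2 (s : bool) (x y : R) : (-1) ^+ s * (x * ((-1) ^+ s * y)) = x * y.
Proof. by rewrite mulrCA sign_cancel. Qed.

Lemma wedge1E q (a b : tensor V) : multilinear 1 a -> skew_form q b ->
  wedge 1 q a b = w1 (fun x => a (fun=> x)) q b.
Proof.
move=> [ma _] sb; apply/funext => v; rewrite /wedge w1_def.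
under eq_bigr do rewrite -mulrA.
rewrite (sum_lift_perm ord0) mulr_sumr; apply: eq_bigr => k _.
rewrite add0n; under eq_bigr => t _.
  rewrite vperm_lift0 vshift1_cons (skew_perm _ _ sb).
  rewrite (ma _ (fun=> v k)); last by case.
  rewrite sign_cancel2; over.
rewrite card_sum_perm (mul1n q`!).
by rewrite mulrCA [X in _ * X]mulKf ?fact_neq0 // mulrA.
Qed.

Lemma alternationE n (b : tensor V) : (forall x, skew_form n (iprod x b)) ->
  alternation n b = fun v => \sum_(k < n.+1) (-1) ^+ k * b (vcons (v k) (vdel k v)).
Proof.
move=> sb; apply/funext => v; rewrite /alternation.
rewrite (sum_lift_perm ord0) mulr_sumr; apply: eq_bigr => k _.
rewrite add0n; under eq_bigr => t _.
  rewrite vperm_lift0 -/(iprod (v k) b _) (skew_perm _ _ (sb _)).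
  rewrite sign_cancel; over.
by rewrite card_sum_perm mulrCA [X in _ * X]mulKf ?fact_neq0.
Qed.

Lemma wedge2E p (c : tensor V) (om : V -> V -> R) : skew_form p c ->
  (forall x y, om x y = - om y x) ->
  wedge p 2 c (fun v => om (v 0%N) (v 1%N)) = fun v =>
  2^-1 * \sum_(k < p.+2) \sum_(l < p.+1)
   (-1) ^+ (k + l) * om (v k) (vdel k v l) * c (vdel l (vdel k v)).
Proof.
move=> sc anti; apply/funext => v; rewrite /wedge addn2 natrM invfM [_^-1 * 2`!%:R^-1]mulrC.
rewrite -mulrA; congr (_^-1 * _); rewrite /vshift addn0 addn1.
under eq_bigr do rewrite -mulrA.
rewrite (sum_lift_perm ord_max) mulr_sumr; apply: eq_bigr => k _.
rewrite (sum_lift_perm ord_max) 2!mulr_sumr; apply: eq_bigr => l _.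
under eq_bigr => t _.
  rewrite vperm_lift_max vperm_lift_max_lt // vperm_lift_max.
  rewrite (sc.1.1 _ (vperm t (vdel l (vdel k v)))); last first.
    by move=> j jp; rewrite !vperm_lift_max_lt // ltnS ltnW.
  rewrite (skew_perm _ _ sc) -!mulrA sign_cancel; over.
(* The two expansions together carry the sign (-1)^(2p+1), which the skewness of [om]
   compensates. *)
rewrite card_sum_perm anti /=.
rewrite !exprD exprS; set P := (-1) ^+ p; have PP : P * P = 1.
  by rewrite /P -expr2 -exprM mulnC exprM sqrrN expr1n expr1n.
by field: PP; exact: fact_neq0.
Qed.

End Perms.

(** * Metric operators: I on the first slot, wedge with a vector, and its (p,0) projection *)

HB.lock Definition II {R : realType} {V : lmodType R} (F : su_data V)
  (D : tensor V) : tensor V := Islot F 0 D.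

HB.lock Definition W {R : realType} {V : lmodType R} (F : su_data V) p x
  (D : tensor V) : tensor V := w1 (fun y => ip F y x) p D.

(* The wedge product with x, its projection to type (p+1,0) up to a factor 2,  *)
(* when D has type (p,0).                                                      *)
HB.lock Definition Th {R : realType} {V : lmodType R} (F : su_data V) p x
  (D : tensor V) : tensor V := W F p x D - W F p (Jc F x) (II F D).

Section Metric.
Context {R : realType} {V : lmodType R} (F : su_data V).
Local Notation g := (ip F).
Local Notation J := (Jc F).
Local Notation II := (II F).
Local Notation W := (W F).
Local Notation Th := (Th F).
Hypothesis HG : inner_product F.
Hypothesis HJ : orthogonal_complex_structure F.
Implicit Types (D E : tensor V) (v w : nat -> V) (x y z : V) (c : R) (p k : nat).

Lemma gC x y : g x y = g y x. Proof. by case: HG. Qed.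
Lemma glcl c x y z : g (c *: x + y) z = c * g x z + g y z.
Proof. by case: HG. Qed.
Lemma glcr c x y z : g z (c *: x + y) = c * g z x + g z y.
Proof. by rewrite gC glcl !(gC z). Qed.
Lemma g0l z : g 0 z = 0.
Proof. by have := glcl (-1) 0 0 z; rewrite scaleN1r oppr0 addr0 mulN1r addNr. Qed.
Lemma gDl x y z : g (x + y) z = g x z + g y z.
Proof. by have := glcl 1 x y z; rewrite scale1r mul1r. Qed.
Lemma gZl c x z : g (c *: x) z = c * g x z.
Proof. by have := glcl c x 0 z; rewrite g0l !addr0. Qed.
Lemma gNl x z : g (- x) z = - g x z.
Proof. by rewrite -scaleN1r gZl mulN1r. Qed.
Lemma gNr x z : g z (- x) = - g z x.
Proof. by rewrite gC gNl gC. Qed.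
Lemma gDr x y z : g z (x + y) = g z x + g z y.
Proof. by rewrite gC gDl !(gC z). Qed.
Lemma gZr c x z : g z (c *: x) = c * g z x.
Proof. by rewrite gC gZl gC. Qed.
Lemma g_suml (I : Type) (r : seq I) (P : pred I) (f : I -> V) z :
  g (\sum_(i <- r | P i) f i) z = \sum_(i <- r | P i) g (f i) z.
Proof.
elim/big_rec2: _ => [|i x s _ <-]; first exact: g0l.
by rewrite gDl.
Qed.
Lemma g_sumr (I : Type) (r : seq I) (P : pred I) (f : I -> V) z :
  g z (\sum_(i <- r | P i) f i) = \sum_(i <- r | P i) g z (f i).
Proof. by rewrite gC g_suml; apply: eq_bigr => i _; rewrite gC. Qed.

Lemma Jlc c x y : J (c *: x + y) = c *: J x + J y. Proof. by case: HJ. Qed.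
Lemma JJ x : J (J x) = - x. Proof. by case: HJ. Qed.
Lemma gJJ x y : g (J x) (J y) = g x y. Proof. by case: HJ. Qed.
Lemma gJ x y : g (J x) y = - g x (J y).
Proof. by rewrite -(gJJ (J x) y) JJ gNl. Qed.
Lemma gJr x y : g x (J y) = - g (J x) y. Proof. by rewrite gJ opprK. Qed.
Lemma J0 : J 0 = 0.
Proof. by have := Jlc (-1) 0 0; rewrite scaleN1r oppr0 addr0 scaleN1r addNr. Qed.
Lemma JD x y : J (x + y) = J x + J y.
Proof. by have := Jlc 1 x y; rewrite !scale1r. Qed.
Lemma JZ c x : J (c *: x) = c *: J x.
Proof. by have := Jlc c x 0; rewrite J0 !addr0. Qed.
Lemma JN x : J (- x) = - J x.
Proof. by rewrite -scaleN1r JZ scaleN1r. Qed.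

Lemma W_def p x D : W p x D = w1 (fun y => g y x) p D.
Proof. by rewrite W.unlock. Qed.
Lemma W_is_linear p x : linear (W p x).
Proof. by move=> c D E; rewrite !W_def linearP. Qed.
HB.instance Definition _ p x :=
  GRing.isLinear.Build R (tensor V) (tensor V) *:%R (W p x) (W_is_linear p x).

Lemma WrD p x D E : W p x (D + E) = W p x (D) + W p x (E). Proof. exact: linearD. Qed.
Lemma WrN p x D : W p x (- D) = - W p x (D). Proof. exact: linearN. Qed.
Lemma WrB p x D E : W p x (D - E) = W p x (D) - W p x (E). Proof. exact: linearB. Qed.
Lemma WrZ p x c D : W p x (c *: D) = c *: W p x (D). Proof. exact: linearZ. Qed.
Lemma Wr0 p x : W p x (0) = 0. Proof. exact: linear0. Qed.
Lemma Wr_sum p x (I : Type) (r : seq I) (P : pred I) (G : I -> tensor V) :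
 W p x (\sum_(i <- r | P i) G i) = \sum_(i <- r | P i) W p x (G i). Proof. exact: linear_sum. Qed.

Lemma flat_lin x : linform (fun y => g y x).
Proof. by move=> c y z; rewrite glcl. Qed.

Lemma W_lc p c x y D : W p (c *: x + y) D = c *: W p x D + W p y D.
Proof.
by rewrite !W_def -w1_lin; congr (w1 _ p D); apply/funext => z; rewrite glcr.
Qed.
Lemma W0 p D : W p 0 D = 0.
Proof.
have := W_lc p (-1) 0 0 D; rewrite scaleN1r oppr0 addr0 => ->.
by rewrite scaleN1r addNr.
Qed.
Lemma WN p x D : W p (- x) D = - W p x D.
Proof. by have := W_lc p (-1) x 0 D; rewrite W0 !addr0 !scaleN1r. Qed.
Lemma WZ p c x D : W p (c *: x) D = c *: W p x D.
Proof. by have := W_lc p c x 0 D; rewrite W0 !addr0. Qed.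
Lemma iprod_WS p x D y : iprod y (W p.+1 x D) = g y x *: D - W p x (iprod y D).
Proof. by rewrite !W_def iprod_w1S. Qed.
Lemma iprod_W0 x D y : iprod y (W 0 x D) = g y x *: D.
Proof. by rewrite W_def iprod_w10. Qed.
Lemma iprod_W p x D y : iprod y (W p x D) =
  g y x *: D - (if p is q.+1 then W q x (iprod y D) else 0).
Proof. by rewrite W_def iprod_w1; case: p => // p; rewrite W_def. Qed.
Lemma skew_W p x D : skew_form p D -> skew_form p.+1 (W p x D).
Proof. by rewrite W_def; exact: skew_w1 (flat_lin x). Qed.
Lemma W_anti p x y D : W p.+1 x (W p y D) = - W p.+1 y (W p x D).
Proof. by rewrite !W_def w1_anti. Qed.
Lemma W_sq p x D : W p.+1 x (W p x D) = 0.
Proof.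
have h := W_anti p x x D; apply/funext => v; have := congr1 (@^~ v) h.
rewrite /= tensorN tensor0; lra.
Qed.

Lemma skew_flat x : skew_form 1 (flat F x).
Proof.
have -> : flat F x = W 0 x (cst 1).
  by apply/funext => v; rewrite W_def w1_def big_ord1 /= expr0 mul1r mulr1.
by apply: skew_W; split=> //; apply/multilinear0.
Qed.

Lemma wedge_flat p x D : skew_form p D -> wedge 1 p (flat F x) D = W p x D.
Proof. by move=> s; rewrite W_def wedge1E //; have [] := skew_flat x. Qed.

Lemma II_is_linear : linear II.
Proof. by move=> c D E; apply/funext => v; rewrite II.unlock /Islot !tensorE; ring. Qed.
HB.instance Definition _ :=
  GRing.isLinear.Build R (tensor V) (tensor V) *:%R II II_is_linear.

Lemma IID D E : II (D + E) = II (D) + II (E). Proof. exact: linearD. Qed.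
Lemma IIB D E : II (D - E) = II (D) - II (E). Proof. exact: linearB. Qed.
Lemma IIZ c D : II (c *: D) = c *: II (D). Proof. exact: linearZ. Qed.
Lemma II_0 : II (0) = 0. Proof. exact: linear0. Qed.
Lemma II_sum (I : Type) (r : seq I) (P : pred I) (G : I -> tensor V) :
 II (\sum_(i <- r | P i) G i) = \sum_(i <- r | P i) II (G i). Proof. exact: linear_sum. Qed.

Lemma iprod_II y D : iprod y (II D) = - iprod (J y) D.
Proof. by apply/funext => v; rewrite II.unlock /Islot /iprod vset_cons0 tensorN. Qed.

Lemma II_II D : lin0 D -> II (II D) = - D.
Proof.
move=> l; apply: tensor_ext => y; rewrite !iprod_II JJ lin0N // opprK.
by rewrite linearN.
Qed.

Lemma Th_is_linear p x : linear (Th p x).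
Proof. move=> c D E; rewrite !Th.unlock !linearP. tring. Qed.
HB.instance Definition _ p x :=
  GRing.isLinear.Build R (tensor V) (tensor V) *:%R (Th p x) (Th_is_linear p x).

Lemma ThD p x D E : Th p x (D + E) = Th p x (D) + Th p x (E). Proof. exact: linearD. Qed.
Lemma ThN p x D : Th p x (- D) = - Th p x (D). Proof. exact: linearN. Qed.
Lemma ThZ p x c D : Th p x (c *: D) = c *: Th p x (D). Proof. exact: linearZ. Qed.
Lemma Th0 p x : Th p x (0) = 0. Proof. exact: linear0. Qed.
Lemma Th_sum p x (I : Type) (r : seq I) (P : pred I) (G : I -> tensor V) :
 Th p x (\sum_(i <- r | P i) G i) = \sum_(i <- r | P i) Th p x (G i). Proof. exact: linear_sum. Qed.

Lemma Th_lc p c x y D : Th p (c *: x + y) D = c *: Th p x D + Th p y D.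
Proof. rewrite !Th.unlock Jlc !W_lc. tring. Qed.

Lemma Th_def p x D : Th p x D = W p x D - W p (J x) (II D).
Proof. by rewrite Th.unlock. Qed.

Lemma II_Th p x D : lin0 D -> II (Th p.+1 x D) = Th p.+1 x (II D).
Proof.
move=> l; apply: tensor_ext => z; rewrite 2!Th_def II_II // IIB !(ipB, ipD, ipN, WrN).
rewrite !iprod_II !iprod_WS !iprod_II JJ lin0N // !(WrN, gJ, gNr, JJ).
tring.
Qed.

Lemma Th_anti p x y D : lin0 D ->
  Th p.+2 x (Th p.+1 y D) = - Th p.+2 y (Th p.+1 x D).
Proof.
move=> l; rewrite !(Th_def p.+2) !II_Th // !Th_def II_II //.
rewrite !(WrB, WrN).
rewrite (W_anti _ x y) (W_anti _ x (J y)) (W_anti _ (J x) y) (W_anti _ (J x) (J y)).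
tring.
Qed.

Lemma iprod_Th p x D y :
  iprod y (Th p.+1 x D) = g y x *: D - g y (J x) *: II D
    - (W p x (iprod y D) - W p (J x) (iprod y (II D))).
Proof. by rewrite Th_def ipB !iprod_WS; tring. Qed.

End Metric.

(* The Lefschetz operator omega /\ D on forms of degree p, see [wedge_kahler]. *)
HB.lock Definition Lo {R : realType} {V : lmodType R} {n} (F : su_data V)
    (e : 'I_n.*2 -> V) p (D : tensor V) : tensor V :=
  - 2^-1 *: \sum_i W F p.+1 (e i) (W F p (Jc F (e i)) D).

(** The sum runs over all 2n basis vectors, so this is the usual adjoint of omega /\ . up to a
    factor -2; it sends omega to -2n. *)
HB.lock Definition Lam {R : realType} {V : lmodType R} {n} (F : su_data V)
    (e : 'I_n.*2 -> V) (D : tensor V) : tensor V :=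
  \sum_i iprod (Jc F (e i)) (iprod (e i) D).

(** * Traces over an orthonormal basis and the Lefschetz operators *)

Section Frame.
Context {R : realType} {V : lmodType R} (n : nat) (F : su_data V).
Variable e : 'I_n.*2 -> V.
Local Notation g := (ip F).
Local Notation J := (Jc F).
Local Notation II := (II F).
Local Notation W := (W F).
Local Notation Th := (Th F).
Local Notation Lo := (Lo F e).
Local Notation Lam := (Lam F e).
Hypothesis HG : inner_product F.
Hypothesis HJ : orthogonal_complex_structure F.
Hypothesis he : orthonormal_basis F e.
Hypothesis hspan : forall x, x = \sum_i g x (e i) *: e i.
Implicit Types (D E : tensor V) (v w : nat -> V) (x y z : V) (c : R) (p k : nat).

Section Sums.
Variable U : lmodType R.

Definition vlin (f : V -> U) := forall c x y, f (c *: x + y) = c *: f x + f y.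

Lemma vlin_sum (f : V -> U) (I : Type) (r : seq I) (P : pred I) (h : I -> V) : vlin f ->
  f (\sum_(i <- r | P i) h i) = \sum_(i <- r | P i) f (h i).
Proof.
move=> l; have f0 : f 0 = 0.
  by have := l (-1) 0 0; rewrite scaleN1r addr0 oppr0 scaleN1r addNr.
elim/big_rec2: _ => [|i x s _ <-]; first by [].
by have := l 1 (h i) s; rewrite !scale1r.
Qed.

Lemma vlinZ (f : V -> U) c x : vlin f -> f (c *: x) = c *: f x.
Proof.
move=> l; have f0 : f 0 = 0.
  by have := l (-1) 0 0; rewrite scaleN1r addr0 oppr0 scaleN1r addNr.
by have := l c x 0; rewrite f0 !addr0.
Qed.

Lemma sum_g (f : V -> U) x : vlin f -> \sum_i g x (e i) *: f (e i) = f x.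
Proof.
move=> l; rewrite [in RHS](hspan x) vlin_sum //.
by apply: eq_bigr => i _; rewrite vlinZ.
Qed.

(** Both sides equal the double sum of <A e_i, e_j> B(e_j, e_i). *)
Lemma sum_adj (B : V -> V -> U) (A At : V -> V) :
  (forall y, vlin (B^~ y)) -> (forall x, vlin (B x)) ->
  (forall x y, g (A x) y = g x (At y)) ->
  \sum_i B (A (e i)) (e i) = \sum_i B (e i) (At (e i)).
Proof.
move=> l1 l2 adj.
under eq_bigr => i _ do rewrite -(sum_g (A (e i)) (l1 (e i))).
rewrite exchange_big /=; apply: eq_bigr => j _.
under eq_bigr => i _ do rewrite adj gC //.
exact: sum_g (l2 (e j)).
Qed.

Lemma sum_J (B : V -> V -> U) :
  (forall y, vlin (B^~ y)) -> (forall x, vlin (B x)) ->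
  \sum_i B (J (e i)) (e i) = - \sum_i B (e i) (J (e i)).
Proof.
move=> l1 l2; rewrite (sum_adj (A := J) (At := fun y => - J y) l1 l2) => [|x y].
  rewrite -sumrN; apply: eq_bigr => i _.
  by rewrite -scaleN1r vlinZ // scaleN1r.
by rewrite gJ // gNr.
Qed.

Lemma sum_JJ (B : V -> V -> U) :
  (forall y, vlin (B^~ y)) -> (forall x, vlin (B x)) ->
  \sum_i B (J (e i)) (J (e i)) = \sum_i B (e i) (e i).
Proof.
move=> l1 l2; rewrite (sum_J (B := fun x y => B x (J y))) //; last first.
  by move=> x c y z; rewrite Jlc // l2.
rewrite -sumrN; apply: eq_bigr => i _.
by rewrite JJ // -[- e i]scaleN1r vlinZ // scaleN1r opprK.
Qed.

End Sums.

Lemma sum_gg x y : \sum_i g x (e i) * g y (e i) = g x y.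
Proof.
rewrite [in RHS](hspan y) g_sumr //; apply: eq_bigr => i _.
by rewrite gZr // mulrC.
Qed.

Lemma sum_WgJ p y D : \sum_i g y (e i) *: W p (J (e i)) D = W p (J y) D.
Proof. by apply: (sum_g (f := fun x => W p (J x) D)) => c x z; rewrite Jlc // W_lc. Qed.
Lemma sum_Wg p y D : \sum_i g y (e i) *: W p (e i) D = W p y D.
Proof. by apply: (sum_g (f := fun x => W p x D)) => c x z; rewrite W_lc. Qed.
Lemma sum_ipg y D : lin0 D -> \sum_i g y (e i) *: iprod (e i) D = iprod y D.
Proof. by move=> l; apply: (sum_g (f := fun x => iprod x D)). Qed.

(** Identifies the wedge sums in the definition of Xi with derivations; this is how nabla I enters
    in [iprod_Xip_na] and [iprod_Xim_na]. *)
Lemma sum_W_der p (A At : V -> V) D : skew_form p.+1 D ->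
  (forall x y, g (A x) y = g x (At y)) ->
  \sum_i W p (A (e i)) (iprod (e i) D) = der p.+1 At D.
Proof.
move=> s adj; elim: p D s => [|p IH] D s; apply: tensor_ext => y.
  rewrite iprod_der der0 addr0 ip_sum -(sum_ipg (At y)); last exact: skew_lin0 s.
  apply: eq_bigr => i _.
  by rewrite iprod_W0 gC // adj gC.
rewrite iprod_der -(IH _ (skew_iprod y s)) ip_sum.
under eq_bigr => i _.
  rewrite iprod_WS (skew_anti _ _ s) WrN opprK gC // adj gC //; over.
by rewrite big_split /= sum_ipg //; exact: skew_lin0 s.
Qed.

Lemma der_id p D : skew_form p D -> der p id D = p%:R *: D.
Proof.
move=> s; apply/funext => v; rewrite der_def tensorZ.
under eq_bigr do rewrite vset_same.
by rewrite sumr_const card_ord mulr_natl.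
Qed.

Lemma sum_W_ip p D : skew_form p.+1 D ->
  \sum_i W p (e i) (iprod (e i) D) = p.+1%:R *: D.
Proof. by move=> s; rewrite (sum_W_der (A := id) (At := id) s) // der_id. Qed.

Lemma Lo_def p D : Lo p D = - 2^-1 *: \sum_i W p.+1 (e i) (W p (J (e i)) D).
Proof. by rewrite Lo.unlock. Qed.
Lemma Lo_is_linear p : linear (Lo p).
Proof.
move=> c D E; rewrite !Lo_def scalerA mulrC -scalerA -scalerDr; congr (_ *: _).
rewrite scaler_sumr -big_split; apply: eq_bigr => i _.
by rewrite /= !(WrD, WrZ).
Qed.
HB.instance Definition _ p :=
  GRing.isLinear.Build R (tensor V) (tensor V) *:%R (Lo p) (Lo_is_linear p).

Lemma LoD p D E : Lo p (D + E) = Lo p (D) + Lo p (E). Proof. exact: linearD. Qed.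
Lemma LoN p D : Lo p (- D) = - Lo p (D). Proof. exact: linearN. Qed.
Lemma LoZ p c D : Lo p (c *: D) = c *: Lo p (D). Proof. exact: linearZ. Qed.
Lemma Lo0 p : Lo p (0) = 0. Proof. exact: linear0. Qed.
Lemma Lo_sum p (I : Type) (r : seq I) (P : pred I) (G : I -> tensor V) :
 Lo p (\sum_(i <- r | P i) G i) = \sum_(i <- r | P i) Lo p (G i). Proof. exact: linear_sum. Qed.

Lemma iprod_Lo p D y : iprod y (Lo p D) =
  - W p (J y) D + (if p is q.+1 then Lo q (iprod y D) else 0).
Proof.
rewrite Lo_def ipZ ip_sum.
have h1 : \sum_i g y (J (e i)) *: W p (e i) D = - W p (J y) D.
  rewrite -(sum_Wg p (J y) D) -sumrN; apply: eq_bigr => i _.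
  by rewrite gJr // scaleNr.
under eq_bigr => i _ do rewrite iprod_WS iprod_W WrB WrZ.
rewrite 2!sumrB sum_WgJ h1; case: p {h1} => [|q].
  under [X in _ - (_ - X)]eq_bigr => i _ do rewrite Wr0.
  by rewrite big1 //; apply/funext => v; rewrite !tensorE; field.
by rewrite Lo_def; set S := \sum_i _; apply/funext => v; rewrite !tensorE; field.
Qed.

Lemma iprod_LoS p D y : iprod y (Lo p.+1 D) = - W p.+1 (J y) D + Lo p (iprod y D).
Proof. exact: iprod_Lo. Qed.

Lemma skew_Lo p D : skew_form p D -> skew_form p.+2 (Lo p D).
Proof.
move=> s; rewrite Lo_def; apply: skew_scale; apply: skew_sum => i _.
by apply: (skew_W HG); apply: (skew_W HG).
Qed.

Lemma W_Lo p x D : W p.+2 x (Lo p D) = Lo p.+1 (W p x D).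
Proof.
rewrite !Lo_def WrZ Wr_sum; congr (_ *: _); apply: eq_bigr => i _.
by rewrite W_anti (W_anti _ _ x) WrN opprK.
Qed.

Lemma wedge_kahler p D : skew_form p D -> wedge p 2 D (kahler F) = Lo p D.
Proof.
move=> s; rewrite (wedge2E (om := fun x y => g x (J y)) s); last first.
  by move=> x y; rewrite gJr // gC.
apply/funext => v; rewrite Lo_def tensorZ tensor_sum mulNr -mulrN -sumrN; congr (_ * _).
under [RHS]eq_bigr => i _ do rewrite W_def // w1_def -sumrN.
rewrite [RHS]exchange_big /=; apply: eq_bigr => k _.
under [RHS]eq_bigr => i _ do rewrite W_def // w1_def mulr_sumr -sumrN.
rewrite [RHS]exchange_big /=; apply: eq_bigr => l _.
rewrite exprD -sum_gg mulr_sumr mulr_suml.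
by apply: eq_bigr => i _; rewrite (gJ HG HJ); ring.
Qed.

Lemma Lam_def D : Lam D = \sum_i iprod (J (e i)) (iprod (e i) D).
Proof. by rewrite Lam.unlock. Qed.
Lemma Lam_is_linear : linear Lam.
Proof.
move=> c D E; rewrite !Lam_def.
rewrite scaler_sumr -big_split; apply: eq_bigr => i _.
by rewrite /= !(ipD, ipZ).
Qed.
HB.instance Definition _ :=
  GRing.isLinear.Build R (tensor V) (tensor V) *:%R Lam Lam_is_linear.

Lemma LamD D E : Lam (D + E) = Lam (D) + Lam (E). Proof. exact: linearD. Qed.
Lemma LamZ c D : Lam (c *: D) = c *: Lam (D). Proof. exact: linearZ. Qed.
Lemma Lam0 : Lam (0) = 0. Proof. exact: linear0. Qed.
Lemma Lam_sum (I : Type) (r : seq I) (P : pred I) (G : I -> tensor V) :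
 Lam (\sum_(i <- r | P i) G i) = \sum_(i <- r | P i) Lam (G i). Proof. exact: linear_sum. Qed.

(** The Lefschetz commutator. Contracting omega with both vectors gives -2n; contracting it with
    only one of the two gives the degree of [D], once for each of them. *)
Lemma Lam_Lo p D : skew_form p D -> Lam (Lo p D) =
  (p.*2%:R - n.*2%:R) *: D + (if p is q.+2 then Lo q (Lam D) else 0).
Proof.
move=> s; rewrite Lam_def.
have geJ i : g (J (e i)) (J (e i)) = 1 by rewrite gJJ // he eqxx.
have su : \sum_(i < n.*2) D = n.*2%:R *: D.
  by rewrite sumr_const card_ord scaler_nat.
case: p s => [|p] s.
  under eq_bigr => i _ do rewrite iprod_Lo addr0 ipN iprod_W0 geJ scale1r.
  by rewrite sumrN su sub0r addr0 scaleNr.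
under eq_bigr => i _.
  rewrite iprod_LoS ipD ipN iprod_WS geJ scale1r iprod_Lo JJ // WN // opprK; over.
rewrite !big_split /= sumrN sumrB su.
rewrite (sum_JJ (B := fun x y => W p x (iprod y D))); last 2 first.
- by move=> y c x z; rewrite W_lc.
- by move=> x c y z; rewrite (skew_lin0 s) !(WrD, WrZ).
rewrite sum_W_ip //.
have -> : \sum_i (match p with 0 => 0 | q.+1 => Lo q (iprod (J (e i)) (iprod (e i) D)) end)
   = match p with 0 => 0 | q.+1 => Lo q (Lam D) end.
  by case: p {s} => [|q]; rewrite ?big1_eq // Lam_def Lo_sum.
rewrite -!addnn !natrD; set X := match p with 0 => _ | _ => _ end.
by apply/funext => v; rewrite !tensorE; ring.
Qed.

Lemma sum_ip_W p D : skew_form p.+1 D ->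
  \sum_i iprod (e i) (W p.+1 (e i) D) = (n.*2%:R - p.+1%:R) *: D.
Proof.
move=> s; under eq_bigr => i _ do rewrite iprod_WS he eqxx scale1r.
rewrite sumrB sum_W_ip // sumr_const card_ord -scaler_nat scalerBl //.
Qed.

(** Reconstructs [D] from the forms [Th e_i D] when its degree is below n; [lam_codim1] and
    [cont_rec] rest on it. *)
Lemma sum_ip_Th p D : skew_form p.+1 D ->
  \sum_i iprod (e i) (Th p.+1 (e i) D) = (n.*2%:R - p.+1.*2%:R) *: D.
Proof.
move=> s; under eq_bigr => i _ do rewrite Th_def ipB.
rewrite sumrB sum_ip_W //.
have -> : \sum_i iprod (e i) (W p.+1 (J (e i)) (II D)) = p.+1%:R *: D.
  under eq_bigr => i _.
    rewrite iprod_WS gC // gJ // iprod_II WrN opprK.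
    have -> : g (e i) (J (e i)) = 0.
      have := gJ HG HJ (e i) (e i); rewrite gC // => h; lra.
    rewrite oppr0 scale0r add0r; over.
  rewrite (sum_JJ (B := fun x y => W p x (iprod y D))) ?sum_W_ip //.
  - by move=> y c x z; rewrite W_lc.
  - by move=> x c y z; rewrite (skew_lin0 s) !(WrD, WrZ).
by rewrite -!addnn !natrD; tring.
Qed.

End Frame.

(** * Forms of type (p,0) *)

Section Lam.
Context {R : realType} {V : lmodType R} (F : su_data V).
Local Notation g := (ip F).
Local Notation J := (Jc F).
Local Notation II := (II F).
Local Notation W := (W F).
Local Notation Th := (Th F).
Local Notation lam := (lam F).
Hypothesis HG : inner_product F.
Hypothesis HJ : orthogonal_complex_structure F.
Implicit Types (D E : tensor V) (v w : nat -> V) (x y z : V) (c : R) (p k : nat).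

Lemma vset_neq v i j x : (j == i) = false -> vset v i x j = v j.
Proof. by rewrite /vset => ->. Qed.

Lemma lamP p D : lam p D <-> skew_form p D /\ forall v i j, (i < j)%N -> (j < p)%N ->
  D (vset (vset v i (J (v i))) j (J (v j))) = - D v.
Proof.
split=> -[s h]; (split; first exact: s).
  move=> v i j ij jp.
  have := congr1 (@^~ v) (h i j ij jp); rewrite /Islot /= opprK => <-.
  by rewrite vset_neq ?gtn_eqF.
move=> i j ij jp; apply/funext => v; rewrite /Islot opprK -(h v i j ij jp).
by rewrite vset_neq ?gtn_eqF.
Qed.

(** A pair of slots (0, j) with j > 1 is brought inside a contraction by exchanging the first two
    vectors, so only the first two slots need a separate condition. *)
Lemma lamS p D : lam p.+1 D <-> [/\ skew_form p.+1 D, forall x, lam p (iprod x D) &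
  (0 < p)%N -> forall x y, iprod (J x) (iprod (J y) D) = - iprod x (iprod y D)].
Proof.
split=> [/lamP[s h]|[s h1 h2]].
  split=> // [x|p0 x y].
    apply/lamP; split=> [|v i j ij jp]; first exact: skew_iprod s.
    by have := h (vcons x v) i.+1 j.+1 ij jp; rewrite vset_consS vset_consS.
  apply/funext => v; have := h (vcons y (vcons x v)) 0%N 1%N isT p0.
  by rewrite vset_cons0 vset_consS vset_cons0.
apply/lamP; split=> // v [|i] [|j] // ij jp; last first.
  by have /lamP[_ /(_ (vshift 1 v) i j ij jp)] := h1 (v 0%N);
    rewrite /iprod -!vset_consS vcons_eta.
rewrite ltnS in jp; case: p jp s h1 h2 => // p jp s h1 h2.
rewrite -(vcons_eta v) -(vcons_eta (vshift 1 v)).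
set a := v 0%N; set b := vshift 1 v 0%N; set w := vshift 1 (vshift 1 v).
rewrite vset_cons0 /=; case: j jp {ij} => [|j] jp; rewrite !vset_consS.
  rewrite vset_cons0 /=; exact: (congr1 (@^~ w) (h2 isT b a)).
have := congr1 (@^~ (vset w j (J (w j)))) (skew_anti b (J a) s).
rewrite /iprod tensorN /= => ->; apply/eqP; rewrite eqr_opp; apply/eqP.
have /lamP[_ /(_ (vcons a w) 0%N j.+1 isT jp)] := h1 b.
rewrite vset_cons0 vset_consS /iprod /= => ->.
by have := congr1 (@^~ w) (skew_anti a b s); rewrite /iprod tensorN => ->; rewrite opprK.
Qed.

Lemma lam_skew p D : lam p D -> skew_form p D.
Proof. by case. Qed.
Lemma lam_lin0 p D : lam p.+1 D -> lin0 D.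
Proof. by case=> /skew_lin0. Qed.
Lemma lam_iprod p D x : lam p.+1 D -> lam p (iprod x D).
Proof. by case/lamS. Qed.
Lemma lam_JJ p D x y : lam p.+2 D ->
  iprod (J x) (iprod (J y) D) = - iprod x (iprod y D).
Proof. by case/lamS => _ _; exact. Qed.

Lemma lam_J p D x y : lam p.+2 D -> iprod (J x) (iprod y D) = iprod x (iprod (J y) D).
Proof.
move=> l; have := lam_JJ x (J y) l; rewrite JJ // (lin0N _ (lam_lin0 l)).
by rewrite ipN => /oppr_inj.
Qed.

Lemma lam_0 p : lam p (0 : tensor V).
Proof. by apply/lamP; split=> [|*]; [exact: skew_0 | rewrite !tensorE oppr0]. Qed.
Lemma lam_lc p c D E : lam p D -> lam p E -> lam p (c *: D + E).
Proof.
move=> /lamP[s h] /lamP[s' h']; apply/lamP; split; first exact: skew_lc.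
by move=> v i j ij jp; rewrite !tensorE h // h' //; ring.
Qed.
Lemma lam_scale p c D : lam p D -> lam p (c *: D).
Proof. exact: lc_scale (lam_0 p) (lam_lc (p:=p)) _ _. Qed.
Lemma lam_opp p D : lam p D -> lam p (- D).
Proof. exact: lc_opp (lam_0 p) (lam_lc (p:=p)) _. Qed.
Lemma lam_sub p D E : lam p D -> lam p E -> lam p (D - E).
Proof. exact: lc_sub (lam_0 p) (lam_lc (p:=p)) _ _. Qed.
Lemma lam_sum p (I : Type) (r : seq I) (P : pred I) (G : I -> tensor V) :
  (forall i, P i -> lam p (G i)) -> lam p (\sum_(i <- r | P i) G i).
Proof. exact: lc_sum (lam_0 p) (lam_lc (p:=p)) _ _ _ _. Qed.

Lemma iprod_II_comm p D y : lam p.+2 D -> iprod y (II D) = II (iprod y D).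
Proof.
move=> l; rewrite iprod_II; apply: tensor_ext => z.
by rewrite ipN iprod_II (lam_J _ _ l).
Qed.

Lemma lin0_II D : lin0 D -> lin0 (II D).
Proof. by move=> l c x y; rewrite !iprod_II Jlc // l; tring. Qed.

Lemma lam_II p D : lam p.+1 D -> lam p.+1 (II D).
Proof.
move=> l; have l0 := lam_lin0 l; have nE x : iprod x (II D) = - iprod (J x) D by rewrite iprod_II.
apply/lamS; split=> [|x|p0 x y].
- apply/skew_formS; split=> [|x|p0 x]; first exact: lin0_II.
  + rewrite nE; exact/skew_opp/(skew_iprod _ (lam_skew l)).
  + case: p p0 l => // p _ l.
    rewrite nE ipN; have := lam_J x x l; rewrite (skew_anti _ _ (lam_skew l)) => h.
    by apply/funext => v; have := congr1 (@^~ v) h; rewrite !tensorE; lra.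
- by rewrite nE; exact/lam_opp/lam_iprod.
- case: p p0 l => // p _ l.
  by rewrite !nE !ipN JJ // (lin0N _ l0) ipN -(lam_J x y l).
Qed.

Lemma skew_Th p x D : lam p.+1 D -> skew_form p.+2 (Th p.+1 x D).
Proof.
move=> l; rewrite Th_def; apply: skew_sub; apply: (skew_W HG); first exact: lam_skew l.
exact: lam_skew (lam_II l).
Qed.

Lemma iprod_ThS p x D y : lam p.+2 D ->
  iprod y (Th p.+2 x D) = g y x *: D - g y (J x) *: II D - Th p.+1 x (iprod y D).
Proof. by move=> l; rewrite iprod_Th (iprod_II_comm _ l) Th_def. Qed.

Lemma lam_Th p x D : lam p.+1 D -> lam p.+2 (Th p.+1 x D).
Proof.
elim: p D => [|p IH] D l; apply/lamS; split=> [|y|_ y z]; try exact: skew_Th.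
- rewrite iprod_Th; apply/lamP; split=> [|v i [|j]] //.
  apply: skew_sub.
    by apply: skew_sub; apply: skew_scale; [exact: lam_skew l | exact: lam_skew (lam_II l)].
  apply: skew_sub; apply: (skew_W HG); apply: (@skew_iprod _ _ 0); first exact: lam_skew l.
  exact: lam_skew (lam_II l).
- rewrite !iprod_Th !(ipB, ipZ) !iprod_W0 !iprod_II !JJ // !(lin0N _ (lam_lin0 l)).
  by rewrite !gJJ // !(gJ HG HJ); tring.
- rewrite iprod_ThS //; apply: lam_sub; last exact/IH/lam_iprod.
  by apply: lam_sub; apply: lam_scale => //; exact: lam_II.
- rewrite !iprod_ThS // !(ipB, ipZ) !iprod_Th -!(iprod_II_comm _ l) !iprod_II !ipN.
  rewrite !JJ // !(lin0N _ (lam_lin0 l)) !ipN !(lam_JJ _ _ l) !(lam_J _ _ l).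
  by rewrite !gJJ // !(gJ HG HJ) !(WrN, opprK); tring.
Qed.

(** I acts in the same way in every slot of a form of pure type. *)
Lemma lam_slot p D k v : lam p D -> (k < p)%N -> D (vset v k (J (v k))) = - II D v.
Proof.
case: p => // p l kp; case: k kp => [|k] kp.
  by rewrite II.unlock opprK.
rewrite II.unlock opprK; have /lamP[_ h] := l.
(* The type condition is taken where slot 0 already holds J v_0, so that J J = -1 leaves only slot k
   rotated. *)
have := h (vset v 0 (J (v 0%N))) 0%N k.+1 isT kp => {h}.
have -> : vset v 0 (J (v 0%N)) 0%N = J (v 0%N) by [].
have -> : vset v 0 (J (v 0%N)) k.+1 = v k.+1 by [].
rewrite JJ // -(vcons_eta v) !vset_cons0 /= !vset_consS.
set w := vset _ _ _; have := congr1 (@^~ w) (lin0N (v 0%N) (lam_lin0 l)).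
by rewrite /iprod tensorN => -> /oppr_inj.
Qed.

(** Inserting J in one slot exchanges [D] and [II D] up to sign, so the vanishing of both survives
    any number of insertions. *)
Lemma lam_toggle p D (b : nat -> bool) w : lam p.+1 D -> D w = 0 -> II D w = 0 ->
  D (fun k => if b k then J (w k) else w k) = 0.
Proof.
move=> l d0 i0; pose mx m k := if (k < m)%N && b k then J (w k) else w k.
have h m : (m <= p.+1)%N -> D (mx m) = 0 /\ II D (mx m) = 0.
  elim: m => [|m IH] mp; first by have -> : mx 0%N = w by [].
  have [h1 h2] := IH (ltnW mp).
  have [bm|bm] := boolP (b m); last first.
    have -> : mx m.+1 = mx m; last by split.
    apply/funext => k; rewrite /mx ltnS leq_eqVlt; case: eqP => //= ->.
    by rewrite ltnn (negbTE bm).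
  have -> : mx m.+1 = vset (mx m) m (J (mx m m)).
    apply/funext => k; rewrite /mx /vset ltnS leq_eqVlt ltnn; case: eqP => //= ->.
    by rewrite bm.
  rewrite (lam_slot _ l) // (lam_slot _ (lam_II l)) //.
  by rewrite (II_II HJ (lam_lin0 l)) tensorN h1 h2 !oppr0.
have [<- _] := h p.+1 (leqnn _); have [[dep _] _] := lam_skew l.
by apply: dep => k kp; rewrite /mx kp.
Qed.

End Lam.

Lemma multilinear_basis {R : realType} {V : lmodType R} (I : finType) (u : I -> V)
    (i0 : I) p (D : tensor V) :
  (forall x, exists c : I -> R, x = \sum_i c i *: u i) -> multilinear p D ->
  (forall h : nat -> I, D (u \o h) = 0) -> D = 0.
Proof.
move=> sp; elim: p D => [|p IH] D m h0.
  apply/funext => v; rewrite tensor0 -(h0 (fun=> i0)).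
  by have /multilinear0 := m; exact.
have /multilinearS[l m'] := m; apply: tensor_ext => x.
have [c ->] := sp x; rewrite lin0_sum // big1 ?ip0 // => i _.
rewrite lin0Z // (IH (iprod (u i) D)) ?scaler0 // => h.
rewrite -(h0 (fun k => if k is k'.+1 then h k' else i)).
by congr (D _); apply/funext => -[|k].
Qed.

Section ComplexRe.
Context {R : realType}.
Implicit Types x y : R[i].
Lemma cReD x y : complex.Re (x + y) = complex.Re x + complex.Re y.
Proof. by case: x; case: y. Qed.
Lemma cImD x y : complex.Im (x + y) = complex.Im x + complex.Im y.
Proof. by case: x; case: y. Qed.
Lemma cReM x y : complex.Re (x * y) =
  complex.Re x * complex.Re y - complex.Im x * complex.Im y.
Proof. by case: x; case: y. Qed.
Lemma cImM x y : complex.Im (x * y) =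
  complex.Re x * complex.Im y + complex.Im x * complex.Re y.
Proof. by case: x; case: y. Qed.
Lemma cReN x : complex.Re (- x) = - complex.Re x.
Proof. by case: x. Qed.
Lemma cImN x : complex.Im (- x) = - complex.Im x.
Proof. by case: x. Qed.
Lemma cRe_sum (I : Type) (r : seq I) (P : pred I) (h : I -> R[i]) :
  complex.Re (\sum_(i <- r | P i) h i) = \sum_(i <- r | P i) complex.Re (h i).
Proof. by elim/big_rec2: _ => // i x y _ <-; rewrite cReD. Qed.
Lemma cIm_sum (I : Type) (r : seq I) (P : pred I) (h : I -> R[i]) :
  complex.Im (\sum_(i <- r | P i) h i) = \sum_(i <- r | P i) complex.Im (h i).
Proof. by elim/big_rec2: _ => // i x y _ <-; rewrite cImD. Qed.
Lemma cRe_sign k x : complex.Re ((-1) ^+ k * x) = (-1) ^+ k * complex.Re x.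
Proof. by elim: k => [|k IH]; rewrite ?expr0 ?mul1r // !exprS !mulN1r !mulNr cReN IH. Qed.
Lemma cIm_sign k x : complex.Im ((-1) ^+ k * x) = (-1) ^+ k * complex.Im x.
Proof. by elim: k => [|k IH]; rewrite ?expr0 ?mul1r // !exprS !mulN1r !mulNr cImN IH. Qed.
Definition cReE := (cReD, cReM, cReN, cImD, cImM, cImN).
End ComplexRe.

(** * The complex volume form and forms of type (n,0) *)

Section Psi.
Context {R : realType} {V : lmodType R} (m : nat) (F : su_data V).
Local Notation n := m.+1.
Variable f : 'I_n -> V.
Local Notation g := (ip F).
Local Notation J := (Jc F).
Local Notation II := (II F).
Local Notation W := (W F).
Local Notation Th := (Th F).
Local Notation lam := (lam F).
Local Notation psip := (psip F).
Local Notation psim := (psim F).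
Hypothesis HG : inner_product F.
Hypothesis HJ : orthogonal_complex_structure F.
Hypothesis Hf : adapted_frame F f.
Hypothesis fspan : forall x, x = \sum_j (g x (f j) *: f j + g x (J (f j)) *: J (f j)).
Implicit Types (D E : tensor V) (v w : nat -> V) (x y z : V) (c : R) (p k : nat).

Definition theta (j : 'I_n) x : R[i] := (g x (f j) +i* g x (J (f j)))%C.
Definition Psi v : R[i] := \det (\matrix_(j < n, k < n) theta j (v k)).

Lemma psipE v : psip v = complex.Re (Psi v).
Proof. by have [_ _ h] := Hf; have := congr1 (@complex.Re R) (h v). Qed.
Lemma psimE v : psim v = complex.Im (Psi v).
Proof. by have [_ _ h] := Hf; have := congr1 (@complex.Im R) (h v). Qed.

Lemma thetaJ j x : theta j (J x) = ('i * theta j x)%C.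
Proof.
rewrite /theta /GRing.mul /= !mul0r !mul1r sub0r add0r.
by rewrite (gJ HG HJ) gJJ.
Qed.

(** The coefficients are complex, so that real linearity in a slot and the action of J are both
    instances. *)
Lemma Psi_lin v i a b x y z : (i < n)%N ->
  (forall j, theta j x = a * theta j y + b * theta j z) ->
  Psi (vset v i x) = a * Psi (vset v i y) + b * Psi (vset v i z).
Proof.
move=> ip h; rewrite /Psi -!(det_tr (\matrix_(_, _) _)).
apply: (determinant_multilinear (i0 := Ordinal ip)).
- by apply/rowP => j; rewrite !mxE /vset /= !eqxx.
- apply/matrixP => k j; rewrite !mxE /vset /=.
  by rewrite [bump _ _ == _]eq_sym (negbTE (neq_bump _ _)).
- apply/matrixP => k j; rewrite !mxE /vset /=.
  by rewrite [bump _ _ == _]eq_sym (negbTE (neq_bump _ _)).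
Qed.

Lemma theta_lin j c x y : theta j (c *: x + y) = (c%:C)%C * theta j x + theta j y.
Proof.
rewrite /theta !(glcl HG) /GRing.mul /GRing.add /=.
by rewrite !mul0r subr0 addr0.
Qed.

Lemma Psi_slot v i c x y : (i < n)%N ->
  Psi (vset v i (c *: x + y)) = (c%:C)%C * Psi (vset v i x) + Psi (vset v i y).
Proof.
move=> ip; rewrite (Psi_lin _ (a := (c%:C)%C) (b := 1) (y := x) (z := y)) ?mul1r //.
by move=> j; rewrite theta_lin mul1r.
Qed.

Lemma Psi_J v i : (i < n)%N -> Psi (vset v i (J (v i))) = ('i * Psi v)%C.
Proof.
move=> ip; rewrite (Psi_lin _ (a := 'i%C) (b := 0) (y := v i) (z := v i)) //.
  by rewrite mul0r addr0 vset_same.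
by move=> j; rewrite thetaJ mul0r addr0.
Qed.

Lemma Psi_dep v w : (forall k, (k < n)%N -> v k = w k) -> Psi v = Psi w.
Proof.
by move=> h; rewrite /Psi; congr (\det _); apply/matrixP => j k; rewrite !mxE h.
Qed.

Lemma Psi_alt v i j : (i < j)%N -> (j < n)%N -> v i = v j -> Psi v = 0.
Proof.
move=> ij jn e; rewrite /Psi -det_tr.
apply: (determinant_alternate (i1 := Ordinal (ltn_trans ij jn)) (i2 := Ordinal jn)).
  by rewrite -val_eqE /= ltn_eqF.
by move=> k; rewrite !mxE /= e.
Qed.

Lemma psip_skew : skew_form n psip.
Proof.
split; first split => [v w h|i v c x y ip].
- by rewrite !psipE (Psi_dep h).
- by rewrite !psipE Psi_slot // !cReE /=; ring.
- by move=> v i j ij jn e; rewrite psipE (Psi_alt ij jn e).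
Qed.
Lemma psim_skew : skew_form n psim.
Proof.
split; first split => [v w h|i v c x y ip].
- by rewrite !psimE (Psi_dep h).
- by rewrite !psimE Psi_slot // !cReE /=; ring.
- by move=> v i j ij jn e; rewrite psimE (Psi_alt ij jn e).
Qed.

Lemma Psi_JJ v i j : (i < j)%N -> (j < n)%N ->
  Psi (vset (vset v i (J (v i))) j (J (v j))) = - Psi v.
Proof.
move=> ij jn; have <- : vset v i (J (v i)) j = v j by rewrite vset_neq ?gtn_eqF.
rewrite !Psi_J //; last exact: ltn_trans jn.
by rewrite mulrA -expr2 sqr_i mulN1r.
Qed.

Lemma psip_lam : lam n psip.
Proof.
apply/lamP; split=> [|v i j ij jn]; first exact: psip_skew.
by rewrite !psipE Psi_JJ // cReN.
Qed.
Lemma psim_lam : lam n psim.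
Proof.
apply/lamP; split=> [|v i j ij jn]; first exact: psim_skew.
by rewrite !psimE Psi_JJ // cImN.
Qed.

Lemma II_psip : II psip = psim.
Proof.
apply/funext => v; rewrite II.unlock /Islot psipE psimE Psi_J // cReM /=; ring.
Qed.
Lemma II_psim : II psim = - psip.
Proof.
apply/funext => v; rewrite II.unlock /Islot tensorN psipE psimE Psi_J // cImM /=; ring.
Qed.

Lemma theta_wedge_Psi j v :
  \sum_(k < n.+1) (-1) ^+ k * (theta j (v k) * Psi (vdel k v)) = 0.
Proof.
(* Row 0 repeats the row of theta_j; expanding along it gives theta_j /\ Psi. *)
pose M := \matrix_(l < n.+1, k < n.+1) theta (odflt j (unlift ord0 l)) (v k).
have d0 : \det M = 0.
  apply: (determinant_alternate (i1 := ord0) (i2 := lift ord0 j)) => // k.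
  by rewrite !mxE unlift_none liftK.
rewrite -[RHS]d0 (expand_det_row M ord0); apply: eq_bigr => k _.
rewrite /cofactor add0n mulrCA !mxE unlift_none /=; congr (_ * (_ * _)).
by rewrite /Psi; congr (\det _); apply/matrixP => l k'; rewrite !mxE liftK.
Qed.

Lemma W_psi_re j : W n (f j) psip = W n (J (f j)) psim.
Proof.
apply/funext => v; apply/eqP; rewrite -subr_eq0; apply/eqP.
have := congr1 (@complex.Re R) (theta_wedge_Psi j v); rewrite cRe_sum => h; apply: etrans h.
rewrite !W_def !w1_def -sumrB; apply: eq_bigr => k _.
by rewrite cRe_sign cReM psipE psimE /=; ring.
Qed.
Lemma W_psi_im j : W n (f j) psim = - W n (J (f j)) psip.
Proof.
apply/funext => v; apply/eqP; rewrite -subr_eq0 tensorN opprK; apply/eqP.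
have := congr1 (@complex.Im R) (theta_wedge_Psi j v); rewrite cIm_sum => h; apply: etrans h.
rewrite !W_def !w1_def -big_split; apply: eq_bigr => k _.
by rewrite cIm_sign cImM psipE psimE /=; ring.
Qed.

Lemma W_psip x : W n x psip = W n (J x) psim.
Proof.
have l (h : V -> tensor V) (s : 'I_n -> V) : (forall c y z, h (c *: y + z) = c *: h y + h z) ->
    h (\sum_j s j) = \sum_j h (s j).
  by move=> hl; rewrite (vlin_sum (f := h)).
rewrite (fspan x) (l (fun x => W n x psip)); last by move=> *; rewrite W_lc.
rewrite (l (fun x => W n (J x) psim)); last by move=> *; rewrite Jlc // W_lc.
apply: eq_bigr => j _; rewrite JD // !JZ // JJ // !W_lc // !WZ // WN //.
by rewrite W_psi_re W_psi_im; tring.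
Qed.

(** There are no nonzero forms of type (n+1,0). *)
Lemma Th_psip x : Th n x psip = 0.
Proof. by rewrite Th_def II_psip W_psip subrr. Qed.

Definition fseq : nat -> V := fun k => if insub k is Some i then f i else 0.
Lemma fseqE (k : 'I_n) : fseq k = f k.
Proof. by rewrite /fseq valK. Qed.

Lemma Psi_f : Psi fseq = 1.
Proof.
rewrite /Psi (_ : \matrix_(_, _) _ = 1%:M) ?det1 //; apply/matrixP => j k.
have [h1 h2 _] := Hf; rewrite !mxE fseqE /theta h1 h2 eq_sym.
by case: (j == k).
Qed.
Lemma psip_f : psip fseq = 1. Proof. by rewrite psipE Psi_f. Qed.
Lemma psim_f : psim fseq = 0. Proof. by rewrite psimE Psi_f. Qed.

Lemma skew_f_perm E (h : nat -> 'I_n) : skew_form n E -> E fseq = 0 ->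
  E (f \o h) = 0.
Proof.
move=> s e0; have [/injectiveP ih|/injectivePn] := boolP (injectiveb (fun i : 'I_n => h i)).
  have [[dep _] _] := s.
  rewrite (dep _ (vperm (perm ih) fseq)); last first.
    move=> k kn; rewrite -[k]/(nat_of_ord (Ordinal kn)) vpermE permE fseqE.
    by [].
  by rewrite (skew_perm _ _ s) e0 mulr0.
case=> i [j ij e]; have [_ a] := s.
have [lij|] := ltnP i j; first by apply: (a _ i j) => //=; rewrite e.
rewrite leq_eqVlt => /orP[/eqP ji|lji]; first by move: ij; rewrite -val_eqE /= ji eqxx.
by apply: (a _ j i) => //=; rewrite e.
Qed.

(** On basis vectors f_j and J f_j the J's can be stripped by [lam_toggle], and skewness then leaves
    only the frame itself, in some order. *)
Lemma lam_top_eq0 E : lam n E -> E fseq = 0 -> II E fseq = 0 -> E = 0.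
Proof.
move=> l e0 i0.
apply: (multilinear_basis (u := fun bj : bool * 'I_n => if bj.1 then J (f bj.2) else f bj.2) (true, ord0) (p := n)).
- move=> x; exists (fun bj => if bj.1 then g x (J (f bj.2)) else g x (f bj.2)).
  rewrite [LHS]fspan -(pair_bigA _ (fun b j => (if b then g x (J (f j)) else g x (f j)) *: if b then J (f j) else f j)) /=.
  by rewrite big_bool big_split /= addrC.
- by have [[]] := l.
- move=> h; apply: (lam_toggle HJ (fun k => (h k).1) (w := f \o (fun k => (h k).2)) l).
    exact: skew_f_perm (lam_skew l) e0.
  exact: skew_f_perm (lam_skew (lam_II HJ l)) i0.
Qed.

(** The real plane [[lambda^{n,0}]] has the values of E and I_(1) E on the frame as coordinates. *)
Lemma lam_top E : lam n E -> E = E fseq *: psip - II E fseq *: psim.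
Proof.
move=> l; apply/eqP; rewrite -subr_eq0; apply/eqP; apply: lam_top_eq0.
- apply: lam_sub => //; apply: lam_sub; apply: lam_scale; [exact: psip_lam|exact: psim_lam].
- by rewrite !tensorE psip_f psim_f; ring.
- by rewrite !(IIB, IIZ) II_psip II_psim !tensorE psip_f psim_f; ring.
Qed.

(** The length of Psi expressed through the metric and I alone, for arbitrary vectors; its
    derivative yields [DP_f]. *)
Lemma Psi_norm v : psip v ^+ 2 + psim v ^+ 2 = complex.Re (\det (\matrix_(k < n, l < n)
  (g (v k) (v l) +i* g (v k) (J (v l)))%C)).
Proof.
pose T := \matrix_(j < n, k < n) theta j (v k).
(* The Hermitian Gram matrix is the transpose of T times the conjugate of T. *)
have -> : \matrix_(k < n, l < n) (g (v k) (v l) +i* g (v k) (J (v l)))%C =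
    T^T *m map_mx (@conjc R) T.
  apply/matrixP => k l; rewrite !mxE; apply/eqP; rewrite eq_complex /=.
  rewrite cRe_sum cIm_sum; apply/andP; split; apply/eqP.
    rewrite [in LHS](fspan (v k)) g_suml //; apply: eq_bigr => j _.
    by rewrite !mxE /= gDl // !gZl // !(gC HG _ (v l)); ring.
  rewrite [in LHS](fspan (v k)) g_suml //; apply: eq_bigr => j _.
  by rewrite !mxE /= gDl // !gZl // gJJ // (gC HG (f j)) (gJ HG HJ (v l)) (gC HG (f j)); ring.
rewrite det_mulmx det_tr det_map_mx -/(Psi v) psipE psimE.
by case: (Psi v) => a b /=; ring.
Qed.

End Psi.

(** The endomorphism T representing [al], with <y, T x> = al(x, y); see [gT]. *)
HB.lock Definition Tm {R : realType} {V : lmodType R} {n}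
    (e : 'I_n.*2 -> V) (al : V -> V -> R) (x : V) : V := \sum_j al x (e j) *: e j.

(* al(e_i, e_j) psi_+(e_i, e_j, ...).                                          *)
HB.lock Definition cont {R : realType} {V : lmodType R} {n} (F : su_data V)
    (e : 'I_n.*2 -> V) (al : V -> V -> R) : tensor V :=
  \sum_i iprod (Tm e al (e i)) (iprod (e i) (psip F)).

(** * The contraction c with psi_+ and its inverse *)

Section Contraction.
Context {R : realType} {V : lmodType R} (m : nat) (F : su_data V).
Local Notation n := m.+4.
Variable f : 'I_n -> V.
Variable e : 'I_n.*2 -> V.
Local Notation g := (ip F).
Local Notation J := (Jc F).
Local Notation II := (II F).
Local Notation W := (W F).
Local Notation Th := (Th F).
Local Notation lam := (lam F).
Local Notation psip := (psip F).
Local Notation psim := (psim F).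
Local Notation Lo := (Lo F e).
Local Notation Lam := (Lam F e).
Local Notation Tm := (Tm e).
Local Notation cont := (cont F e).
Hypothesis HG : inner_product F.
Hypothesis HJ : orthogonal_complex_structure F.
Hypothesis Hf : adapted_frame F f.
Hypothesis fspan : forall x, x = \sum_j (g x (f j) *: f j + g x (J (f j)) *: J (f j)).
Hypothesis he : orthonormal_basis F e.
Hypothesis hspan : forall x, x = \sum_i g x (e i) *: e i.
Implicit Types (D E c : tensor V) (v w : nat -> V) (x y z X Y Z : V) (p k : nat).
Implicit Types (al be : V -> V -> R).

Let psip_lam : lam n psip. Proof. exact: psip_lam HG HJ Hf. Qed.
Let psim_lam : lam n psim. Proof. exact: psim_lam HG HJ Hf. Qed.
Let lp : lin0 psip. Proof. exact: lam_lin0 psip_lam. Qed.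
Let lm : lin0 psim. Proof. exact: lam_lin0 psim_lam. Qed.
Let II_p : II psip = psim. Proof. exact: II_psip HG HJ Hf. Qed.
Let II_m : II psim = - psip. Proof. exact: II_psim HG HJ Hf. Qed.

Lemma iprod_psim x : iprod x psim = - iprod (J x) psip.
Proof. by rewrite -II_p iprod_II. Qed.
Lemma iprodJ_psim x : iprod (J x) psim = iprod x psip.
Proof. by rewrite iprod_psim JJ // lin0N // opprK. Qed.

Lemma Lo_psip : Lo n psip = 0.
Proof.
rewrite Lo_def big1 ?scaler0 // => i _.
by rewrite (W_psip HG HJ Hf fspan) JJ // WN // WrN W_sq oppr0.
Qed.

Lemma Lo_iprod x : Lo m.+3 (iprod x psip) = W n (J x) psip.
Proof.
have := congr1 (iprod x) Lo_psip; rewrite ip0 (iprod_LoS HG HJ hspan) => /eqP.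
by rewrite addrC subr_eq0 => /eqP.
Qed.

Lemma Lo_iprod2 x y : Lo m.+2 (iprod y (iprod x psip)) =
  g y (J x) *: psip - W m.+3 (J x) (iprod y psip) + W m.+3 (J y) (iprod x psip).
Proof.
have := congr1 (iprod y) (Lo_iprod x).
rewrite (iprod_LoS HG HJ hspan) iprod_WS // => <-.
by rewrite addrAC addNr add0r.
Qed.

Definition bilin al := forall a x y z, al (a *: x + y) z = a * al x z + al y z.
Record uperp al : Prop := Uperp {
  ubil : bilin al;
  uanti : forall x y, al x y = - al y x;
  uJJ : forall x y, al (J x) (J y) = - al x y }.

Section Al.
Variable al : V -> V -> R.
Hypothesis ual : uperp al.
Local Notation T := (Tm al).

Lemma u_r a x y z : al z (a *: x + y) = a * al z x + al z y.
Proof. by rewrite !(uanti ual z) (ubil ual); ring. Qed.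

Lemma uN x y : al (- x) y = - al x y.
Proof.
have h := ubil ual (-1) x 0 y; have h0 := ubil ual (-1) 0 0 y.
move: h h0; rewrite !scaleN1r oppr0 !addr0 => -> h0; lra.
Qed.

Lemma u_J x y : al (J x) y = al x (J y).
Proof.
by have := uJJ ual (J x) y; rewrite JJ // uN => /oppr_inj.
Qed.

Lemma u_JJ0 x : al x (J x) = 0.
Proof. have := u_J x x; rewrite uanti // => h; lra. Qed.

Lemma gT x y : g y (T x) = al x y.
Proof.
rewrite Tm.unlock g_sumr //.
rewrite -[RHS](sum_g (U := R^o) hspan (f := al x)); last by move=> *; exact: u_r.
by apply: eq_bigr => j _; rewrite gZr // mulrC.
Qed.

Lemma g_inj x y : (forall z, g z x = g z y) -> x = y.
Proof.
move=> h; rewrite (hspan x) (hspan y); apply: eq_bigr => i _.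
by rewrite !(gC HG _ (e i)) h.
Qed.

Lemma T_lin : vlin T.
Proof.
by move=> a x y; apply: g_inj => z; rewrite glcr // !gT (ubil ual).
Qed.

Lemma T_adj x y : g (T x) y = - g x (T y).
Proof. by rewrite gC // !gT uanti. Qed.

Lemma TJ x : T (J x) = - J (T x).
Proof. by apply: g_inj => z; rewrite gNr // gJr // !gT opprK u_J. Qed.

(** In [Lo_iprod2] the scalar term drops because al(x, J x) = 0, and the two wedge terms agree after
    summation because T is skew-adjoint. *)
Lemma Lo_cont : Lo m.+2 (cont al) = 2 *: \sum_i W m.+3 (J (T (e i))) (iprod (e i) psip).
Proof.
rewrite cont.unlock Lo_sum.
under eq_bigr => i _ do rewrite Lo_iprod2 gC // gT u_JJ0 scale0r sub0r.
rewrite big_split /= sumrN.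
have -> : \sum_i W m.+3 (J (e i)) (iprod (T (e i)) psip) =
   - \sum_i W m.+3 (J (T (e i))) (iprod (e i) psip).
  rewrite -(sum_adj HG hspan (B := fun x y => W m.+3 (J x) (iprod y psip)) (A := fun x => - T x)).
  - by rewrite -sumrN; apply: eq_bigr => i _; rewrite JN // WN.
  - by move=> y a x z; rewrite Jlc // W_lc.
  - by move=> x a y z; rewrite lp !(WrD, WrZ).
  - by move=> x y; rewrite gNl // T_adj opprK.
by rewrite opprK; tring.
Qed.

(** The source of [iprod_Xip]: contracting psi_- with x is minus contracting psi_+ with J x, and T
    anticommutes with J. *)
Lemma sum_W_T_psim :
  \sum_i W m.+3 (T (e i)) (iprod (e i) psim) = - 2^-1 *: Lo m.+2 (cont al).
Proof.
rewrite Lo_cont scalerA mulNr mulVf ?pnatr_eq0 // scaleN1r -sumrN.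
under eq_bigr => i _ do rewrite iprod_psim WrN.
under [RHS]eq_bigr => i _ do rewrite -WN // -TJ.
rewrite sumrN -(sum_J HG HJ hspan (B := fun x y => W m.+3 (T x) (iprod y psip))) //.
- by move=> y a x z; rewrite T_lin W_lc.
- by move=> x a y z; rewrite lp !(WrD, WrZ).
Qed.

Lemma cont_lam : lam m.+2 (cont al).
Proof. by rewrite cont.unlock; apply: lam_sum => i _; do 2 apply: lam_iprod. Qed.

Lemma Th_iprod Z x : Th m.+3 Z (iprod x psip) = g x Z *: psip - g x (J Z) *: psim.
Proof.
have := iprod_ThS HJ Z x psip_lam; rewrite (Th_psip HG HJ Hf fspan) ip0 II_p.
by move=> /esym/eqP; rewrite subr_eq0 => /eqP.
Qed.

Lemma Th_iprod2 Z x y : Th m.+2 Z (iprod y (iprod x psip)) =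
  g y Z *: iprod x psip - g y (J Z) *: iprod x psim
  - (g x Z *: iprod y psip - g x (J Z) *: iprod y psim).
Proof.
have := iprod_ThS HJ Z y (lam_iprod x psip_lam).
rewrite Th_iprod !(ipB, ipZ) -(iprod_II_comm HJ _ psip_lam) II_p => ->.
by tring.
Qed.

(** One wedge undoes one of the two contractions in c. All four terms of [Th_iprod2] contribute
    equally. *)
Lemma Th_cont Z : Th m.+2 Z (cont al) = - 4 *: iprod (T Z) psip.
Proof.
rewrite cont.unlock Th_sum.
under eq_bigr => i _ do rewrite Th_iprod2 !T_adj.
rewrite !sumrB.
under eq_bigr => i _ do rewrite scaleNr gC //.
under [X in _ - X - _]eq_bigr => i _ do rewrite scaleNr gC //.
under [X in _ - (X - _)]eq_bigr => i _ do rewrite gC //.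
under [X in _ - (_ - X)]eq_bigr => i _ do rewrite gC //.
rewrite !sumrN !sum_ipg //.
have h (k : V -> tensor V) : vlin k -> \sum_i g Z (e i) *: k (e i) = k Z.
  by move=> l; rewrite (sum_g hspan).
have h' (k : V -> tensor V) : vlin k -> \sum_i g (J Z) (e i) *: k (e i) = k (J Z).
  by move=> l; rewrite (sum_g hspan).
rewrite (h (fun x => iprod (T x) psip)); last by move=> a x y; rewrite T_lin lp.
rewrite (h' (fun x => iprod (T x) psim)); last by move=> a x y; rewrite T_lin lm.
rewrite TJ iprod_psim JN // JJ // !opprK; tring.
Qed.

(** A second wedge reaches type (n,0), where evaluation on the frame reads off [al]; hence c is
    injective. *)
Lemma Th_Th_cont Y Z : Th m.+3 Y (Th m.+2 Z (cont al)) (fseq f) = 4 * al Y Z.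
Proof.
rewrite Th_cont ThZ Th_iprod !tensorE (psip_f Hf) (psim_f Hf) gC // gT uanti //.
ring.
Qed.

End Al.

Lemma II_cont al : uperp al -> II (cont al) = cont (fun x y => al (J x) y).
Proof.
move=> ual.
have TmJ x : Tm (fun x y => al (J x) y) x = Tm al (J x) by rewrite !Tm.unlock.
rewrite !cont.unlock II_sum.
under [RHS]eq_bigr => i _ do rewrite TmJ.
rewrite (sum_J HG HJ hspan (B := fun x y => iprod (Tm al x) (iprod y psip))).
- rewrite -sumrN; apply: eq_bigr => i _.
  rewrite -(iprod_II_comm HJ _ (lam_iprod _ psip_lam)).
  by rewrite -(iprod_II_comm HJ _ psip_lam) II_p iprod_psim ipN.
- move=> y a x z; rewrite T_lin //; exact: (lam_lin0 (lam_iprod _ psip_lam)).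
- by move=> x a y z; rewrite lp !(ipD, ipZ).
Qed.

Lemma cont_lc a al be :
  cont (fun x y => a * al x y + be x y) = a *: cont al + cont be.
Proof.
rewrite !cont.unlock scaler_sumr -big_split /=; apply: eq_bigr => i _.
rewrite -(lam_lin0 (lam_iprod (e i) psip_lam)).
suff -> : Tm (fun x y => a * al x y + be x y) (e i) = a *: Tm al (e i) + Tm be (e i) by [].
rewrite !Tm.unlock scaler_sumr -big_split /=; apply: eq_bigr => j _.
by rewrite /= scalerDl scalerA.
Qed.

(** Forms of pure type are primitive: J changes sign when moved across the trace but not when moved
    across the form. *)
Lemma Lam_lam p c : lam p.+2 c -> Lam c = 0.
Proof.
move=> l; rewrite Lam_def.
have h : \sum_i iprod (J (e i)) (iprod (e i) c) = - \sum_i iprod (e i) (iprod (J (e i)) c).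
  apply: (sum_J HG HJ hspan (B := fun x y => iprod x (iprod y c))).
    by move=> y; exact: (lam_lin0 (lam_iprod y l)).
  by move=> x a y z; rewrite (lam_lin0 l) !(ipD, ipZ).
have e1 : \sum_i iprod (e i) (iprod (J (e i)) c) = \sum_i iprod (J (e i)) (iprod (e i) c).
  by apply: eq_bigr => i _; rewrite (lam_J HJ _ _ l).
rewrite e1 in h.
by apply/funext => v; have := congr1 (@^~ v) h; rewrite tensorN tensor0; lra.
Qed.

Lemma cont_scale a al : cont (fun x y => a * al x y) = a *: cont al.
Proof.
rewrite !cont.unlock scaler_sumr; apply: eq_bigr => i _.
rewrite -(lin0Z _ _ (lam_lin0 (lam_iprod (e i) psip_lam))).
suff -> : Tm (fun x y => a * al x y) (e i) = a *: Tm al (e i) by [].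
rewrite !Tm.unlock scaler_sumr; apply: eq_bigr => j _.
by rewrite scalerA.
Qed.

Lemma contE al : cont al = \sum_i \sum_j al (e i) (e j) *: iprod (e j) (iprod (e i) psip).
Proof.
rewrite cont.unlock; apply: eq_bigr => i _.
have l := lam_lin0 (lam_iprod (e i) psip_lam).
rewrite Tm.unlock lin0_sum //; apply: eq_bigr => j _.
by rewrite lin0Z.
Qed.

Lemma Th_J p X D : lin0 D -> Th p (J X) D = Th p X (II D).
Proof. by move=> l; rewrite !Th_def JJ // WN // II_II // WrN; tring. Qed.

(** [sum_ip_Th] in degree n-1, with factor 2. Each [Th e_i D] is a combination of psi_+ and psi_-,
    and rotating the basis by J identifies the psi_- terms with the psi_+ terms. *)
Lemma lam_codim1 D : lam m.+3 D ->
  D = \sum_j Th m.+3 (e j) D (fseq f) *: iprod (e j) psip.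
Proof.
move=> l; have := sum_ip_Th HG HJ he hspan (lam_skew l).
rewrite -natrB; last lia; rewrite (_ : (_ - _)%N = 2%N); last by lia.
move=> h; suff : 2%:R *: D = 2%:R *: \sum_j Th m.+3 (e j) D (fseq f) *: iprod (e j) psip.
  by move/(congr1 ( *:%R 2^-1)); rewrite !scalerA mulVf ?pnatr_eq0 // !scale1r.
rewrite -h.
under eq_bigr => i _.
  rewrite (lam_top HG HJ Hf fspan (lam_Th HG HJ (e i) l)) (II_Th HG HJ); last exact: lam_lin0 l.
  rewrite -Th_J; last exact: lam_lin0 l.
  rewrite ipB !ipZ iprod_psim scalerN opprK; over.
rewrite big_split /= (sum_JJ HG HJ hspan (B := fun x y => Th m.+3 x D (fseq f) *: iprod y psip)).
- by rewrite scaler_nat mulr2n.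
- by move=> y a x z; rewrite Th_lc // !tensorE scalerDl scalerA.
- by move=> x a y z; rewrite lp scalerDr !scalerA mulrC.
Qed.

(** [sum_ip_Th] in degree n-2, with factor 4, followed by [lam_codim1] in degree n-1. Hence c is
    onto. *)
Lemma cont_rec c : lam m.+2 c ->
  cont (fun Y Z => Th m.+3 Y (Th m.+2 Z c) (fseq f)) = 4 *: c.
Proof.
move=> l; have := sum_ip_Th HG HJ he hspan (lam_skew l).
rewrite -natrB; last lia; rewrite (_ : (_ - _)%N = 4%N); last by lia.
move=> <-; rewrite contE exchange_big /=; apply: eq_bigr => i _.
rewrite [in RHS](lam_codim1 (lam_Th HG HJ (e i) l)) ip_sum.
by apply: eq_bigr => j _; rewrite ipZ.
Qed.

(* The inverse of a |-> (X |-> -1/4 cont (a_X)).                               *)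
Definition recA (c : V -> tensor V) X Y Z := - Th m.+3 Y (Th m.+2 Z (c X)) (fseq f).

Lemma cont_recA (c : V -> tensor V) X : lam m.+2 (c X) -> cont (recA c X) = - 4 *: c X.
Proof.
move=> l; rewrite scaleNr -cont_rec // -scaleN1r -cont_scale; congr cont.
by apply/funext => Y; apply/funext => Z; rewrite mulN1r.
Qed.

Lemma uperp_recA (c : V -> tensor V) X : lam m.+2 (c X) -> uperp (recA c X).
Proof.
move=> l; have l0 := lam_lin0 l; split.
- by move=> a x y z; rewrite /recA Th_lc // !tensorE; ring.
- by move=> x y; rewrite /recA Th_anti // tensorN opprK.
- move=> x y; rewrite /recA Th_J; last exact: lam_lin0 (lam_Th HG HJ _ l).
  rewrite Th_J // II_Th //; last exact: lin0_II.
  by rewrite II_II // !ThN tensorN.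
Qed.

(** * Trilinear form of T^* tensor u(n)^perp; Xi_+ as an isomorphism onto W^Xi *)

Definition a3 (a : tensor V) x y z := a (vcons x (vcons y (vcons z (fun=> 0)))).
Definition tens (A : V -> V -> V -> R) : tensor V := fun v => A (v 0%N) (v 1%N) (v 2%N).
Record trip (A : V -> V -> V -> R) : Prop := Trip {
  tl : forall a x y z t, A (a *: x + y) z t = a * A x z t + A y z t;
  tu : forall x, uperp (A x) }.

Lemma T_uperp_tens A : trip A -> T_uperp F (tens A).
Proof.
move=> [t1 t2]; split.
  split=> [v w h|[|[|[|//]]] v a x y _]; rewrite /tens /vset /=.
  - by rewrite !h.
  - exact: t1.
  - by rewrite (ubil (t2 _)).
  - by rewrite u_r.
move=> x; apply/lamP; split; last first.
  move=> v [|i] [|[|j]] // _ _; rewrite /iprod /tens /vset /=.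
  exact: (uJJ (t2 x)).
split; first split=> [v w h|[|[|//]] v a y z _]; rewrite /iprod /tens /vset /=.
- by rewrite !h.
- exact: (ubil (t2 x)).
- exact: u_r.
- move=> v [|i] [|[|j]] // _ _ e'; rewrite /iprod /tens /=.
  by have := uanti (t2 x) (v 0%N) (v 1%N); rewrite e' => h; lra.
Qed.

Lemma T_uperp_trip a : T_uperp F a -> trip (a3 a).
Proof.
move=> [ml l]; split=> [c x y z w|x].
  by have := congr1 (@^~ (vcons z (vcons w (fun=> 0)))) (multilinear_lin0 ml c x y).
split=> [c y z w|y z|y z].
- by have := congr1 (@^~ (vcons w (fun=> 0))) (lam_lin0 (l x) c y z).
- by have := congr1 (@^~ (fun=> 0)) (skew_anti z y (lam_skew (l x))).
- by have := congr1 (@^~ (fun=> 0)) (lam_JJ z y (l x)).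
Qed.

Lemma T_uperp_a3 a : T_uperp F a -> a = tens (a3 a).
Proof.
move=> [[dep _] _]; apply/funext => v; rewrite /tens /a3.
by apply: dep => -[|[|[|k]]].
Qed.

Lemma a3_inj a b : T_uperp F a -> T_uperp F b -> (forall x y z, a3 a x y z = a3 b x y z) -> a = b.
Proof.
move=> ta tb h; rewrite (T_uperp_a3 ta) (T_uperp_a3 tb).
by apply/funext => v; rewrite /tens h.
Qed.

Local Notation Xip := (Xip F e).
Local Notation Xim := (Xim F e).

Lemma Xi_wedge a X i (psi : tensor V) : T_uperp F a -> skew_form n psi ->
  wedge 1 (n - 1) (iprod (e i) (iprod X a)) (iprod (e i) psi) =
  W m.+3 (Tm (a3 a X) (e i)) (iprod (e i) psi).
Proof.
move=> ta sp; have <- : flat F (Tm (a3 a X) (e i)) = iprod (e i) (iprod X a).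
  apply/funext => v; rewrite /flat gT; last exact: (tu (T_uperp_trip ta)).
  by rewrite [in RHS](T_uperp_a3 ta).
by rewrite (wedge_flat HG (p := m.+3)) //; exact: skew_iprod sp.
Qed.

Lemma iprod_Xip a X : T_uperp F a ->
  iprod X (Xip a) = - 4^-1 *: Lo m.+2 (cont (a3 a X)).
Proof.
move=> ta; apply/funext => v.
have -> : iprod X (Xip a) v = 2^-1 * \sum_i wedge 1 (n - 1)
    (iprod (e i) (iprod X a)) (iprod (e i) psim) v by [].
under eq_bigr => i _ do rewrite (Xi_wedge _ _ ta (lam_skew psim_lam)).
rewrite -(tensor_sum _ xpredT (fun i => W m.+3 (Tm (a3 a X) (e i)) (iprod (e i) psim))).
rewrite sum_W_T_psim; last exact: (tu (T_uperp_trip ta)).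
by rewrite !tensorE; field.
Qed.

Definition aJ (a : tensor V) : tensor V := tens (fun x y z => a3 a x (J y) z).

Lemma aJ_uperp a : T_uperp F a -> T_uperp F (aJ a).
Proof.
move=> ta; have [t1 t2] := T_uperp_trip ta; apply: T_uperp_tens; split=> [c x y z w|x].
  exact: t1.
split=> [c y z w|y z|y z].
- by rewrite Jlc // (ubil (t2 x)).
- by rewrite (uanti (t2 x)) u_J.
- by rewrite (uJJ (t2 x)).
Qed.

(** Inserting I into the second slot of a trades psi_+ for psi_-, so only Xi_+ has to be studied. *)
Lemma Xim_Xip a : T_uperp F a -> Xim a = Xip (aJ a).
Proof.
move=> ta; apply: tensor_ext => X; rewrite (iprod_Xip _ (aJ_uperp ta)).
have t2 := tu (T_uperp_trip ta); have t2' := tu (T_uperp_trip (aJ_uperp ta)).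
apply/funext => v.
have -> : iprod X (Xim a) v = - 2^-1 * \sum_i wedge 1 (n - 1)
    (iprod (e i) (iprod X a)) (iprod (e i) psip) v by [].
under eq_bigr => i _ do rewrite (Xi_wedge _ _ ta (lam_skew psip_lam)).
rewrite Lo_cont // -(tensor_sum _ xpredT (fun i => W m.+3 (Tm (a3 a X) (e i)) (iprod (e i) psip))).
have -> : \sum_i W m.+3 (J (Tm (a3 (aJ a) X) (e i))) (iprod (e i) psip) =
  \sum_i W m.+3 (Tm (a3 a X) (e i)) (iprod (e i) psip).
  apply: eq_bigr => i _; congr (W _ _ _); apply: g_inj => z.
  rewrite gJr // gT // gT // [LHS](_ : _ = - a3 a X (J (e i)) (J z)) //.
  by rewrite (uJJ (t2 X)) opprK.
by rewrite !tensorE; field.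
Qed.

(** The form is primitive, so only the number 2(n-2) - 2n of [Lam_Lo] remains. *)
Lemma Lam_Lo_lam c : lam m.+2 c -> Lam (Lo m.+2 c) = - 4 *: c.
Proof.
move=> l; rewrite (Lam_Lo HG HJ he hspan (lam_skew l)) (Lam_lam l) Lo0 addr0.
rewrite -opprB -natrB; last lia.
by rewrite (_ : (_ - _)%N = 4%N); last lia.
Qed.

Lemma Lo_inj c c' : lam m.+2 c -> lam m.+2 c' -> Lo m.+2 c = Lo m.+2 c' -> c = c'.
Proof.
move=> l l' /(congr1 Lam); rewrite !Lam_Lo_lam // => h.
by apply/funext => v; have := congr1 (@^~ v) h; rewrite !tensorE; lra.
Qed.

Lemma cont_inj al be : uperp al -> uperp be -> cont al = cont be ->
  forall y z, al y z = be y z.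
Proof.
move=> ual ube h y z; have := Th_Th_cont ual y z; rewrite h Th_Th_cont //; lra.
Qed.

Lemma Xip_inj a b : T_uperp F a -> T_uperp F b -> Xip a = Xip b -> a = b.
Proof.
move=> ta tb h; apply: a3_inj => // x.
have t := tu (T_uperp_trip ta) x; have t' := tu (T_uperp_trip tb) x.
apply: cont_inj => //; apply: Lo_inj; try exact: cont_lam.
have := congr1 (iprod x) h; rewrite !iprod_Xip // => {}h.
by apply/funext => v; have := congr1 (@^~ v) h; rewrite !tensorE; lra.
Qed.

Lemma T_uperp_0 : T_uperp F (0 : tensor V).
Proof. by split=> [|x]; [exact: multilinear_0 | rewrite ip0; exact: lam_0]. Qed.
Lemma T_uperp_lc a b (k : R) : T_uperp F a -> T_uperp F b -> T_uperp F (k *: a + b).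
Proof.
move=> [ma la] [mb lb]; split=> [|x]; first exact: multilinear_lc.
by rewrite ipD ipZ; apply: lam_lc.
Qed.

Lemma Xip_lc a b (k : R) : T_uperp F a -> T_uperp F b ->
  Xip (k *: a + b) = k *: Xip a + Xip b.
Proof.
move=> ta tb; apply: tensor_ext => X; have tc := T_uperp_lc k ta tb.
rewrite ipD ipZ !iprod_Xip //.
rewrite (_ : a3 (k *: a + b) X = fun y z => k * a3 a X y z + a3 b X y z) //.
by rewrite cont_lc LoD LoZ; tring.
Qed.
Lemma Xip_D a b : T_uperp F a -> T_uperp F b -> Xip (a + b) = Xip a + Xip b.
Proof. by move=> ta tb; have := Xip_lc 1 ta tb; rewrite !scale1r. Qed.
Lemma Xip_0 : Xip 0 = 0.
Proof.
have t0 := T_uperp_0; have := Xip_lc (-1) t0 t0.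
by rewrite scaler0 addr0 scaleN1r addNr.
Qed.
Lemma Xip_Z a (k : R) : T_uperp F a -> Xip (k *: a) = k *: Xip a.
Proof. by move=> ta; have := Xip_lc k ta T_uperp_0; rewrite Xip_0 !addr0. Qed.

Lemma Xip_skew a X : T_uperp F a -> skew_form n (iprod X (Xip a)).
Proof.
move=> ta; rewrite iprod_Xip //; apply: skew_scale; apply: skew_Lo => //.
apply: lam_skew; apply: cont_lam.
Qed.

Lemma Xip_lin0 a : T_uperp F a -> lin0 (Xip a).
Proof.
move=> ta k x y; rewrite !iprod_Xip //.
rewrite (_ : a3 a (k *: x + y) = fun z t => k * a3 a x z t + a3 a y z t).
  by rewrite cont_lc LoD LoZ; tring.
apply/funext => z; apply/funext => t; exact: (tl (T_uperp_trip ta)).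
Qed.

Lemma Xip_multilinear a : T_uperp F a -> multilinear n.+1 (Xip a).
Proof.
move=> ta; apply/multilinearS; split=> [|x]; first exact: Xip_lin0.
by case: (Xip_skew x ta).
Qed.

Lemma Xip_rec (c : V -> tensor V) : vlin c -> (forall X, lam m.+2 (c X)) ->
  T_uperp F (tens (recA c)) /\ forall X, iprod X (Xip (tens (recA c))) = Lo m.+2 (c X).
Proof.
move=> cl l; have t : T_uperp F (tens (recA c)).
  apply: T_uperp_tens; split=> [k x y z t|X]; last exact: uperp_recA.
  by rewrite /recA cl !ThD !ThZ !tensorE; ring.
split=> // X; rewrite iprod_Xip // [a3 _ X](_ : _ = recA c X) // cont_recA // LoZ.
by apply/funext => v; rewrite !tensorE; field.
Qed.

Lemma wedge_omega c : skew_form m.+2 c -> wedge (n - 2) 2 c (kahler F) = Lo m.+2 c.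
Proof. exact: (wedge_kahler HG HJ hspan). Qed.

Lemma W_Xi_E : W_Xi n F = [set Xip a | a in T_uperp F].
Proof.
apply/seteqP; split=> [b [mb hb]|_ [a ta <-]]; last first.
  split=> [|X]; first exact: Xip_multilinear.
  exists (- 4^-1 *: cont (a3 a X)); first exact/lam_scale/cont_lam.
  rewrite wedge_omega // ?LoZ -?iprod_Xip //.
  exact/skew_scale/lam_skew/cont_lam.
(* The factor of omega is given for each X separately; recovering it through Lambda makes it linear
   in X. *)
pose c X := - 4^-1 *: Lam (iprod X b).
have hc X : lam m.+2 (c X) /\ iprod X b = Lo m.+2 (c X).
  rewrite /c; have [d ld ->] := hb X.
  rewrite wedge_omega; last exact: lam_skew ld.
  rewrite Lam_Lo_lam // scalerA mulrNN mulVf ?pnatr_eq0 // scale1r.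
  by split.
have cl : vlin c.
  by move=> k x y; rewrite /c (multilinear_lin0 mb) LamD LamZ; tring.
have [t h] := Xip_rec cl (fun X => (hc X).1).
exists (tens (recA c)) => //; apply: tensor_ext => X.
by rewrite h; have [_ ->] := hc X.
Qed.

(** * The operator L *)

Lemma der_lam p c : lam p.+1 c -> der p.+1 J c = - p.+1%:R *: II c.
Proof.
move=> l; apply/funext => v; rewrite der_def tensorZ.
under eq_bigr => k _ do rewrite (lam_slot HJ _ l) //.
by rewrite sumrN sumr_const card_ord mulNr mulr_natl.
Qed.

(** The derivation by J kills omega: in e_i /\ J e_i, differentiating either factor repeats the
    other one up to sign. *)
Lemma der_Lo p D : der p.+2 J (Lo p D) = Lo p (der p J D).
Proof.
have fl x : (fun y => g y x) \o J = fun y => g y (- J x).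
  by apply/funext => y /=; rewrite gNr // gJ.
have dW q x E : der q.+1 J (W q x E) = W q (- J x) E + W q x (der q J E).
  by rewrite !W_def der_w1 fl.
rewrite !Lo_def derZ der_sum; congr (_ *: _); apply: eq_bigr => i _.
by rewrite !dW JJ // opprK WrD !WN // !W_sq oppr0 !add0r.
Qed.

(** The sign of I_(1) cancels that of each later I_(k), leaving a plain derivation. *)
Lemma iprod_calL b X : iprod X (calL n F b) = der n J (iprod (J X) b).
Proof.
apply/funext => v; rewrite der_def /iprod /calL {1}/Islot big_add1 /= big_mkord.
rewrite -sumrN; apply: eq_bigr => k _.
by rewrite /Islot opprK vset_cons0 /= vset_consS.
Qed.

Definition aJJ (a : tensor V) : tensor V := tens (fun x y z => a3 a (J x) (J y) z).

Lemma aJJ_uperp a : T_uperp F a -> T_uperp F (aJJ a).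
Proof.
move=> ta; have [t1 t2] := T_uperp_trip ta; apply: T_uperp_tens; split=> [c x y z w|x].
  by rewrite Jlc // t1.
split=> [c y z w|y z|y z].
- by rewrite Jlc // (ubil (t2 _)).
- by rewrite (uanti (t2 _)) u_J.
- by rewrite (uJJ (t2 _)).
Qed.

(** In omega /\ c only c is affected by the derivation, whence its degree n-2 as the factor. *)
Lemma calL_Xip a : T_uperp F a ->
  calL n F (Xip a) = - (n - 2)%:R *: Xip (aJJ a).
Proof.
move=> ta; have t2 := tu (T_uperp_trip ta).
apply: tensor_ext => X; rewrite iprod_calL [in RHS]ipZ !iprod_Xip //; last exact: aJJ_uperp.
rewrite derZ der_Lo der_lam; last exact: cont_lam.
rewrite II_cont // LoZ -[(n - 2)%N]/m.+2 -[a3 (aJJ a) X]/(fun x y => a3 a (J X) (J x) y).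
by tring.
Qed.

Lemma a3JJ a x y z : a3 (aJJ a) x y z = a3 a (J x) (J y) z.
Proof. by []. Qed.

(** * The Gray-Hervella classes and their splitting *)

Lemma GH1E a : GH1 F a <-> T_uperp F a /\ forall x y z, a3 a x y z = - a3 a y x z.
Proof.
split=> -[ta h]; split=> //.
  move=> x y z; have s : skew_form 3 a by split=> //; case: ta.
  by have := congr1 (@^~ (vcons z (fun=> 0))) (skew_anti y x s).
have [t1 t2] := T_uperp_trip ta.
move=> v i j ij j3 e'; rewrite (T_uperp_a3 ta) /tens.
have s0 x z : a3 a x x z = 0 by have := h x x z; lra.
case: i j ij j3 e' => [|[|i]] [|[|[|j]]] // _ _ e'.
- by rewrite e' s0.
- by rewrite e' h; have := uanti (t2 (v 1%N)) (v 2%N) (v 2%N); lra.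
- by rewrite e'; have := uanti (t2 (v 0%N)) (v 2%N) (v 2%N); lra.
Qed.

Lemma a3_v a x y z v : T_uperp F a -> a (vcons x (vcons y (vcons z v))) = a3 a x y z.
Proof. by move=> ta; rewrite [in LHS](T_uperp_a3 ta). Qed.

Lemma GH2E a : GH2 F a <-> T_uperp F a /\
  forall x y z, a3 a x y z + a3 a y z x + a3 a z x y = 0.
Proof.
split=> -[ta h]; split=> // x y z; first exact: h.
by move=> v; rewrite !a3_v.
Qed.

Lemma GH3E a : GH3 F e a <-> [/\ T_uperp F a,
  forall x y z, a3 a (J x) (J y) z = a3 a x y z &
  forall z, \sum_i a3 a (e i) (e i) z = 0].
Proof.
split=> -[ta h1 h2]; split=> //.
- by move=> x y z; exact: h1.
- by move=> z; exact: h2.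
- by move=> x y z v; rewrite !a3_v.
- by move=> z v; under eq_bigr do rewrite a3_v //.
Qed.

(** The element e_i (x) (e_i /\ mu - I e_i /\ I mu) of W_4 for mu = <., m0>, evaluated on three
    vectors. *)
Definition quad m0 x y z := (g y x * g z m0 - g z x * g y m0)
  - (g y (J x) * g z (J m0) - g z (J x) * g y (J m0)).

Lemma trip_quad m0 : trip (quad m0).
Proof.
split=> [c x y z w|x]; first by rewrite /quad Jlc // !glcr //; ring.
split=> [c y z t|y z|y z]; rewrite /quad.
- by rewrite !glcl //; ring.
- by ring.
- by rewrite !gJJ // !(gJ HG HJ); ring.
Qed.

Lemma wedge11_flat x y v : wedge 1 1 (flat F x) (flat F y) v =
  g (v 0%N) x * g (v 1%N) y - g (v 1%N) x * g (v 0%N) y.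
Proof.
rewrite (wedge_flat HG); last exact: skew_flat.
rewrite W_def w1_def !big_ord_recl big_ord0 /= /flat /vdel /bump /=.
by rewrite expr0 expr1; ring.
Qed.

Lemma GH4E : GH4 F e = [set tens (quad m0) | m0 in setT].
Proof.
have key m0 : (fun v => \sum_i otimes (flat F (e i))
           (fun w => wedge 1 1 (flat F (e i)) (flat F m0) w
                     - wedge 1 1 (flat F (J (e i))) (Islot F 0 (flat F m0)) w) v) = tens (quad m0).
  apply/funext => v.
  have -> : Islot F 0 (flat F m0) = flat F (J m0).
    by apply/funext => w; rewrite /Islot /flat /= gJr.
  under eq_bigr => i _ do rewrite /otimes !wedge11_flat /flat /vshift /= !add1n.
  have l : linform (fun x => quad m0 x (v 1%N) (v 2%N)).
    by move=> c x y; rewrite (tl (trip_quad m0)).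
  rewrite /tens -(sum_g (U := R^o) hspan (f := fun x => quad m0 x (v 1%N) (v 2%N))) //.
apply/seteqP; split=> [a [mu [smu _] ->]|_ [m0 _ <-]]; last first.
  by exists (flat F m0); [exact: skew_flat | rewrite key].
pose m0 := \sum_i mu (fun=> e i) *: e i; exists m0 => //; rewrite -key.
suff -> : mu = flat F m0 by [].
apply/funext => v; rewrite /flat /m0 g_sumr //.
have ml := multilinear_lin0 smu; have [dep _] := smu.
rewrite -[LHS](_ : iprod (v 0%N) mu (fun=> 0) = _); last by apply: dep; case.
rewrite -(sum_ipg hspan (v 0%N) ml) tensor_sum; apply: eq_bigr => i _.
rewrite tensorZ gZr // mulrC; congr (_ * _).
by apply: dep; case.
Qed.

(** The types of W_1 + W_2 and, for [Janti], of W_3 + W_4; see [Jlin_split] and [Janti_split]. *)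
Definition Jlin a := forall x y z, a3 a (J x) (J y) z = - a3 a x y z.
Definition Janti a := forall x y z, a3 a (J x) (J y) z = a3 a x y z.

Lemma a3D a b x y z : a3 (a + b) x y z = a3 a x y z + a3 b x y z.
Proof. by []. Qed.
Lemma a3N a x y z : a3 (- a) x y z = - a3 a x y z.
Proof. by []. Qed.
Lemma a3Z (k : R) a x y z : a3 (k *: a) x y z = k * a3 a x y z.
Proof. by []. Qed.
Lemma a3_0 x y z : a3 0 x y z = 0.
Proof. by []. Qed.
Definition a3_E := (a3D, a3N, a3Z, a3_0).

Lemma T_uperp_D a b : T_uperp F a -> T_uperp F b -> T_uperp F (a + b).
Proof. by move=> ta tb; have := T_uperp_lc 1 ta tb; rewrite scale1r. Qed.
Lemma T_uperp_Z (k : R) a : T_uperp F a -> T_uperp F (k *: a).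
Proof. by move=> ta; have := T_uperp_lc k ta T_uperp_0; rewrite addr0. Qed.
Lemma T_uperp_N a : T_uperp F a -> T_uperp F (- a).
Proof. by move=> ta; rewrite -scaleN1r; exact: T_uperp_Z. Qed.

Section A3.
Variable a : tensor V.
Hypothesis ta : T_uperp F a.

Lemma a3_anti x y z : a3 a x y z = - a3 a x z y.
Proof. exact: (uanti (tu (T_uperp_trip ta) x)). Qed.
Lemma a3_J x y z : a3 a x (J y) z = a3 a x y (J z).
Proof. exact: (u_J (tu (T_uperp_trip ta) x)). Qed.
Lemma a3_JJ x y z : a3 a x (J y) (J z) = - a3 a x y z.
Proof. exact: (uJJ (tu (T_uperp_trip ta) x)). Qed.
Lemma a3_0l y z : a3 a 0 y z = 0.
Proof.
have := tl (T_uperp_trip ta) (-1) 0 0 y z.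
by rewrite scaleN1r addr0 oppr0 mulN1r addNr.
Qed.
Lemma a3_Nl x y z : a3 a (- x) y z = - a3 a x y z.
Proof.
have := tl (T_uperp_trip ta) (-1) x 0 y z.
by rewrite scaleN1r addr0 a3_0l mulN1r addr0.
Qed.
Lemma a3_N2 x y z : a3 a x (- y) z = - a3 a x y z.
Proof. exact: (uN (tu (T_uperp_trip ta) x)). Qed.
Lemma a3_l1 (k : R) x x' y z : a3 a (k *: x + x') y z = k * a3 a x y z + a3 a x' y z.
Proof. exact: (tl (T_uperp_trip ta)). Qed.
Lemma a3_l2 (k : R) x y y' z : a3 a x (k *: y + y') z = k * a3 a x y z + a3 a x y' z.
Proof. exact: (ubil (tu (T_uperp_trip ta) x)). Qed.
Lemma a3_l3 (k : R) x y z z' : a3 a x y (k *: z + z') = k * a3 a x y z + a3 a x y z'.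
Proof. exact: (u_r (tu (T_uperp_trip ta) x)). Qed.
End A3.

(** Total skewness moves both J's into the last two slots, where membership in u(n)^perp gives the
    sign. *)
Lemma GH1_Jlin a : GH1 F a -> Jlin a.
Proof.
move=> /GH1E[ta h] x y z.
by rewrite (a3_anti ta) h opprK a3_JJ // (h z x y) opprK (a3_anti ta).
Qed.

(* other vanishes.                                                             *)
Lemma sym12_skew23 (A : V -> V -> V -> R) : (forall x y z, A x y z = A y x z) ->
  (forall x y z, A x y z = - A x z y) -> forall x y z, A x y z = 0.
Proof.
move=> s k x y z.
have : A x y z = - A x y z; last by lra.
(* Six alternating swaps restore the order of x, y, z with three changes of sign. *)
by rewrite {1}k s k s opprK k s.
Qed.

(** The cyclic identities at (x,y,z) and (Jx,Jy,z) make a + a(J.,J.,.) symmetric in its first two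
    slots, and it is skew in the last two. *)
Lemma GH2_Jlin a : GH2 F a -> Jlin a.
Proof.
move=> /GH2E[ta h]; pose A x y z := a3 a x y z + a3 a (J x) (J y) z.
have A0 : forall x y z, A x y z = 0.
  apply: sym12_skew23 => x y z; rewrite /A.
    have := h x y z; have := h (J x) (J y) z.
    by rewrite (a3_JJ ta z) (a3_anti ta (J y) z (J x)) (a3_anti ta y z x); lra.
  by rewrite (a3_anti ta x y) (a3_J ta (J x)) (a3_anti ta (J x) y) opprD.
by move=> x y z; have := A0 x y z; rewrite /A; lra.
Qed.

Lemma GH3_Janti a : GH3 F e a -> Janti a.
Proof. by case/GH3E. Qed.

Lemma GH4_uperp a : GH4 F e a -> T_uperp F a.
Proof. by rewrite GH4E => -[m0 _ <-]; exact/T_uperp_tens/trip_quad. Qed.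
Lemma GH4_Janti a : GH4 F e a -> Janti a.
Proof.
rewrite GH4E => -[m0 _ <-] x y z; rewrite /a3 /tens /= /quad.
by rewrite !JJ // !gNr // !gJJ // !(gJ HG HJ); ring.
Qed.
Lemma GH1_uperp a : GH1 F a -> T_uperp F a. Proof. by case/GH1E. Qed.
Lemma GH2_uperp a : GH2 F a -> T_uperp F a. Proof. by case/GH2E. Qed.
Lemma GH3_uperp a : GH3 F e a -> T_uperp F a. Proof. by case/GH3E. Qed.

Lemma GH1_lc (k : R) a b : GH1 F a -> GH1 F b -> GH1 F (k *: a + b).
Proof.
move=> /GH1E[ta h] /GH1E[tb h']; apply/GH1E; split; first exact: T_uperp_lc.
by move=> x y z; rewrite !a3_E h h'; ring.
Qed.
Lemma GH2_lc (k : R) a b : GH2 F a -> GH2 F b -> GH2 F (k *: a + b).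
Proof.
move=> /GH2E[ta h] /GH2E[tb h']; apply/GH2E; split; first exact: T_uperp_lc.
move=> x y z; rewrite !a3_E; have := h x y z; have := h' x y z => q1 q2.
transitivity (k * (a3 a x y z + a3 a y z x + a3 a z x y)
  + (a3 b x y z + a3 b y z x + a3 b z x y)); first by ring.
by rewrite q1 q2 mulr0 addr0.
Qed.
Lemma GH3_lc (k : R) a b : GH3 F e a -> GH3 F e b -> GH3 F e (k *: a + b).
Proof.
move=> /GH3E[ta h t] /GH3E[tb h' t']; apply/GH3E; split; first exact: T_uperp_lc.
  by move=> x y z; rewrite !a3_E h h'.
move=> z; under eq_bigr do rewrite !a3_E.
by rewrite big_split /= -mulr_sumr t t' mulr0 addr0.
Qed.
Lemma GH4_lc (k : R) a b : GH4 F e a -> GH4 F e b -> GH4 F e (k *: a + b).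
Proof.
rewrite GH4E => -[m1 _ <-] [m2 _ <-]; exists (k *: m1 + m2) => //.
apply/funext => v; rewrite !tensorE /tens /quad Jlc // !glcr //; ring.
Qed.

Lemma type_split a : T_uperp F a -> exists b c, [/\ T_uperp F b, T_uperp F c, Jlin b, Janti c & a = b + c].
Proof.
move=> ta; have tj := aJJ_uperp ta.
exists (2^-1 *: (a - aJJ a)), (2^-1 *: (a + aJJ a)); split.
- exact/T_uperp_Z/T_uperp_D/T_uperp_N.
- exact/T_uperp_Z/T_uperp_D.
- by move=> x y z; rewrite !a3_E !a3JJ !JJ // (a3_Nl ta) (a3_N2 ta); ring.
- by move=> x y z; rewrite !a3_E !a3JJ !JJ // (a3_Nl ta) (a3_N2 ta); ring.
- by apply/funext => v; rewrite !tensorE; field.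
Qed.

(** The W_1 part is the cyclic average of a; [Jlin a] ensures that the average again takes values in
    u(n)^perp. *)
Lemma Jlin_split a : T_uperp F a -> Jlin a -> exists b c, [/\ GH1 F b, GH2 F c & a = b + c].
Proof.
move=> ta ja; pose A x y z := 3^-1 * (a3 a x y z + a3 a y z x + a3 a z x y).
have tA : trip A.
  rewrite /A; split=> [c x y z t|x].
    by rewrite !(a3_l1 ta, a3_l2 ta, a3_l3 ta); ring.
  split=> [c y z t|y z|y z].
  - by rewrite !(a3_l1 ta, a3_l2 ta, a3_l3 ta); ring.
  - by rewrite (a3_anti ta x z) (a3_anti ta z y) (a3_anti ta y x); ring.
  - by rewrite (a3_JJ ta) -(a3_J ta (J z)) !ja; ring.
have t1 : T_uperp F (tens A) by exact: T_uperp_tens.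
have aA x y z : a3 (tens A) x y z = A x y z by [].
exists (tens A), (a - tens A); split.
- apply/GH1E; split=> // x y z; rewrite !aA /A.
  by rewrite (a3_anti ta x) (a3_anti ta y) (a3_anti ta z); ring.
- apply/GH2E; split=> [|x y z]; first exact/T_uperp_D/T_uperp_N.
  by rewrite !(a3D, a3N) !aA /A; field.
- by rewrite addrC subrK.
Qed.

Lemma sum_ge x y : \sum_i g (e i) x * g (e i) y = g x y.
Proof. by rewrite -(sum_gg HG hspan x y); apply: eq_bigr => i _; rewrite !(gC HG (e i)). Qed.

Lemma sum_quad m0 z : \sum_i quad m0 (e i) (e i) z = (n.*2%:R - 2) * g z m0.
Proof.
have g0 x : g x (J x) = 0 by have := gJ HG HJ x x; rewrite gC // => h; lra.
have E i : quad m0 (e i) (e i) z = g z m0 - g (e i) z * g (e i) m0 - g (e i) (J z) * g (e i) (J m0).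
  rewrite /quad he eqxx g0 (gC HG z (e i)) (gC HG z (J (e i))) (gJ HG HJ (e i) z) mul1r; ring.
under eq_bigr => i _ do rewrite E.
rewrite !sumrB !sum_ge gJJ // sumr_const card_ord -[_ *+ _]mulr_natl; ring.
Qed.

Lemma n2_neq0 : n.*2%:R - 2 != 0 :> R.
Proof. by rewrite -natrB // pnatr_eq0. Qed.

(** By [sum_quad] the element of W_4 attached to m0 has trace (2n-2) m0, so the W_4 part is found by
    dividing the trace of a by 2n-2. *)
Lemma Janti_split a : T_uperp F a -> Janti a ->
  exists b c, [/\ GH3 F e b, GH4 F e c & a = b + c].
Proof.
move=> ta ja; pose t z := \sum_i a3 a (e i) (e i) z.
pose m0 := (n.*2%:R - 2)^-1 *: \sum_j t (e j) *: e j.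
have tz z : (n.*2%:R - 2) * g z m0 = t z.
  rewrite /m0 gZr // mulrA mulfV ?n2_neq0 // mul1r g_sumr //.
  rewrite -[RHS](sum_g (U := R^o) hspan (f := t)).
    by apply: eq_bigr => j _; rewrite gZr // mulrC.
  move=> k x y; rewrite /t scaler_sumr -big_split /=; apply: eq_bigr => i _.
  exact: (u_r (tu (T_uperp_trip ta) (e i))).
have t4 : GH4 F e (tens (quad m0)) by rewrite GH4E; exists m0.
exists (a - tens (quad m0)), (tens (quad m0)); split=> //; last by rewrite subrK.
apply/GH3E; split; first exact/T_uperp_D/T_uperp_N/GH4_uperp.
  by move=> x y z; rewrite !(a3D a) !a3N ja (GH4_Janti t4).
move=> z; under eq_bigr do rewrite (a3D a) a3N.
by rewrite sumrB sum_quad tz subrr.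
Qed.

Lemma type_indep a b : T_uperp F a -> T_uperp F b -> Jlin a -> Janti b ->
  a + b = 0 -> a = 0 /\ b = 0.
Proof.
move=> ta tb ja jb h.
have E x y z : a3 a x y z = 0 /\ a3 b x y z = 0.
  have h1 := congr1 (fun c => a3 c x y z) h.
  have h2 := congr1 (fun c => a3 c (J x) (J y) z) h.
  move: h1 h2; rewrite !a3_E ja jb => h1 h2; split; lra.
by split; apply: a3_inj => // *; rewrite ?(E _ _ _).1 ?(E _ _ _).2 //; exact: T_uperp_0.
Qed.

Lemma GH12_indep a b : GH1 F a -> GH2 F b -> a + b = 0 -> a = 0 /\ b = 0.
Proof.
move=> /GH1E[ta ha] /GH2E[tb hb] h.
have E x y z : a3 a x y z = 0.
  have q x' y' z' := congr1 (fun c => a3 c x' y' z') h.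
  have := hb x y z; have := q x y z; have := q y z x; have := q z x y.
  rewrite !a3_E (ha z x y) (a3_anti ta x z y) (a3_anti ta y z x) (ha y x z); lra.
have a0 : a = 0 by apply: a3_inj => //; exact: T_uperp_0.
by split=> //; move: h; rewrite a0 add0r.
Qed.

Lemma GH34_indep a b : GH3 F e a -> GH4 F e b -> a + b = 0 -> a = 0 /\ b = 0.
Proof.
move=> /GH3E[ta ja h3]; rewrite GH4E => -[m0 _ <-] h.
have m00 z : g z m0 = 0.
  have := sum_quad m0 z.
  have -> : \sum_i quad m0 (e i) (e i) z = \sum_i a3 (a + tens (quad m0)) (e i) (e i) z.
    by under [RHS]eq_bigr do rewrite (a3D a); rewrite [RHS]big_split /= h3 add0r.
  rewrite h big1 // => /esym/eqP; rewrite mulf_eq0 (negbTE n2_neq0) /=.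
  by move/eqP.
have q0 : tens (quad m0) = 0.
  apply/funext => v; rewrite tensor0 /tens /quad !(gJr HG HJ) !m00; ring.
by split=> //; move: h; rewrite q0 addr0.
Qed.

Lemma sum_modules2 (A B : set (tensor V)) b :
  sum_modules [:: A; B] b <-> exists D E, [/\ A D, B E & b = D + E].
Proof.
split=> [[h hAB ->]|[D [E [AD BE ->]]]].
  exists (h 0%N), (h 1%N); split; [exact: (hAB 0%N)|exact: (hAB 1%N)|].
  by apply/funext => v; rewrite !big_ord_recl big_ord0 addr0.
exists (fun i => if i is 0%N then D else E) => [[|[|]]//|].
by apply/funext => v; rewrite !big_ord_recl big_ord0 addr0.
Qed.

Lemma calL_Jlin a : T_uperp F a ->
  calL n F (Xip a) = (n - 2)%:R *: Xip a <-> Jlin a.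
Proof.
move=> ta; have tj := aJJ_uperp ta; have tn := T_uperp_N ta.
have nz : (n - 2)%:R != 0 :> R by rewrite pnatr_eq0.
rewrite calL_Xip //; split=> [h|ja].
  have : Xip (aJJ a) = Xip (- a).
    have -> : Xip (- a) = - Xip a by rewrite -scaleN1r Xip_Z // scaleN1r.
    apply/funext => v; have := congr1 (@^~ v) h; rewrite tensorN !tensorZ mulNr.
    by rewrite -mulrN => /(mulfI nz) <-; rewrite opprK.
  by move/(Xip_inj tj tn) => e' x y z; rewrite -a3JJ e'.
have -> : aJJ a = - a by apply: a3_inj => // x y z; rewrite a3JJ ja.
have -> : Xip (- a) = - Xip a by rewrite -scaleN1r Xip_Z // scaleN1r.
by rewrite scalerN scaleNr opprK.
Qed.

Lemma calL_Janti a : T_uperp F a ->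
  calL n F (Xip a) = - (n - 2)%:R *: Xip a <-> Janti a.
Proof.
move=> ta; have tj := aJJ_uperp ta.
have nz : (n - 2)%:R != 0 :> R by rewrite pnatr_eq0.
rewrite calL_Xip //; split=> [h|ja].
  have : Xip (aJJ a) = Xip a.
    apply/funext => v; have := congr1 (@^~ v) h; rewrite !tensorZ.
    by move/(mulfI _); apply; rewrite oppr_eq0.
  by move/(Xip_inj tj ta) => e' x y z; rewrite -a3JJ e'.
by have -> : aJJ a = a by apply: a3_inj => // x y z; rewrite a3JJ ja.
Qed.

(** * Eigenspaces of L, equality of the images of Xi_+ and Xi_- *)

Lemma W12_E : sum_modules [:: W1_Xi F e; W2_Xi F e] =
  [set b | W_Xi n F b /\ calL n F b = (fun v => (n - 2)%:R * b v)].
Proof.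
apply/seteqP; split=> b.
  move/sum_modules2 => [_ [_ [[a1 g1 <-] [a2 g2 <-] ->]]].
  have t1 := GH1_uperp g1; have t2 := GH2_uperp g2.
  rewrite -Xip_D //; have t := T_uperp_D t1 t2; split.
    by rewrite W_Xi_E; exists (a1 + a2).
  apply/(calL_Jlin t) => x y z.
  by rewrite !a3D (GH1_Jlin g1) (GH2_Jlin g2) opprD.
case; rewrite W_Xi_E => -[a ta <-] /(calL_Jlin ta)/(Jlin_split ta)[a1 [a2 [g1 g2 ->]]].
apply/sum_modules2; exists (Xip a1), (Xip a2); split.
- by exists a1.
- by exists a2.
- by rewrite Xip_D //; [exact: GH1_uperp|exact: GH2_uperp].
Qed.

Lemma W34_E : sum_modules [:: W3_Xi F e; W4_Xi F e] =
  [set b | W_Xi n F b /\ calL n F b = (fun v => - (n - 2)%:R * b v)].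
Proof.
apply/seteqP; split=> b.
  move/sum_modules2 => [_ [_ [[a1 g1 <-] [a2 g2 <-] ->]]].
  have t1 := GH3_uperp g1; have t2 := GH4_uperp g2.
  rewrite -Xip_D //; have t := T_uperp_D t1 t2; split.
    by rewrite W_Xi_E; exists (a1 + a2).
  apply/(calL_Janti t) => x y z.
  by rewrite !a3D (GH3_Janti g1) (GH4_Janti g2).
case; rewrite W_Xi_E => -[a ta <-] /(calL_Janti ta)/(Janti_split ta)[a1 [a2 [g1 g2 ->]]].
apply/sum_modules2; exists (Xip a1), (Xip a2); split.
- by exists a1.
- by exists a2.
- by rewrite Xip_D //; [exact: GH3_uperp|exact: GH4_uperp].
Qed.

Lemma lc_neg (S : set (tensor V)) a :
  (forall (k : R) a b, S a -> S b -> S (k *: a + b)) -> S a -> S (- a).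
Proof.
move=> h Sa; have := h (-2) a a Sa Sa.
by have -> : -2 *: a + a = - a by tring.
Qed.
Lemma lc_diff (S : set (tensor V)) a b :
  (forall (k : R) a b, S a -> S b -> S (k *: a + b)) -> S a -> S b -> S (a - b).
Proof.
by move=> h Sa Sb; have := h (-1) b a Sb Sa; rewrite scaleN1r addrC.
Qed.

(** The operation [aJ] squares to -1, hence maps any subspace stable under it onto itself. *)
Lemma Xip_Xim_image (S : set (tensor V)) :
  S `<=` T_uperp F -> (forall a, S a -> S (aJ a)) ->
  (forall (k : R) a b, S a -> S b -> S (k *: a + b)) -> Xip @` S = Xim @` S.
Proof.
move=> st sj slc; apply/seteqP; split=> [_ [a Sa <-]|_ [a Sa <-]]; last first.
  by rewrite Xim_Xip; [exists (aJ a) => //; exact: sj | exact: st].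
exists (- aJ a); first exact/(lc_neg slc)/sj.
rewrite Xim_Xip; last exact/st/(lc_neg slc)/sj.
congr Xip; apply: a3_inj => [||x y z].
- exact/st/sj/(lc_neg slc)/sj.
- exact: st.
- have -> : a3 (aJ (- aJ a)) x y z = - a3 a x (J (J y)) z by [].
  by rewrite JJ // (a3_N2 (st _ Sa)) opprK.
Qed.

Lemma a3aJ a x y z : a3 (aJ a) x y z = a3 a x (J y) z. Proof. by []. Qed.

Lemma Jlin_J1 a x y z : T_uperp F a -> Jlin a -> a3 a (J x) y z = a3 a x (J y) z.
Proof.
move=> ta h; have := h x (J y) z; rewrite JJ // (a3_N2 ta); lra.
Qed.

Lemma GH1_aJ a : GH1 F a -> GH1 F (aJ a).
Proof.
move=> g1; have j := GH1_Jlin g1; move/GH1E: g1 => [ta h].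
apply/GH1E; split=> [|x y z]; first exact: aJ_uperp.
by rewrite !a3aJ h (Jlin_J1 _ _ _ ta j).
Qed.
Lemma GH2_aJ a : GH2 F a -> GH2 F (aJ a).
Proof.
move=> g1; have j := GH2_Jlin g1; move/GH2E: g1 => [ta h].
apply/GH2E; split=> [|x y z]; first exact: aJ_uperp.
rewrite !a3aJ -(Jlin_J1 _ _ _ ta j) (a3_J ta y); exact: h.
Qed.
Lemma GH3_aJ a : GH3 F e a -> GH3 F e (aJ a).
Proof.
move=> /GH3E[ta j t]; apply/GH3E; split=> [|x y z|z]; first exact: aJ_uperp.
  by rewrite !a3aJ j.
under eq_bigr do rewrite a3aJ a3_J //; exact: t.
Qed.
Lemma GH4_aJ a : GH4 F e a -> GH4 F e (aJ a).
Proof.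
rewrite GH4E => -[m0 _ <-]; exists (- J m0) => //.
apply: a3_inj => [||x y z].
- exact/T_uperp_tens/trip_quad.
- exact/aJ_uperp/T_uperp_tens/trip_quad.
rewrite a3aJ /a3 /tens /= /quad JN // JJ // opprK !(gJ HG HJ) !JJ // !gNr //; ring.
Qed.

(** * Directness of the sum with W_5 *)

Lemma Lam_psip : Lam psip = 0. Proof. exact: Lam_lam psip_lam. Qed.
Lemma Lam_psim : Lam psim = 0. Proof. exact: Lam_lam psim_lam. Qed.

(** psi is killed by Lambda, whereas Lambda(omega /\ c) = -4 c; a multiple of psi of the form omega
    /\ c therefore has c = 0. *)
Lemma Xip_W5 a (psi : tensor V) : T_uperp F a -> Lam psi = 0 -> W5 n psi (Xip a) -> a = 0.
Proof.
move=> ta lpsi [_ h]; apply: Xip_inj => //; first exact: T_uperp_0.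
apply: tensor_ext => X; rewrite Xip_0 ip0; have [k hk] := h X.
have {}hk : iprod X (Xip a) = k *: psi := hk.
have := congr1 Lam hk; rewrite [in RHS]LamZ lpsi scaler0 iprod_Xip // LamZ Lam_Lo_lam; last exact: cont_lam.
move=> h0; have c0 : cont (a3 a X) = 0.
  apply/funext => v; have := congr1 (@^~ v) h0; rewrite !tensorE; lra.
by rewrite c0 Lo0 scaler0.
Qed.

Lemma W5_lc (psi : tensor V) : forall (k : R) a b, W5 n psi a -> W5 n psi b -> W5 n psi (k *: a + b).
Proof.
move=> k a b [ma ha] [mb hb]; split; first exact: multilinear_lc.
move=> x; have [r hr] := ha x; have [s hs] := hb x; exists (k * r + s).
rewrite ipD ipZ hr hs; apply/funext => v; rewrite !tensorE; ring.
Qed.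

Lemma Xip_diff (S : set (tensor V)) D E : S `<=` T_uperp F ->
  (forall (k : R) a b, S a -> S b -> S (k *: a + b)) ->
  (Xip @` S) D -> (Xip @` S) E -> exists2 a, S a & Xip a = D - E.
Proof.
move=> st slc [a Sa <-] [b Sb <-]; exists (a - b); first exact: lc_diff.
rewrite -scaleN1r addrC Xip_lc; [|exact: st|exact: st].
by rewrite scaleN1r addrC.
Qed.

Lemma direct_W (psi : tensor V) : Lam psi = 0 ->
  direct_modules [:: W1_Xi F e; W2_Xi F e; W3_Xi F e; W4_Xi F e; W5 n psi].
Proof.
move=> lpsi h k hk hs.
have [d1 g1 e1] := Xip_diff GH1_uperp GH1_lc (hk 0%N isT).1 (hk 0%N isT).2.
have [d2 g2 e2] := Xip_diff GH2_uperp GH2_lc (hk 1%N isT).1 (hk 1%N isT).2.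
have [d3 g3 e3] := Xip_diff GH3_uperp GH3_lc (hk 2%N isT).1 (hk 2%N isT).2.
have [d4 g4 e4] := Xip_diff GH4_uperp GH4_lc (hk 3%N isT).1 (hk 3%N isT).2.
have w5 := lc_diff (@W5_lc psi) (hk 4%N isT).2 (hk 4%N isT).1.
have t1 := GH1_uperp g1; have t2 := GH2_uperp g2.
have t3 := GH3_uperp g3; have t4 := GH4_uperp g4.
have t12 := T_uperp_D t1 t2; have t34 := T_uperp_D t3 t4.
(* The differences of two decompositions combine to one element of T^* tensor u(n)^perp whose image
   lies in W_5. *)
have key : Xip (d1 + d2 + (d3 + d4)) = k 4%N - h 4%N.
  rewrite !Xip_D // e1 e2 e3 e4; apply/funext => v; have := hs v.
  rewrite !big_ord_recl !big_ord0 /= /bump /= !tensorE; lra.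
have d0 : d1 + d2 + (d3 + d4) = 0.
  by apply: (Xip_W5 _ lpsi); [exact: T_uperp_D | rewrite key].
have [d12 d34] : d1 + d2 = 0 /\ d3 + d4 = 0.
  apply: type_indep => // x y z; rewrite !a3D.
    by rewrite (GH1_Jlin g1) (GH2_Jlin g2) opprD.
  by rewrite (GH3_Janti g3) (GH4_Janti g4).
have [d10 d20] := GH12_indep g1 g2 d12; have [d30 d40] := GH34_indep g3 g4 d34.
move: e1 e2 e3 e4 key; rewrite d0 d10 d20 d30 d40 Xip_0 => e1 e2 e3 e4 e5.
case=> [|[|[|[|[|//]]]]] _; apply/eqP; rewrite -subr_eq0; apply/eqP => //.
by rewrite -opprB -e5 oppr0.
Qed.

(** * Explicit form of W_4 and W_1 *)

Lemma iprod_elt_W4 (psi : tensor V) x X : lam n psi ->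
  iprod X (elt_W4 F e psi x) = Lo m.+2 (iprod X (iprod x psi)).
Proof.
move=> l; have ml := lam_lin0 (lam_iprod x l).
rewrite -(sum_ipg hspan X ml) Lo_sum; apply/funext => v.
rewrite /iprod /elt_W4 tensor_sum; apply: eq_bigr => i _.
rewrite /otimes vshift1_cons LoZ tensorZ; congr (_ * _).
rewrite wedge_omega //; exact: lam_skew (lam_iprod _ (lam_iprod _ l)).
Qed.

Lemma sum_sum_ip x y : \sum_i \sum_j (g (e i) x * g (e j) y) *: iprod (e j) (iprod (e i) psip)
  = iprod y (iprod x psip).
Proof.
rewrite -(sum_ipg hspan y (lam_lin0 (lam_iprod x psip_lam))) exchange_big /=.
apply: eq_bigr => j _; rewrite -(sum_ipg hspan x lp) ip_sum scaler_sumr.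
apply: eq_bigr => i _; rewrite ipZ scalerA.
by rewrite (gC HG y) (gC HG x) mulrC.
Qed.

(** The four terms of [quad] contribute equally, because psi_+ is skew and of type (n,0). *)
Lemma cont_quad m0 X : cont (quad m0 X) = - 4 *: iprod X (iprod m0 psip).
Proof.
have s x y : \sum_i \sum_j (g (e j) x * g (e i) y) *: iprod (e j) (iprod (e i) psip)
    = iprod x (iprod y psip).
  rewrite -sum_sum_ip; apply: eq_bigr => i _; apply: eq_bigr => j _.
  by rewrite mulrC.
rewrite contE /quad.
under eq_bigr => i _ do under eq_bigr => j _ do rewrite !scalerBl.
under eq_bigr => i _ do rewrite 3!sumrB.
rewrite 3!sumrB !sum_sum_ip !s !(lam_JJ _ _ psip_lam) (skew_anti m0 X (lam_skew psip_lam)).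
by tring.
Qed.

Lemma Xip_quad m0 : Xip (tens (quad m0)) = elt_W4 F e psip m0.
Proof.
have t := T_uperp_tens (trip_quad m0); apply: tensor_ext => X.
rewrite iprod_Xip // iprod_elt_W4 // [a3 _ X](_ : _ = quad m0 X) // cont_quad LoZ.
by apply/funext => v; rewrite !tensorE; field.
Qed.

Lemma W4_psip : W4_Xi F e = [set elt_W4 F e psip x | x in setT].
Proof.
rewrite /W4_Xi GH4E; apply/seteqP; split=> [_ [_ [m0 _ <-] <-]|_ [m0 _ <-]].
  by exists m0 => //; rewrite Xip_quad.
by exists (tens (quad m0)); [exists m0 | rewrite Xip_quad].
Qed.

Lemma elt_W4_psim x : elt_W4 F e psim x = elt_W4 F e psip (- J x).
Proof.
apply: tensor_ext => X; rewrite !iprod_elt_W4 //.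
by rewrite iprod_psim -(lin0N _ lp).
Qed.

Lemma W4_psim : W4_Xi F e = [set elt_W4 F e psim x | x in setT].
Proof.
rewrite W4_psip; apply/seteqP; split=> [_ [x _ <-]|_ [x _ <-]].
  by exists (J x) => //; rewrite elt_W4_psim JJ // opprK.
by exists (- J x) => //; rewrite elt_W4_psim.
Qed.

(** The two sums of [elt_W1] assemble to X /\ I b + I X /\ b, which is [Th] applied to I b because I
    I b = -b. *)
Lemma iprod_elt_W1 b X : lam m.+1 b ->
  iprod X (elt_W1 F e b) = Lo m.+2 (Th m.+1 X (II b)).
Proof.
move=> l; have ll := lam_II HJ l.
have wf x d : lam m.+1 d -> wedge 1 (n - 3) (flat F x) d = W m.+1 x d.
  by move=> ld; apply: (wedge_flat HG); exact: lam_skew ld.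
have sW x d : lam m.+1 d -> skew_form m.+2 (W m.+1 x d).
  by move=> ld; apply: (skew_W HG); exact: lam_skew ld.
rewrite Th_def II_II //; last exact: lam_lin0 l.
rewrite WrN opprK LoD -(sum_Wg HG hspan _ X) -(sum_WgJ HG HJ hspan _ X) !Lo_sum.
apply/funext => v; rewrite tensorD addrC /iprod /elt_W1 !tensor_sum; congr (_ + _).
  apply: eq_bigr => i _; rewrite /otimes vshift1_cons LoZ tensorZ; congr (_ * _).
  by rewrite wf // wedge_omega //; exact: sW.
apply: eq_bigr => i _; rewrite /otimes vshift1_cons LoZ tensorZ; congr (_ * _).
have -> : Islot F 0 b = II b by rewrite II.unlock.
by rewrite wf // wedge_omega //; exact: sW.
Qed.

Lemma cont_vlin a : T_uperp F a -> vlin (fun X => cont (a3 a X)).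
Proof.
move=> ta k x y; rewrite -cont_lc; congr cont.
by apply/funext => z; apply/funext => t; exact: (a3_l1 ta).
Qed.

(** For a in W_1, the parameter b of [elt_W1] is I_(1) of this form divided by 24. *)
Definition cont3 a := \sum_k iprod (e k) (cont (a3 a (e k))).

Lemma cont3_lam a : T_uperp F a -> lam m.+1 (cont3 a).
Proof. by move=> ta; apply: lam_sum => i _; exact/lam_iprod/cont_lam. Qed.

(** 6 = 1 + 1 + 4: one from <e_i, Z>, one from the J term through [Jlin], and 4 from [Th_cont],
    where skewness of a exchanges e_i and Z. *)
Lemma Th_cont3 a Z : GH1 F a -> Th m.+1 Z (cont3 a) = 6 *: cont (a3 a Z).
Proof.
move=> g1; have ja := GH1_Jlin g1; have /GH1E[ta h] := g1.
have u X := tu (T_uperp_trip ta) X.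
rewrite /cont3 Th_sum.
have E i : Th m.+1 Z (iprod (e i) (cont (a3 a (e i)))) =
  g (e i) Z *: cont (a3 a (e i)) - g (e i) (J Z) *: II (cont (a3 a (e i)))
  + 4 *: iprod (Tm (a3 a Z) (e i)) (iprod (e i) psip).
  have := iprod_ThS HJ Z (e i) (cont_lam (a3 a (e i))).
  rewrite (Th_cont (u (e i))) ipZ.
  have -> : Tm (a3 a (e i)) Z = - Tm (a3 a Z) (e i).
    rewrite !Tm.unlock -sumrN; apply: eq_bigr => j _.
    by rewrite h scaleNr.
  rewrite (lin0N _ lp) ipN (skew_anti _ _ (lam_skew psip_lam)) opprK.
  move=> q; apply/funext => v; have := congr1 (@^~ v) q; rewrite !tensorE => {q}; lra.
under eq_bigr => i _ do rewrite E.
rewrite big_split sumrB /= -scaler_sumr.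
have -> : \sum_i iprod (Tm (a3 a Z) (e i)) (iprod (e i) psip) = cont (a3 a Z).
  by rewrite cont.unlock.
under eq_bigr => k _ do rewrite (gC HG _ Z).
under [X in _ - X + _]eq_bigr => k _ do rewrite (gC HG _ (J Z)).
rewrite (sum_g hspan Z (cont_vlin ta)).
rewrite (sum_g hspan (f := fun X => II (cont (a3 a X)))); last first.
  by move=> k x y; rewrite (cont_vlin ta) IID IIZ.
rewrite (II_cont (u (J Z))).
have -> : (fun x y => a3 a (J Z) (J x) y) = (fun x y => -1 * a3 a Z x y).
  by apply/funext => x; apply/funext => y; rewrite ja mulN1r.
rewrite cont_scale; tring.
Qed.

Lemma W1_E : W1_Xi F e = [set elt_W1 F e b | b in lam (n - 3)].
Proof.
apply/seteqP; split=> [_ [a g1 <-]|_ [b lb <-]].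
  have ta := GH1_uperp g1; have l3 := cont3_lam ta.
  have lb : lam m.+1 (24^-1 *: II (cont3 a)) by apply: lam_scale; exact: lam_II.
  (* 24 is the 6 of [Th_cont3] times the 4 of [iprod_Xip]; the sign of I_(1) I_(1) = -1 matches that
     of -1/4. *)
  exists (24^-1 *: II (cont3 a)) => //; apply: tensor_ext => X.
  rewrite iprod_elt_W1 // IIZ II_II //; last exact: lam_lin0 l3.
  rewrite iprod_Xip // ThZ ThN Th_cont3 // LoZ LoN LoZ.
  by apply/funext => v; rewrite !tensorE; field.
have lb' : lam m.+1 b := lb; have l2 := lam_II HJ lb'; have l0 := lam_lin0 l2.
pose c X := Th m.+1 X (II b).
have cl : vlin c by move=> k x y; rewrite /c Th_lc.
have [t h] := Xip_rec cl (fun X => lam_Th HG HJ X l2).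
exists (tens (recA c)); last by apply: tensor_ext => X; rewrite h iprod_elt_W1.
apply/GH1E; split=> // x y z.
have E X Y Z : a3 (tens (recA c)) X Y Z = - Th m.+3 Y (Th m.+2 Z (Th m.+1 X (II b))) (fseq f) by [].
rewrite !E (Th_anti HG HJ _ z x l0) (Th_anti HG HJ _ z y l0) !ThN.
rewrite (Th_anti HG HJ _ y x); last exact: lam_lin0 (lam_Th HG HJ z l2).
by rewrite !tensorN !opprK.
Qed.

(** * Alternation of Xi_+(a) and the description of W_3 *)

Lemma alternation_sum b : lin0 b -> (forall x, skew_form n (iprod x b)) ->
  alternation n b = \sum_i W n (e i) (iprod (e i) b).
Proof.
move=> l s; rewrite alternationE //; apply/funext => v.
rewrite tensor_sum; under [RHS]eq_bigr => i _ do rewrite W_def w1_def.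
rewrite exchange_big /=; apply: eq_bigr => k _.
have -> : b (vcons (v k) (vdel k v)) = iprod (v k) b (vdel k v) by [].
rewrite -(sum_ipg hspan (v k) l) tensor_sum mulr_sumr.
by apply: eq_bigr => i _; rewrite tensorZ mulrA.
Qed.

(* alternation (Xip a) = -1/4 omega /\ KK a.                                   *)
Definition KK a := \sum_i W m.+2 (e i) (cont (a3 a (e i))).

Lemma KK_skew a : T_uperp F a -> skew_form m.+3 (KK a).
Proof.
move=> ta; apply: skew_sum => i _; apply: (skew_W HG).
by apply: lam_skew; exact: cont_lam.
Qed.

Lemma alternation_Xip a : T_uperp F a ->
  alternation n (Xip a) = - 4^-1 *: Lo m.+3 (KK a).
Proof.
move=> ta; rewrite alternation_sum; [|exact: Xip_lin0|by move=> x; exact: Xip_skew].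
rewrite Lo_sum scaler_sumr; apply: eq_bigr => i _.
by rewrite iprod_Xip // WrZ -W_Lo.
Qed.

Lemma wedge_alternation_Xip a : T_uperp F a ->
  wedge n.+1 2 (alternation n (Xip a)) (kahler F) = - 4^-1 *: Lo m.+4.+1 (Lo m.+3 (KK a)).
Proof.
move=> ta; rewrite (wedge_kahler HG HJ hspan); rewrite alternation_Xip // ?LoZ //.
by apply: skew_scale; apply: skew_Lo => //; exact: KK_skew.
Qed.

Lemma Lam_W x c : lam m.+2 c -> Lam (W m.+2 x c) = 2 *: iprod (J x) c.
Proof.
move=> l; have l0 := lam_lin0 l; rewrite Lam_def.
have E i : iprod (J (e i)) (iprod (e i) (W m.+2 x c)) = g x (e i) *: iprod (J (e i)) c
   + g (J x) (e i) *: iprod (e i) c + W m x (iprod (J (e i)) (iprod (e i) c)).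
  rewrite iprod_WS ipB ipZ iprod_WS (gC HG (J _) x) (gC HG (e i) x) (gJr HG HJ).
  by tring.
under eq_bigr => i _ do rewrite E.
rewrite !big_split /= (sum_ipg hspan _ l0).
rewrite (sum_g hspan (f := fun y => iprod (J y) c)); last by move=> k y z; rewrite Jlc // l0.
by rewrite -Wr_sum -Lam_def (Lam_lam l) Wr0; tring.
Qed.

Lemma Lo_Lam_eq0 p c : lam p c -> (if p is q.+2 then Lo q (Lam c) else 0) = 0.
Proof. by case: p => [|[|p]] // l; rewrite (Lam_lam l) Lo0. Qed.

Lemma Lam_Lo1 B : lam m.+1 B -> Lam (Lo m.+1 B) = - 6 *: B.
Proof.
move=> l; rewrite (Lam_Lo HG HJ he hspan (lam_skew l)).
rewrite (Lo_Lam_eq0 l).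
rewrite addr0 -opprB -natrB; last lia.
by rewrite (_ : (_ - _)%N = 6%N); last lia.
Qed.

Lemma Lam_Lo3 D : skew_form m.+3 D -> Lam (Lo m.+3 D) = - 2 *: D + Lo m.+1 (Lam D).
Proof.
move=> s; rewrite (Lam_Lo HG HJ he hspan s) -opprB -natrB; last lia.
by rewrite (_ : (_ - _)%N = 2%N); last lia.
Qed.

(** Apply Lambda twice: first -2 K + omega /\ B = 0 with B = Lambda K of type (n-3,0), then -8 B =
    0. *)
Lemma Lo_KK_eq0 a : T_uperp F a -> Lo m.+3 (KK a) = 0 -> KK a = 0.
Proof.
move=> ta h; have := congr1 Lam h; rewrite Lam_Lo3; last exact: KK_skew.
have lK : lam m.+1 (Lam (KK a)).
  rewrite Lam_sum; apply: lam_sum => i _; rewrite Lam_W; last exact: cont_lam.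
  exact/lam_scale/lam_iprod/cont_lam.
rewrite Lam0 => h1; have := congr1 Lam h1; rewrite Lam0 LamD LamZ Lam_Lo1 //.
move=> h2; have l0 : Lam (KK a) = 0.
  by apply/funext => v; have := congr1 (@^~ v) h2; rewrite !tensorE; lra.
rewrite l0 Lo0 addr0 in h1.
by apply/funext => v; have := congr1 (@^~ v) h1; rewrite !tensorE; lra.
Qed.

(** Lambda lowers the power of omega in front of B by one each time, with nonzero factors -6, -8,
    -6. *)
Lemma Lo_Lo_Lo_eq0 B : lam m.+1 B -> Lo m.+4.+1 (Lo m.+3 (Lo m.+1 B)) = 0 -> B = 0.
Proof.
move=> l h; have s := lam_skew l; have s1 : skew_form m.+3 (Lo m.+1 B) by exact: skew_Lo.
have s2 : skew_form m.+4.+1 (Lo m.+3 (Lo m.+1 B)) by exact: skew_Lo.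
have e1 := Lam_Lo1 l; have e2 := Lam_Lo3 s1.
have := congr1 Lam h; rewrite Lam0 (Lam_Lo HG HJ he hspan s2) -natrB; last lia.
rewrite (_ : (_ - _)%N = 2%N); last lia.
rewrite e2 e1 => h3.
have h2 : Lo m.+3 (Lo m.+1 B) = 0.
  apply/funext => v; have := congr1 (@^~ v) h3.
  by rewrite !(LoD, LoZ) !tensorE; lra.
rewrite h2 Lam0 in e2.
have h1 : Lo m.+1 B = 0.
  apply/funext => v; have := congr1 (@^~ v) e2; rewrite e1 !(LoZ) !tensorE; lra.
rewrite h1 Lam0 in e1.
by apply/funext => v; have := congr1 (@^~ v) e1; rewrite !tensorE; lra.
Qed.

(** For this type c(a_{JX}) = -I c(a_X), so the sum of [Th e_i] applied to c(a_{e_i}) is 2 K;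
    [Th_cont] evaluates it. The vector on the right is dual to the trace of a. *)
Lemma KK_Janti a : T_uperp F a -> Janti a ->
  KK a = - 2 *: iprod (\sum_i Tm (a3 a (e i)) (e i)) psip.
Proof.
move=> ta ja; have u X := tu (T_uperp_trip ta) X.
have cJ X : cont (a3 a (J X)) = - II (cont (a3 a X)).
  have := II_cont (u (J X)).
  have -> : (fun x y => a3 a (J X) (J x) y) = a3 a X.
    by apply/funext => x; apply/funext => y; rewrite ja.
  by move=> <-; rewrite II_II ?opprK //; exact: lam_lin0 (cont_lam _).
have h : \sum_i Th m.+2 (e i) (cont (a3 a (e i))) = 2 *: KK a.
  under eq_bigr => i _ do rewrite Th_def -[II _]opprK -cJ WrN opprK.
  rewrite big_split /= (sum_JJ HG HJ hspan (B := fun x y => W m.+2 x (cont (a3 a y)))).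
  - by rewrite scaler_nat mulr2n.
  - by move=> y k x z; rewrite W_lc.
  - by move=> x k y z; rewrite (cont_vlin ta) WrD WrZ.
have h2 : \sum_i Th m.+2 (e i) (cont (a3 a (e i))) =
    - 4 *: iprod (\sum_i Tm (a3 a (e i)) (e i)) psip.
  by rewrite lin0_sum // scaler_sumr; apply: eq_bigr => i _; rewrite Th_cont.
by apply/funext => v; have := congr1 (@^~ v) (etrans (esym h) h2); rewrite !tensorE; lra.
Qed.

Lemma iprod2_KK a x y : T_uperp F a -> iprod y (iprod x (KK a)) =
  iprod y (cont (a3 a x)) - iprod x (cont (a3 a y))
  + \sum_i W m (e i) (iprod y (iprod x (cont (a3 a (e i))))).
Proof.
move=> ta; have cl := cont_vlin ta; rewrite /KK 2!ip_sum.
have E i : iprod y (iprod x (W m.+2 (e i) (cont (a3 a (e i))))) =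
  g x (e i) *: iprod y (cont (a3 a (e i))) - g y (e i) *: iprod x (cont (a3 a (e i)))
  + W m (e i) (iprod y (iprod x (cont (a3 a (e i))))).
  by rewrite iprod_WS ipB ipZ iprod_WS; tring.
under eq_bigr => i _ do rewrite E.
rewrite big_split sumrB /=.
rewrite (sum_g hspan (f := fun z => iprod y (cont (a3 a z)))); last first.
  by move=> k z t; rewrite cl ipD ipZ.
rewrite (sum_g hspan (f := fun z => iprod x (cont (a3 a z)))) //.
by move=> k z t; rewrite cl ipD ipZ.
Qed.

(** The remaining sum in [iprod2_KK] changes sign when (x,y) becomes (Jx,Jy). Adding both identities
    makes [U] symmetric, and one more contraction gives a tensor skew in another pair of slots, so
    [U] vanishes. *)
Lemma KK0_Janti a : T_uperp F a -> KK a = 0 -> Janti a.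
Proof.
move=> ta K0; have u X := tu (T_uperp_trip ta) X.
pose c X := cont (a3 a X); have lc X : lam m.+2 (c X) by exact: cont_lam.
pose U x y := iprod y (c x) + iprod (J y) (c (J x)).
have Usym x y : U x y = U y x.
  have := iprod2_KK x y ta; have := iprod2_KK (J x) (J y) ta.
  rewrite K0 !ip0.
  have -> : \sum_i W m (e i) (iprod (J y) (iprod (J x) (cont (a3 a (e i))))) =
     - \sum_i W m (e i) (iprod y (iprod x (cont (a3 a (e i))))).
    by rewrite -sumrN; apply: eq_bigr => i _; rewrite (lam_JJ _ _ (cont_lam _)) WrN.
  move=> h1 h2; apply/funext => v; have := congr1 (@^~ v) h1; have := congr1 (@^~ v) h2.
  by rewrite /U /c !tensorE; lra.
have U0 x y : U x y = 0.
  apply: tensor_ext => z; rewrite ip0; apply/funext => v; rewrite tensor0.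
  apply: (sym12_skew23 (A := fun x y z => iprod z (U x y) v)) => {x y z} x y z.
    by rewrite Usym.
  rewrite /U !ipD !tensorE (skew_anti z y (lam_skew (lc x))) (skew_anti z (J y) (lam_skew (lc (J x)))).
  by rewrite -(lam_J HJ _ _ (lc (J x))) !tensorE; ring.
have E x : II (c (J x)) = c x.
  apply: tensor_ext => y; rewrite iprod_II; apply/esym/eqP.
  by rewrite -addr_eq0; apply/eqP; exact: U0.
move=> x y z; apply: (cont_inj (tu (T_uperp_trip (aJJ_uperp ta)) x) (u x)).
by have := E x; rewrite /c (II_cont (u (J x))).
Qed.

Lemma W3_E : W3_Xi F e = [set b | W_Xi n F b /\ alternation n b = (fun=> 0)].
Proof.
apply/seteqP; split=> [_ [a g3 <-]|b [wb hb]].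
  have ta := GH3_uperp g3; have /GH3E[_ ja t0] := g3; split.
    by rewrite W_Xi_E; exists a.
  rewrite alternation_Xip // KK_Janti //.
  have -> : \sum_i Tm (a3 a (e i)) (e i) = 0.
    under eq_bigr do rewrite Tm.unlock; rewrite exchange_big big1 // => j _.
    by rewrite /= -scaler_suml t0 scale0r.
  by rewrite lin00 // scaler0 Lo0 scaler0.
move: wb hb; rewrite W_Xi_E => -[a ta <-].
rewrite alternation_Xip // => h; have {h} : Lo m.+3 (KK a) = 0.
  apply/funext => v; have := congr1 (@^~ v) h; rewrite /= tensorZ tensor0 => q; lra.
move/(Lo_KK_eq0 ta) => K0; have ja := KK0_Janti ta K0; exists a => //.
apply/GH3E; split=> // z.
have := KK_Janti ta ja; rewrite K0; set t := \sum_i Tm _ _ => h.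
have i0 : iprod t psip = 0.
  by apply/funext => v; have := congr1 (@^~ v) h; rewrite !tensorE; lra.
(* Wedging the zero form obtained by contracting psi_+ with t, and evaluating on the frame, leaves
   <t, z> = 0. *)
have := Th_iprod z t; rewrite i0 Th0 => /(congr1 (@^~ (fseq f))).
rewrite !tensorE (psip_f Hf) (psim_f Hf) mulr1 mulr0 subr0 => gt0.
rewrite [RHS]gt0 gC // g_sumr //; apply: eq_bigr => i _.
by rewrite gT //; exact: (tu (T_uperp_trip ta)).
Qed.

(** * The alternation wedged with omega, and the description of W_2 *)

(** Contracting omega /\ psi_+ = 0 shows that omega wedged with the contraction of psi_+ by x is J x
    /\ psi_+; this turns omega /\ omega /\ c(al) into a multiple of al /\ psi_+. *)
Lemma Lo_Lo_cont al : uperp al -> Lo m.+4 (Lo m.+2 (cont al)) =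
  - 2 *: \sum_j \sum_k al (e j) (e k) *: W m.+4.+1 (e k) (W m.+4 (e j) psip).
Proof.
move=> ual; rewrite Lo_cont // LoZ Lo_sum scaleNr -scalerN; congr (_ *: _).
have E i : Lo m.+4 (W m.+3 (J (Tm al (e i))) (iprod (e i) psip)) =
    - W m.+4.+1 (Tm al (J (e i))) (W m.+4 (J (e i)) psip).
  by rewrite -W_Lo Lo_iprod TJ // WN // opprK.
under eq_bigr => i _ do rewrite E.
rewrite sumrN (sum_JJ HG HJ hspan (B := fun x y => W m.+4.+1 (Tm al x) (W m.+4 y psip))).
- congr (- _); apply: eq_bigr => j _; rewrite -(sum_Wg HG hspan).
  by apply: eq_bigr => k _; rewrite gC // gT.
- by move=> y k x z; rewrite T_lin // W_lc.
- by move=> x k y z; rewrite W_lc // WrD WrZ.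
Qed.

Lemma sum_cyc (U : nmodType) (h : 'I_n.*2 -> 'I_n.*2 -> 'I_n.*2 -> U) :
  \sum_i \sum_j \sum_k h i j k = \sum_i \sum_j \sum_k h j k i.
Proof.
rewrite [RHS]exchange_big /=; apply: eq_bigr => i _.
by rewrite exchange_big.
Qed.

(** The triple wedge is cyclically invariant, so only the cyclic sum of a is seen; this is why the
    condition for W_2 contains the extra factor omega. *)
Lemma Lo_Lo_KK a : T_uperp F a -> Lo m.+4.+1 (Lo m.+3 (KK a)) =
  - 2 *: \sum_i \sum_j \sum_k a3 a (e i) (e j) (e k) *:
    W m.+4.+2 (e i) (W m.+4.+1 (e k) (W m.+4 (e j) psip)).
Proof.
move=> ta; rewrite 2!Lo_sum scaler_sumr; apply: eq_bigr => i _.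
rewrite -!W_Lo Lo_Lo_cont; last exact: (tu (T_uperp_trip ta)).
rewrite WrZ Wr_sum; congr (_ *: _); apply: eq_bigr => j _.
by rewrite Wr_sum; apply: eq_bigr => k _; rewrite WrZ.
Qed.

Lemma GH2_Lo_Lo a : GH2 F a -> Lo m.+4.+1 (Lo m.+3 (KK a)) = 0.
Proof.
move=> /GH2E[ta h]; rewrite Lo_Lo_KK //.
pose w (i j k : 'I_n.*2) := W m.+4.+2 (e i) (W m.+4.+1 (e k) (W m.+4 (e j) psip)).
have wc (i j k : 'I_n.*2) : w j k i = w i j k.
  by rewrite /w (W_anti _ _ (e j) (e i)) (W_anti _ _ (e j) (e k)) WrN opprK.
pose S := \sum_i \sum_j \sum_k a3 a (e i) (e j) (e k) *: w i j k.
suff S0 : S = 0 by rewrite -/S S0 scaler0.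
have e1 : S = \sum_i \sum_j \sum_k a3 a (e j) (e k) (e i) *: w i j k.
  rewrite [LHS](sum_cyc (fun i j l : 'I_n.*2 => a3 a (e i) (e j) (e l) *: w i j l)).
  by do 3 (apply: eq_bigr => ? _); rewrite wc.
have e2 : S = \sum_i \sum_j \sum_k a3 a (e k) (e i) (e j) *: w i j k.
  rewrite e1 (sum_cyc (fun i j l : 'I_n.*2 => a3 a (e j) (e l) (e i) *: w i j l)).
  by do 3 (apply: eq_bigr => ? _); rewrite wc.
have e3 : S + S + S = 0.
  transitivity (S + \sum_i \sum_j \sum_k a3 a (e j) (e k) (e i) *: w i j k
      + \sum_i \sum_j \sum_k a3 a (e k) (e i) (e j) *: w i j k).
    by rewrite -e1 -e2.
  rewrite /S.
  rewrite -!big_split big1 //= => i _; rewrite -!big_split big1 //= => j _.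
  by rewrite -!big_split big1 //= => k _; rewrite -!scalerDl h scale0r.
by apply/funext => v; have := congr1 (@^~ v) e3; rewrite !tensorE; lra.
Qed.

Lemma KK_D a b : KK (a + b) = KK a + KK b.
Proof.
rewrite /KK -big_split; apply: eq_bigr => i _ /=; rewrite -WrD; congr (W _ _ _).
have := cont_lc 1 (a3 a (e i)) (a3 b (e i)); rewrite scale1r => <-; congr cont.
by apply/funext => y; apply/funext => z; rewrite mul1r.
Qed.

(** On W_1, K is 1/3 omega /\ I(cont3 a), so the hypothesis is a cube of omega wedged with a form of
    type (n-3,0); and [cont3 a] determines a by [Th_cont3]. *)
Lemma GH1_Lo_Lo a : GH1 F a -> Lo m.+4.+1 (Lo m.+3 (KK a)) = 0 -> a = 0.
Proof.
move=> g1; have ta := GH1_uperp g1; have l3 := cont3_lam ta; have l3' := lam_II HJ l3.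
have -> : KK a = 3^-1 *: Lo m.+1 (II (cont3 a)).
  have E i : W m.+2 (e i) (cont (a3 a (e i))) =
     - 6^-1 *: W m.+2 (e i) (W m.+1 (J (e i)) (II (cont3 a))).
    have -> : cont (a3 a (e i)) = 6^-1 *: Th m.+1 (e i) (cont3 a).
      by rewrite Th_cont3 // scalerA mulVf ?pnatr_eq0 // scale1r.
    by rewrite Th_def WrZ WrB W_sq sub0r scalerN scaleNr.
  rewrite /KK; under eq_bigr => i _ do rewrite E.
  rewrite -scaler_sumr Lo_def scalerA; congr (_ *: _); by field.
rewrite !LoZ => /(congr1 ( *:%R 3)); rewrite scaler0 scalerA mulfV ?pnatr_eq0 // scale1r.
move/(Lo_Lo_Lo_eq0 l3') => h; have c30 : cont3 a = 0.
  by rewrite -[LHS]opprK -(II_II HJ (lam_lin0 l3)) h II_0 oppr0.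
apply: a3_inj => //; first exact: T_uperp_0.
move=> x y z; rewrite a3_0.
have := Th_Th_cont (tu (T_uperp_trip ta) x) y z.
have -> : cont (a3 a x) = 6^-1 *: Th m.+1 x (cont3 a).
  by rewrite Th_cont3 // scalerA mulVf ?pnatr_eq0 // scale1r.
rewrite c30 Th0 scaler0 !Th0 tensor0; lra.
Qed.

Lemma W2_E : W2_Xi F e = [set b | [/\ W_Xi n F b,
   calL n F b = (fun v => (n - 2)%:R * b v) &
   wedge n.+1 2 (alternation n b) (kahler F) = (fun=> 0)]].
Proof.
apply/seteqP; split=> [_ [a g2 <-]|b [wb lb hb]].
  have ta := GH2_uperp g2; split.
  - by rewrite W_Xi_E; exists a.
  - exact/(calL_Jlin ta)/GH2_Jlin.
  - by rewrite wedge_alternation_Xip // GH2_Lo_Lo // scaler0.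
move: wb lb hb; rewrite W_Xi_E => -[a ta <-] /(calL_Jlin ta) ja.
rewrite wedge_alternation_Xip // => h.
have {}h : Lo m.+4.+1 (Lo m.+3 (KK a)) = 0.
  apply/funext => v; have := congr1 (@^~ v) h; rewrite /= tensorZ tensor0 => q; lra.
have [a1 [a2 [g1 g2 ea]]] := Jlin_split ta ja.
move: h; rewrite ea KK_D !LoD (GH2_Lo_Lo g2) addr0 => /(GH1_Lo_Lo g1) ->.
by exists a2 => //; rewrite add0r.
Qed.

(** * The covariant derivative of psi_+ and psi_- at one point *)

Lemma lam_first p D : skew_form p D ->
  (forall q x y, p = q.+2 -> iprod (J x) (iprod (J y) D) = - iprod x (iprod y D)) ->
  lam p D.
Proof.
elim: p D => [|p IH] D s h; first by apply/lamP; split=> // v i [].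
apply/lamS; split=> [//|x|p0 y z]; last by case: p p0 s h {IH} => // p _ s h; exact: (h p).
apply: IH; first exact: skew_iprod s.
move=> q y z pq; rewrite pq in s h.
rewrite (skew_anti (J z) x s) ipN (skew_anti (J y) x (skew_iprod _ s)) opprK (h q.+1) // ipN.
by rewrite (skew_anti z x s) ipN (skew_anti y x (skew_iprod _ s)) opprK.
Qed.

(** A frame vector f_j with j different from k is repeated, and J f_j reduces to that case, so only
    the components of y along f_k and J f_k count. Turns derivations evaluated on the frame into
    traces. *)
Lemma psi_vset_f k y : (k < n)%N ->
  psip (vset (fseq f) k y) = g y (fseq f k) /\ psim (vset (fseq f) k y) = g y (J (fseq f k)).
Proof.
move=> kn; have [[[_ ml] al] [[_ ml'] al']] := (lam_skew psip_lam, lam_skew psim_lam).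
have lin (D : tensor V) : skew_form n D -> vlin (U := R^o) (fun y => D (vset (fseq f) k y)).
  by move=> [[_ md] _] c x z; rewrite md.
have off (D : tensor V) j : skew_form n D -> j != Ordinal kn -> D (vset (fseq f) k (f j)) = 0.
  move=> [_ ad] jk; have e1 : vset (fseq f) k (f j) k = f j by rewrite /vset eqxx.
  have jk' : (j == k :> nat) = false by apply: negbTE; move: jk; rewrite -val_eqE.
  have e2 : vset (fseq f) k (f j) j = f j by rewrite vset_neq // fseqE.
  case: (ltnP j k) => h; first by apply: (ad _ j k) => //; rewrite e1 e2.
  apply: (ad _ k j) => //; last by rewrite e1 e2.
  by rewrite ltn_neqAle eq_sym jk' h.
have on (D : tensor V) : D (vset (fseq f) k (f (Ordinal kn))) = D (fseq f).
  by rewrite -(fseqE f (Ordinal kn)) vset_same.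
have onJ (D : tensor V) j : lam n D -> D (vset (fseq f) k (J (f j))) = - II D (vset (fseq f) k (f j)).
  move=> l; rewrite -(lam_slot HJ (vset (fseq f) k (f j)) l kn).
  congr (D _); apply/funext => i; rewrite /vset eqxx.
  by case: eqP.
have fk : fseq f k = f (Ordinal kn) by rewrite -fseqE.
have key (D : tensor V) : lam n D -> D (vset (fseq f) k y) =
    g y (fseq f k) * D (fseq f) - g y (J (fseq f k)) * II D (fseq f).
  move=> l; have ll := lam_II HJ l; rewrite [in LHS](fspan y).
  rewrite (vlin_sum _ _ _ (lin D (lam_skew l))) (bigD1 (Ordinal kn)) //= big1 ?addr0 => [|j jk].
    rewrite (lin _ (lam_skew l)) [X in _ + X](vlinZ _ _ (lin _ (lam_skew l))).
    by rewrite onJ // !on fk -scalerN.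
  rewrite (lin _ (lam_skew l)) [X in _ + X](vlinZ _ _ (lin _ (lam_skew l))).
  by rewrite onJ // !off ?oppr0 ?scaler0 ?addr0 //; [exact: lam_skew ll|exact: lam_skew l].
rewrite !key // II_p II_m !tensorE (psip_f Hf) (psim_f Hf); split; ring.
Qed.

(* Leibniz rules at one point: DP, DM, DJ and Dg stand for the directional     *)
(* derivatives of psi_+, psi_-, I and the metric, G for the Christoffel map.   *)
Section Nabla.
Variables (DP DM : V -> tensor V) (G DJ : V -> V -> V) (Dg : V -> V -> V -> R).
Hypothesis DPs : forall X, skew_form n (DP X).
Hypothesis DMs : forall X, skew_form n (DM X).
Hypothesis DPl : vlin DP.
Hypothesis DMl : vlin DM.
Hypothesis Gl1 : forall y, vlin (G^~ y).
Hypothesis Gl2 : forall X, vlin (G X).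
Hypothesis DJl1 : forall y, vlin (DJ^~ y).
Hypothesis DJl2 : forall X, vlin (DJ X).
Hypothesis DPJ : forall X y, iprod (J y) (DP X) + iprod (DJ X y) psip = - iprod y (DM X).
Hypothesis DMJ : forall X y, iprod (J y) (DM X) + iprod (DJ X y) psim = iprod y (DP X).
Hypothesis DJJ : forall X y, DJ X (J y) = - J (DJ X y).
Hypothesis Dgcompat : forall X y z, Dg X y z = g (G X y) z + g y (G X z).
Hypothesis DgJ : forall X y z, Dg X (J y) z + Dg X y (J z) + g (DJ X y) z + g y (DJ X z) = 0.
Hypothesis Dnorm : forall X, DP X (fseq f) = 2^-1 * \sum_(k < n) Dg X (f k) (f k).

Definition Np : tensor V := fun v => DP (v 0%N) (vshift 1 v) - der n (G (v 0%N)) psip (vshift 1 v).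
Definition Nm : tensor V := fun v => DM (v 0%N) (vshift 1 v) - der n (G (v 0%N)) psim (vshift 1 v).
(* nK X y = (nabla_X I) y.                                                     *)
Definition nK X y := DJ X y + G X (J y) - J (G X y).
Definition na : tensor V := tens (fun X y z => - g (nK X y) z).

Lemma skew_der p D (A : V -> V) : vlin A -> skew_form p D -> skew_form p (der p A D).
Proof.
move=> lA; elim: p D => [|p IH] D s; first by rewrite der0; exact: skew_0.
have l := skew_lin0 s; apply/skew_formS; split=> [c x y|x|p0 x].
- by rewrite !iprod_der lA !l derD derZ; tring.
- rewrite iprod_der; apply: skew_add; first exact: skew_iprod s.
  exact/IH/skew_iprod.
- case: p p0 IH s => // p _ IH s; rewrite iprod_der ipD iprod_der.
  rewrite (skew_anti x (A x) s) (skew_iprod2 x s) [der p A 0]linear0.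
  by tring.
Qed.

Lemma iprod_Np X : iprod X Np = DP X - der n (G X) psip. Proof. by []. Qed.
Lemma iprod_Nm X : iprod X Nm = DM X - der n (G X) psim. Proof. by []. Qed.

Lemma der_vlin p (D : tensor V) y (B : V -> V -> V) : multilinear p D ->
  (forall y, vlin (B^~ y)) -> forall (k : R) x z,
  der p (B (k *: x + z)) D = k *: der p (B x) D + der p (B z) D.
Proof.
move=> [_ md] lB k x z; apply/funext => v; rewrite tensorD tensorZ !der_def.
by rewrite mulr_sumr -big_split; apply: eq_bigr => i _; rewrite lB md.
Qed.

Lemma Np_multilinear : multilinear n.+1 Np.
Proof.
apply/multilinearS; split=> [k x y|x].
  rewrite !iprod_Np DPl (der_vlin 0 (lam_skew psip_lam).1 Gl1); tring.
rewrite iprod_Np; have := skew_sub (DPs x) (skew_der (Gl2 x) (lam_skew psip_lam)).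
by case.
Qed.
Lemma Nm_multilinear : multilinear n.+1 Nm.
Proof.
apply/multilinearS; split=> [k x y|x].
  rewrite !iprod_Nm DMl (der_vlin 0 (lam_skew psim_lam).1 Gl1); tring.
rewrite iprod_Nm; have := skew_sub (DMs x) (skew_der (Gl2 x) (lam_skew psim_lam)).
by case.
Qed.

Lemma nK_skew X y z : g (nK X y) z = - g y (nK X z).
Proof.
have := DgJ X y z; rewrite !Dgcompat /nK !(gDl, gDr, gNl, gNr, gJr HG HJ) //.
rewrite !(gJ HG HJ); lra.
Qed.

Lemma nK_J X y : nK X (J y) = - J (nK X y).
Proof.
rewrite /nK DJJ !JD // !JN // !JJ //.
have -> : G X (- y) = - G X y.
  by have := vlinZ (-1) y (Gl2 X); rewrite !scaleN1r.
by rewrite !opprD !opprK -addrA [- G X y - _]addrC addrA.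
Qed.

Lemma nK_lin2 X : vlin (nK X).
Proof.
move=> k x y; rewrite /nK DJl2 Jlc // !Gl2 Jlc //; apply: g_inj => z.
by rewrite !(gDr, gNr, gZr) //; ring.
Qed.

Lemma nK_lin1 y : vlin (nK^~ y).
Proof.
move=> k x z; rewrite /nK DJl1 !Gl1 Jlc //; apply: g_inj => t.
by rewrite !(gDr, gNr, gZr) //; ring.
Qed.

Lemma na_uperp : T_uperp F na.
Proof.
apply: T_uperp_tens; split=> [c x y z t|X].
  by rewrite nK_lin1 !(gDl, gZl) //; ring.
split=> [c y z t|y z|y z].
- by rewrite nK_lin2 !(gDl, gZl) //; ring.
- by rewrite nK_skew gC.
- by rewrite nK_J gNl // gJJ.
Qed.

Lemma na_adj X x y : g (Tm (a3 na X) x) y = g x (nK X y).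
Proof.
rewrite gC // gT; last exact: (tu (T_uperp_trip na_uperp)).
by rewrite [LHS](_ : _ = - g (nK X x) y) // nK_skew opprK.
Qed.

Lemma iprod_Xip_na X : iprod X (Xip na) = 2^-1 *: der n (nK X) psim.
Proof.
apply/funext => v.
have -> : iprod X (Xip na) v = 2^-1 * \sum_i wedge 1 (n - 1)
    (iprod (e i) (iprod X na)) (iprod (e i) psim) v by [].
under eq_bigr => i _ do rewrite (Xi_wedge _ _ na_uperp (lam_skew psim_lam)).
rewrite -(tensor_sum _ xpredT (fun i => W m.+3 (Tm (a3 na X) (e i)) (iprod (e i) psim))).
by rewrite (sum_W_der HG hspan (lam_skew psim_lam) (na_adj X)).
Qed.

Lemma iprod_Xim_na X : iprod X (Xim na) = - 2^-1 *: der n (nK X) psip.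
Proof.
apply/funext => v.
have -> : iprod X (Xim na) v = - 2^-1 * \sum_i wedge 1 (n - 1)
    (iprod (e i) (iprod X na)) (iprod (e i) psip) v by [].
under eq_bigr => i _ do rewrite (Xi_wedge _ _ na_uperp (lam_skew psip_lam)).
rewrite -(tensor_sum _ xpredT (fun i => W m.+3 (Tm (a3 na X) (e i)) (iprod (e i) psip))).
by rewrite (sum_W_der HG hspan (lam_skew psip_lam) (na_adj X)).
Qed.

(** The remainders of nabla_X psi_+ and nabla_X psi_- after subtracting Xi_+(na)_X and
    Xi_-(na)_X. *)
Let rp X := DP X - der n (G X) psip - 2^-1 *: der n (nK X) psim.
Let rm X := DM X - der n (G X) psim + 2^-1 *: der n (nK X) psip.

Let der_N p (A : V -> V) D : der p A (- D) = - der p A D.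
Proof. exact: linearN. Qed.

(** The Leibniz rule for psi_+(I y, ...) = -psi_-(y, ...). With [iprod_rm] it says that rp + i rm is
    complex linear in its first slot, which by skewness gives type (n,0). *)
Lemma iprod_rp X y : iprod (J y) (rp X) = - iprod y (rm X).
Proof.
have h1 : iprod (J y) psip = - iprod y psim by rewrite iprod_psim opprK.
have h2 : iprod (J y) (DP X) = - iprod y (DM X) - iprod (DJ X y) psip.
  by rewrite -DPJ addrK.
rewrite /rp /rm !(ipB, ipD, ipN, ipZ) h2 !iprod_der h1 iprodJ_psim !der_N.
have -> : nK X (J y) = - J (nK X y) by exact: nK_J.
have -> : G X (J y) = nK X y - DJ X y + J (G X y).
  by apply: g_inj => z; rewrite /nK !(gDr, gNr) //; ring.
move: (nK X y) => K.
rewrite !(lin0D _ _ lp, lin0N _ lp, lin0N _ lm) !iprodJ_psim.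
have -> : iprod (J (G X y)) psip = - iprod (G X y) psim by rewrite iprod_psim opprK.
by apply/funext => v; rewrite !tensorE; field.
Qed.

Lemma iprod_rm X y : iprod (J y) (rm X) = iprod y (rp X).
Proof.
have h1 x : iprod (J x) psip = - iprod x psim by rewrite iprod_psim opprK.
have h2 : iprod (J y) (DM X) = iprod y (DP X) - iprod (DJ X y) psim.
  by rewrite -DMJ addrK.
rewrite /rp /rm !(ipB, ipD, ipN, ipZ) h2 !iprod_der h1 iprodJ_psim !der_N.
have -> : nK X (J y) = - J (nK X y) by exact: nK_J.
have -> : G X (J y) = nK X y - DJ X y + J (G X y).
  by apply: g_inj => z; rewrite /nK !(gDr, gNr) //; ring.
move: (nK X y) => K.
rewrite !(lin0D _ _ lm, lin0N _ lp, lin0N _ lm) !h1 !iprodJ_psim.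
by apply/funext => v; rewrite !tensorE; field.
Qed.

Lemma rp_skew X : skew_form n (rp X).
Proof.
apply: skew_sub; last exact/skew_scale/(skew_der (nK_lin2 X))/lam_skew/psim_lam.
exact: skew_sub (DPs X) (skew_der (Gl2 X) (lam_skew psip_lam)).
Qed.
Lemma rm_skew X : skew_form n (rm X).
Proof.
apply: skew_add; last exact/skew_scale/(skew_der (nK_lin2 X))/lam_skew/psip_lam.
exact: skew_sub (DMs X) (skew_der (Gl2 X) (lam_skew psim_lam)).
Qed.

Lemma rp_lam X : lam n (rp X).
Proof.
apply: lam_first; first exact: rp_skew.
move=> q x y _; rewrite iprod_rp ipN (skew_anti (J x) y (rm_skew X)) opprK.
by rewrite iprod_rm (skew_anti y x (rp_skew X)).
Qed.
Lemma rm_lam X : lam n (rm X).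
Proof.
apply: lam_first; first exact: rm_skew.
move=> q x y _; rewrite iprod_rm (skew_anti (J x) y (rp_skew X)) iprod_rp.
by rewrite ipN opprK (skew_anti y x (rm_skew X)).
Qed.

Lemma II_rp X : II (rp X) = rm X.
Proof. by apply: tensor_ext => y; rewrite iprod_II iprod_rp opprK. Qed.
Lemma II_rm X : II (rm X) = - rp X.
Proof. by apply: tensor_ext => y; rewrite iprod_II iprod_rm ipN. Qed.

Lemma der_fseq (A : V -> V) (D : tensor V) (h : V -> V -> R) :
  (forall k y, (k < n)%N -> D (vset (fseq f) k y) = h y (fseq f k)) ->
  der n A D (fseq f) = \sum_(k < n) h (A (f k)) (f k).
Proof.
by move=> hD; rewrite der_def; apply: eq_bigr => k _; rewrite hD ?ltn_ord // fseqE.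
Qed.

(** The trace of the derivative of the metric cancels that of the Christoffel map by compatibility,
    and the correction is a sum of <(nabla_X I) f_k, I f_k> = 0. *)
Lemma rp_fseq X : rp X (fseq f) = 0.
Proof.
rewrite /rp !tensorE Dnorm.
rewrite (der_fseq _ (h := g)); last by move=> k y kn; have [] := psi_vset_f y kn.
rewrite (der_fseq _ (h := fun y z => g y (J z))); last by move=> k y kn; have [] := psi_vset_f y kn.
have -> : \sum_(k < n) g (nK X (f k)) (J (f k)) = 0.
  rewrite big1 // => k _; have := u_JJ0 (tu (T_uperp_trip na_uperp) X) (f k).
  rewrite [LHS in LHS = _ -> _](_ : _ = - g (nK X (f k)) (J (f k))) //.
  by move/eqP; rewrite oppr_eq0 => /eqP.
under eq_bigr => k _ do rewrite Dgcompat [X in _ + X]gC //.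
by rewrite big_split /=; field.
Qed.

Lemma rpE X : rp X = - rm X (fseq f) *: psim.
Proof.
have := lam_top HG HJ Hf fspan (rp_lam X).
by rewrite rp_fseq II_rp scale0r sub0r -scaleNr.
Qed.
Lemma rmE X : rm X = rm X (fseq f) *: psip.
Proof.
have := lam_top HG HJ Hf fspan (rm_lam X).
by rewrite II_rm tensorN rp_fseq oppr0 scale0r subr0.
Qed.

Lemma GH_split a : T_uperp F a -> exists a1 a2 a3' a4,
  [/\ GH1 F a1, GH2 F a2, GH3 F e a3', GH4 F e a4 & a = a1 + a2 + (a3' + a4)].
Proof.
move=> ta; have [b [c [tb tc jb jc ->]]] := type_split ta.
have [a1 [a2 [g1 g2 ->]]] := Jlin_split tb jb.
have [a3' [a4 [g3 g4 ->]]] := Janti_split tc jc.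
by exists a1, a2, a3', a4.
Qed.

Lemma sum_modules_Xip a D psi : T_uperp F a -> W5 n psi (D - Xip a) ->
  sum_modules [:: W1_Xi F e; W2_Xi F e; W3_Xi F e; W4_Xi F e; W5 n psi] D.
Proof.
move=> ta h; have [a1 [a2 [a3' [a4 [g1 g2 g3 g4 ea]]]]] := GH_split ta.
exists (nth 0 [:: Xip a1; Xip a2; Xip a3'; Xip a4; D - Xip a]).
  by case=> [|[|[|[|[|//]]]]] _ //=; [exists a1|exists a2|exists a3'|exists a4].
have t1 := GH1_uperp g1; have t2 := GH2_uperp g2.
have t3 := GH3_uperp g3; have t4 := GH4_uperp g4.
have e1 : Xip a = Xip a1 + Xip a2 + (Xip a3' + Xip a4).
  by rewrite ea !Xip_D //; exact: T_uperp_D.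
apply/funext => v; rewrite !big_ord_recl big_ord0 /= /bump /= tensorD tensorN e1.
by rewrite !tensorD; ring.
Qed.

Lemma sum_modules_Np :
  sum_modules [:: W1_Xi F e; W2_Xi F e; W3_Xi F e; W4_Xi F e; W5 n psim] Np.
Proof.
apply: (sum_modules_Xip na_uperp); split=> [|X].
  rewrite -scaleN1r addrC; apply: multilinear_lc; last exact: Np_multilinear.
  exact: Xip_multilinear na_uperp.
exists (- rm X (fseq f)); rewrite ipB iprod_Xip_na iprod_Np; exact: (rpE X).
Qed.

Lemma sum_modules_Nm :
  sum_modules [:: W1_Xi F e; W2_Xi F e; W3_Xi F e; W4_Xi F e; W5 n psip] Nm.
Proof.
apply: (sum_modules_Xip (aJ_uperp na_uperp)); split=> [|X].
  rewrite -scaleN1r addrC; apply: multilinear_lc; last exact: Nm_multilinear.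
  exact: Xip_multilinear (aJ_uperp na_uperp).
exists (rm X (fseq f)); rewrite -(Xim_Xip na_uperp) ipB iprod_Xim_na iprod_Nm.
by rewrite scaleNr opprK; exact: (rmE X).
Qed.

End Nabla.

End Contraction.

(** * Directional derivatives of functions with continuous partial derivatives *)

Section DirectionalDerivative.
Context {R : realType} {m : nat}.
Local Notation E := 'rV[R]_m.
Implicit Types (f : E -> R) (x y v w : E).

Lemma line_quotient f y v t :
  (fun h : R => h^-1 *: (((fun s => f (s *: v + y)) \o shift t) (h *: 1) - f (t *: v + y))) =
  (fun h : R => h^-1 *: ((f \o shift (t *: v + y)) (h *: v) - f (t *: v + y))).
Proof.
by apply/funext => h /=; rewrite [h *: 1]mulr1 scalerDl addrA.
Qed.

Lemma is_derive_line f y v t : derivable f (t *: v + y) v ->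
  is_derive t 1 (fun s : R => f (s *: v + y)) ('D_v f (t *: v + y)).
Proof.
move=> d; split; first by rewrite /derivable line_quotient.
by rewrite /derive line_quotient.
Qed.

Lemma partial_mvt f y v b : (forall t, `|t| <= `|b| -> derivable f (t *: v + y) v) ->
  exists2 t, `|t| <= `|b| & f (b *: v + y) - f y = b * 'D_v f (t *: v + y).
Proof.
move=> d; pose phi (s : R) := f (s *: v + y); pose dphi (s : R) := 'D_v f (s *: v + y).
have mvt a c : a <= c -> (forall t, a <= t <= c -> `|t| <= `|b|) ->
    exists2 t, `|t| <= `|b| & phi c - phi a = dphi t * (c - a).
  move=> ac hb; have der t : a <= t <= c -> is_derive t (1 : R) phi (dphi t).
    by move=> /hb/d; exact: is_derive_line.
  have [||t] := @MVT_segment R phi dphi a c ac.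
  - move=> t; rewrite in_itv /= => /andP[at_ tc]; apply: der.
    by rewrite !ltW.
  - apply: derivable_within_continuous => t; rewrite in_itv /= => h.
    by have [] := der t h.
  - by rewrite in_itv /= => h e; exists t => //; exact: hb.
have phi0 : phi 0 = f y by rewrite /phi scale0r add0r.
case: (lerP 0 b) => b0.
  have [t|t ht e] := mvt 0 b b0.
    by case/andP=> t0 tb; rewrite !ger0_norm.
  by exists t => //; rewrite -phi0 -/(phi b) e subr0 mulrC.
have [t|t ht e] := mvt b 0 (ltW b0).
  by case/andP=> bt t0; rewrite !ler0_norm ?lerN2 // ltW.
exists t => //; rewrite -phi0 -/(phi b) -opprB e sub0r mulrN opprK.
by rewrite mulrC.
Qed.

(** The increment along c v starts from a point moving with h; the mean value theorem and continuity
    of the partial derivative at x absorb this. *)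
Lemma partial_quotient f x v w c : (\forall y \near x, derivable f y v) ->
  {for x, continuous ('D_v f)} ->
  (fun h : R => h^-1 * (f (h *: (w + c *: v) + x) - f (h *: w + x))) @ 0^' -->
  c * 'D_v f x.
Proof.
move=> df cf; apply/cvgrPdist_lt => eps e0.
pose C := `|c| + 1; have C0 : 0 < C by rewrite ltr_wpDl.
have near_x : \forall y \near x, derivable f y v /\ `|'D_v f x - 'D_v f y| < eps / C.
  near=> y; split; first by near: y.
  near: y; move/cvgrPdist_lt : cf; apply; exact: divr_gt0.
have [r /= r0 hr] := (nbhs_normP _ _).1 near_x.
pose K := `|w| + `|c| * `|v| + 1.
have K0 : 0 < K by rewrite ltr_wpDl // addr_ge0 // mulr_ge0.
near=> h.
have hn0 : h != 0 by near: h; exact: nbhs_dnbhs_neq.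
have hr' : `|h| < r / K by near: h; apply: dnbhs0_lt; exact: divr_gt0.
have inball t : `|t| <= `|h * c| -> `|x - (t *: v + (h *: w + x))| < r.
  move=> ht; rewrite addrA opprD addrCA subrr addr0 normrN.
  apply: (le_lt_trans (ler_normD _ _)); rewrite !normrZ.
  apply: (@le_lt_trans _ _ (`|h| * (`|w| + `|c| * `|v|))).
    rewrite mulrDr addrC lerD2l mulrA -normrM ler_wpM2r //.
  apply: (@le_lt_trans _ _ (`|h| * K)).
    by rewrite ler_wpM2l // /K lerDl.
  by rewrite -ltr_pdivlMr.
have [t ht] := @partial_mvt f (h *: w + x) v (h * c) (fun t ht => (hr _ (inball t ht)).1).
have -> : (h * c) *: v + (h *: w + x) = h *: (w + c *: v) + x.
  by rewrite scalerDr scalerA addrA [X in X + x]addrC.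
move=> ->; rewrite mulrA mulrA mulVf // mul1r -mulrBr normrM.
have [_ hd] := hr _ (inball t ht).
apply: (@le_lt_trans _ _ (C * `|'D_v f x - 'D_v f (t *: v + (h *: w + x))|)).
  by rewrite ler_wpM2r // /C lerDl.
by rewrite mulrC -ltr_pdivlMr.
Unshelve. all: by end_near.
Qed.

(** Telescoping: coordinate directions are added one at a time. *)
Lemma C1_quotient f x (s : seq 'I_m) (u : E) :
  (forall i, \forall y \near x, derivable f y (coord_vec i)) ->
  (forall i, {for x, continuous ('D_(coord_vec i) f)}) ->
  (fun h : R => h^-1 * (f (h *: (\sum_(i <- s) u 0 i *: coord_vec i) + x) - f x)) @ 0^' -->
  \sum_(i <- s) u 0 i * 'D_(coord_vec i) f x.
Proof.
move=> df cf; elim: s => [|i s IH].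
  rewrite !big_nil; under eq_fun do rewrite scaler0 add0r subrr mulr0.
  exact: cvg_cst.
have q := @partial_quotient f x (coord_vec i) (\sum_(i <- s) u 0 i *: coord_vec i) (u 0 i) (df i) (cf i).
rewrite !big_cons; apply: cvg_trans (cvgD q IH); apply: near_eq_cvg; near=> h.
by rewrite /= -mulrDr subrKA [u 0 i *: _ + _]addrC.
Unshelve. all: by end_near.
Qed.

Lemma C1_is_derive f x (u : E) :
  (forall i, \forall y \near x, derivable f y (coord_vec i)) ->
  (forall i, {for x, continuous ('D_(coord_vec i) f)}) ->
  is_derive x u f (\sum_i u 0 i * 'D_(coord_vec i) f x).
Proof.
move=> df cf; have q := @C1_quotient f x (index_enum 'I_m) u df cf.
have eu : \sum_i u 0 i *: coord_vec i = u by rewrite -row_sum_delta.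
rewrite eu in q.
have {}q : (fun h : R => h^-1 *: ((f \o shift x) (h *: u) - f x)) @ 0^' -->
  \sum_i u 0 i * 'D_(coord_vec i) f x by [].
split; first by apply/cvg_ex; exists (\sum_i u 0 i * 'D_(coord_vec i) f x).
exact: cvg_lim q.
Qed.

(** [smooth_on] speaks only of derivatives along coordinate vectors, while [nabla] differentiates
    along arbitrary ones. *)
Lemma smooth_is_derive (A : set E) f x (u : E) : open A -> A x -> smooth_on A f ->
  is_derive x u f (\sum_i u 0 i * 'D_(coord_vec i) f x).
Proof.
move=> oA Ax sf; have [_ h] := sf 1%N; apply: C1_is_derive => i.
  near=> y; apply: (h i).1; near: y; exact: open_nbhs_nbhs.
exact: (h i).2.1 x Ax.
Unshelve. all: by end_near.
Qed.

Lemma smooth_derive_lin (A : set E) f x (a : R) (u v : E) :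
  open A -> A x -> smooth_on A f -> 'D_(a *: u + v) f x = a * 'D_u f x + 'D_v f x.
Proof.
move=> oA Ax sf; rewrite !(derive_val (is_derive := smooth_is_derive _ oA Ax sf)).
rewrite mulr_sumr -big_split; apply: eq_bigr => i _.
by rewrite !mxE /=; ring.
Qed.

Lemma smooth_derivable (A : set E) f x (u : E) :
  open A -> A x -> smooth_on A f -> derivable f x u.
Proof. by move=> oA Ax sf; case: (smooth_is_derive u oA Ax sf). Qed.

End DirectionalDerivative.

(** * Orthonormal families of full size span *)

Section Span.
Context {R : realType} {N : nat} (F : su_data 'rV[R]_N).
Local Notation g := (ip F).
Hypothesis HG : inner_product F.

Lemma orthonormal_span (I : finType) (u : I -> 'rV[R]_N) : #|I| = N ->
  (forall i j, g (u i) (u j) = (i == j)%:R) ->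
  forall x, x = \sum_i g x (u i) *: u i.
Proof.
move=> cI ou x; pose h (k : 'I_N) : I := enum_val (cast_ord (esym cI) k).
have hb : bijective h.
  apply: (inj_card_bij (f := h)); last by rewrite cI card_ord.
  by move=> a b /enum_val_inj/cast_ord_inj.
have hi := bij_inj hb; pose M := \matrix_(k < N) u (h k).
have gM (a : 'rV[R]_N) k : g (a *m M) (u (h k)) = a 0 k.
  rewrite mulmx_sum_row g_suml // (bigD1 k) //= big1 => [|l lk].
    by rewrite rowK gZl // ou eqxx mulr1 addr0.
  by rewrite rowK gZl // ou (inj_eq hi) (negbTE lk) mulr0.
have fM : row_free M.
  apply: inj_row_free => a a0; apply/rowP => k; rewrite mxE -gM a0 g0l //.
have [a ->] : exists a, x = a *m M.
  by exists (x *m invmx M); rewrite mulmxKV // -row_free_unit.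
rewrite [in LHS]mulmx_sum_row (reindex h) /=; last exact: onW_bij.
by apply: eq_bigr => k _; rewrite gM rowK.
Qed.

End Span.

Section FrameSpan.
Context {R : realType} {n : nat} (F : su_data 'rV[R]_(n.*2)).
Local Notation g := (ip F).
Local Notation J := (Jc F).
Hypothesis HG : inner_product F.
Hypothesis HJ : orthogonal_complex_structure F.

Lemma adapted_frame_span (f : 'I_n -> 'rV[R]_(n.*2)) : adapted_frame F f ->
  forall x, x = \sum_j (g x (f j) *: f j + g x (J (f j)) *: J (f j)).
Proof.
move=> [q1 q2 _] x; rewrite [LHS](orthonormal_span HG
  (u := fun s : 'I_n + 'I_n => match s with inl j => f j | inr j => J (f j) end)).
- by rewrite big_sumType /= big_split.
- by rewrite card_sum card_ord addnn.
- by move=> [i|i] [j|j] /=; rewrite ?gJJ ?q1 ?q2 // gC ?q2.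
Qed.

End FrameSpan.

(** * The Levi-Civita connection in a chart *)

Section Christoffel.
Context {R : realType} {N : nat}.
Local Notation E := 'rV[R]_N.
Variables (A : set E) (x : E) (S : E -> su_data E).
Hypothesis oA : open A.
Hypothesis Ax : A x.
Hypothesis HG : forall y, A y -> inner_product (S y).
Hypothesis sg : forall u v, smooth_on A (fun y => ip (S y) u v).
Local Notation g := (ip (S x)).
Local Notation gf := (fun y => ip (S y)).
Implicit Types (u v w : E) (c : R).

Definition Dg u v w : R := 'D_u (fun y => ip (S y) v w) x.
Local Notation G := (christoffel gf x).

Lemma nearA : \forall y \near x, A y.
Proof. exact: open_nbhs_nbhs. Qed.

Lemma Dg_l1 c u u' v w : Dg (c *: u + u') v w = c * Dg u v w + Dg u' v w.
Proof. exact: (smooth_derive_lin _ _ _ oA Ax (sg v w)). Qed.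

Lemma Dg_C u v w : Dg u v w = Dg u w v.
Proof.
by apply: near_eq_derive; near=> y; apply: gC; apply: HG; near: y; exact: nearA.
Unshelve. all: by end_near. Qed.

Lemma derive_lc (f h : E -> R) c u : derivable f x u -> derivable h x u ->
  'D_u (fun y => c * f y + h y) x = c * 'D_u f x + 'D_u h x.
Proof.
move=> df dh; rewrite [LHS](_ : _ = 'D_u (c *: f + h) x) //.
rewrite deriveD // ?deriveZ //; exact: derivableZ.
Qed.

Lemma Dg_l2 c u v v' w : Dg u (c *: v + v') w = c * Dg u v w + Dg u v' w.
Proof.
rewrite /Dg -derive_lc; try exact: smooth_derivable oA Ax (sg _ _).
apply: near_eq_derive; near=> y; apply: glcl; apply: HG; near: y; exact: nearA.
Unshelve. all: by end_near. Qed.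

Lemma Dg_l3 c u v w w' : Dg u v (c *: w + w') = c * Dg u v w + Dg u v w'.
Proof. by rewrite Dg_C Dg_l2 !(Dg_C u v). Qed.

Let gram := \matrix_(k, l) g (coord_vec k) (coord_vec l).
Let hx := HG Ax.

Lemma coord_sum (u : E) : u = \sum_i u 0 i *: coord_vec i.
Proof. by rewrite {1}[u]row_sum_delta. Qed.

Lemma g_gram (a w : E) : g a w = \sum_l (a *m gram) 0 l * w 0 l.
Proof.
rewrite [in LHS](coord_sum w) g_sumr //; apply: eq_bigr => l _.
rewrite gZr // mulrC; congr (_ * _); rewrite [in LHS](coord_sum a) g_suml // mxE.
by apply: eq_bigr => k _; rewrite gZl // !mxE.
Qed.

Lemma gram_unit : gram \in unitmx.
Proof.
rewrite -row_free_unit; apply: inj_row_free => a a0.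
apply/eqP; apply: contraT => an0; have [_ _ /(_ a an0)] := hx.
rewrite g_gram a0 big1 ?ltxx // => l _; by rewrite mxE mul0r.
Qed.

(** The Koszul formula for constant vector fields, whose brackets vanish; both sides are linear in
    w, and on coordinate vectors it is the definition. *)
Lemma koszul u v w : g (G u v) w = 2^-1 * (Dg u v w + Dg v u w - Dg w u v).
Proof.
rewrite g_gram /christoffel -mulmxA mulVmx ?gram_unit // mulmx1.
pose L w := 2^-1 * (Dg u v w + Dg v u w - Dg w u v).
have lL : vlin (U := R^o) L.
  move=> c a b; transitivity (c * L a + L b); last by [].
  by rewrite /L Dg_l1 !Dg_l3; ring.
rewrite -[RHS]/(L w) [in RHS](coord_sum w) (vlin_sum _ _ _ lL); apply: eq_bigr => l _.
by rewrite (vlinZ _ _ lL) mxE mulrC.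
Qed.

Lemma christoffel_compat u v w : Dg u v w = g (G u v) w + g v (G u w).
Proof.
rewrite (gC hx v) !koszul (Dg_C u w v) (Dg_C v u w) (Dg_C w u v); by field.
Qed.

Lemma christoffel_l1 v : vlin (G^~ v).
Proof.
move=> c u u'; rewrite /christoffel scalemxAl -mulmxDl; congr (_ *m _).
apply/rowP => l; rewrite !mxE -!/(Dg _ _ _) Dg_l1 !Dg_l2; ring.
Qed.

Lemma christoffel_l2 u : vlin (G u).
Proof.
move=> c v v'; rewrite /christoffel scalemxAl -mulmxDl; congr (_ *m _).
apply/rowP => l; rewrite !mxE -!/(Dg _ _ _) Dg_l1 Dg_l2 Dg_l3; ring.
Qed.

End Christoffel.

(** * Derivatives of complex functions and of determinants *)

Section ComplexDerivative.
Context {R : realType} {V : normedModType R}.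
Variables (x u : V).
Implicit Types (h : V -> R[i]) (d : R[i]).

Definition cder h d :=
  is_derive x u (fun y => complex.Re (h y)) (complex.Re d) /\
  is_derive x u (fun y => complex.Im (h y)) (complex.Im d).

Lemma cder_cst d : cder (fun=> d) 0.
Proof. by split; exact: is_derive_cst. Qed.

Lemma cder_add h k d d' : cder h d -> cder k d' -> cder (fun y => h y + k y) (d + d').
Proof.
move=> [h1 h2] [k1 k2]; split.
  by under eq_fun do rewrite cReD; rewrite cReD; exact: is_deriveD.
by under eq_fun do rewrite cImD; rewrite cImD; exact: is_deriveD.
Qed.

Lemma cder_mul h k d d' : cder h d -> cder k d' ->
  cder (fun y => h y * k y) (h x * d' + d * k x).
Proof.
move=> [h1 h2] [k1 k2]; split.
  under eq_fun do rewrite cReM; rewrite !(cReD, cReM).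
  by apply: is_derive_eq; rewrite /GRing.scale /=; ring.
under eq_fun do rewrite cImM; rewrite !(cImD, cImM).
by apply: is_derive_eq; rewrite /GRing.scale /=; ring.
Qed.

Lemma cder_sum (I : Type) (r : seq I) (P : pred I) (h : I -> V -> R[i]) (d : I -> R[i]) :
  (forall i, P i -> cder (h i) (d i)) ->
  cder (fun y => \sum_(i <- r | P i) h i y) (\sum_(i <- r | P i) d i).
Proof.
move=> H; elim: r => [|i r IH].
  by rewrite big_nil; under eq_fun do rewrite big_nil; exact: cder_cst.
rewrite big_cons; under eq_fun do rewrite big_cons.
by case: ifP => // Pi; apply: cder_add => //; exact: H.
Qed.

Section Prod.
Variables (I : Type) (h : I -> V -> R[i]) (d : I -> R[i]).
Hypothesis hd : forall i, cder (h i) (d i).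

Fixpoint dprod (r : seq I) : R[i] :=
  if r is i :: r' then h i x * dprod r' + d i * \prod_(j <- r') h j x else 0.

Lemma cder_prod r : cder (fun y => \prod_(i <- r) h i y) (dprod r).
Proof.
elim: r => [|i r IH] /=.
  by under eq_fun do rewrite big_nil; exact: cder_cst.
by under eq_fun do rewrite big_cons; apply: cder_mul.
Qed.

Lemma prod_eq0 r : (0 < count (fun i => h i x == 0%R) r)%N -> \prod_(i <- r) h i x = 0.
Proof.
elim: r => //= i r IH; rewrite big_cons; case: eqP => [->|_]; first by rewrite mul0r.
by rewrite add0n => /IH ->; rewrite mulr0.
Qed.

Lemma dprod_eq0 r : (1 < count (fun i => h i x == 0%R) r)%N -> dprod r = 0.
Proof.
elim: r => //= i r IH; case: eqP => [->|_] /=.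
  by rewrite add1n ltnS => /prod_eq0 ->; rewrite mul0r mulr0 addr0.
rewrite add0n => c1; rewrite IH // prod_eq0 ?mulr0 ?addr0 //.
exact: ltn_trans c1.
Qed.

Lemma dprod_eq1 r : (forall i, h i x = 1) -> dprod r = \sum_(i <- r) d i.
Proof.
move=> h1; elim: r => [|i r IH] /=; first by rewrite big_nil.
have -> : \prod_(j <- r) h j x = 1 by rewrite big1.
by rewrite big_cons h1 mul1r mulr1 IH addrC.
Qed.

End Prod.

(** A permutation other than 1 moves at least two indices, so its product has two vanishing factors
    at x and no derivative there; the identity contributes the trace. *)
Lemma cder_det n (H : V -> 'M[R[i]]_n) (D : 'M[R[i]]_n) : H x = 1%:M ->
  (forall i j, cder (fun y => H y i j) (D i j)) -> cder (fun y => \det (H y)) (\tr D).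
Proof.
move=> H1 hd.
have key (s : 'S_n) : (-1) ^+ s * dprod (fun i y => H y i (s i)) (fun i => D i (s i)) (index_enum 'I_n)
    = if s == 1%g then \tr D else 0.
  case: eqP => [->|/eqP s1].
    rewrite odd_perm1 expr0 mul1r dprod_eq1 => [|i]; last by rewrite H1 perm1 mxE eqxx.
    by apply: eq_bigr => i _; rewrite perm1.
  rewrite dprod_eq0 ?mulr0 //.
  have [i si] : exists i, s i != i.
    apply/existsP; apply: contraNT s1 => /existsPn h; apply/eqP/permP => i.
    by rewrite perm1; apply/eqP; have := h i; rewrite negbK.
  have e : [set i; s i]%SET \subset [pred k | H x k (s k) == 0].
    apply/fintype.subsetP => k; rewrite !inE => /orP[]/eqP ->; rewrite H1 mxE.
      by rewrite [i == _]eq_sym (negbTE si).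
    by rewrite (inj_eq perm_inj) [i == _]eq_sym (negbTE si).
  have -> : count (fun k => H x k (s k) == 0) (index_enum 'I_n) = #|[pred k | H x k (s k) == 0]|.
    by rewrite -sum1_count -sum1_card.
  by apply: leq_trans (subset_leq_card e); rewrite cards2 eq_sym si.
have -> : \tr D = \sum_(s : 'S_n) (-1) ^+ s * dprod (fun i y => H y i (s i)) (fun i => D i (s i)) (index_enum 'I_n).
  by under eq_bigr do rewrite key; rewrite -big_mkcond big_pred1_eq.
rewrite /determinant; apply: cder_sum => s _.
have := cder_mul (cder_cst ((-1) ^+ s)) (cder_prod (fun i => hd i (s i)) (index_enum 'I_n)).
by rewrite mul0r addr0.
Qed.

End ComplexDerivative.

(** * Differentiating the pointwise identities of the structure *)

Section FieldDerivatives.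
Context {R : realType} {m : nat}.
Local Notation n := m.+4.
Local Notation E := 'rV[R]_(n.*2).
Variables (A : set E) (x : E) (S : E -> su_data E).
Hypothesis oA : open A.
Hypothesis Ax : A x.
Hypothesis hS : forall y, A y -> su_structure n (S y).
Hypothesis sg : forall u v, smooth_on A (fun y => ip (S y) u v).
Hypothesis sJ : forall u j, smooth_on A (fun y => Jc (S y) u 0 j).
Hypothesis sp : forall v, smooth_on A (fun y => psip (S y) v).
Hypothesis sm : forall v, smooth_on A (fun y => psim (S y) v).
Implicit Types (X u : E) (c : R) (w : nat -> E).
Local Notation g := (ip (S x)).
Local Notation J := (Jc (S x)).

Let HG y : A y -> inner_product (S y). Proof. by case/hS. Qed.
Let HJ y : A y -> orthogonal_complex_structure (S y). Proof. by case/hS. Qed.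
Let Hf y : A y -> exists f : 'I_n -> E, adapted_frame (S y) f. Proof. by case/hS. Qed.

Lemma skew_derive p (b : E -> tensor E) X : (forall y, A y -> skew_form p (b y)) ->
  (forall v, derivable (fun y => b y v) x X) ->
  skew_form p (fun v => 'D_X (fun y => b y v) x).
Proof.
move=> sb db; split; first split=> [v w h|i v c u z ip].
- apply: near_eq_derive; near=> y.
  have /sb[[dep _] _] : A y by near: y; exact: nearA.
  exact: dep.
- rewrite -derive_lc //; apply: near_eq_derive; near=> y.
  have /sb[[_ l] _] : A y by near: y; exact: nearA.
  exact: l.
- move=> v i j ij jp e; rewrite -[RHS](derive_cst (0 : R) x X).
  apply: near_eq_derive; near=> y.
  have /sb[_ a] : A y by near: y; exact: nearA.
  exact: (a v i j).
Unshelve. all: by end_near. Qed.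

(** Leibniz rule for a field of linear forms applied to a vector field, obtained by expanding the
    vector in coordinates. *)
Lemma derive_eval (phi : E -> E -> R) (a : E -> E) X :
  (forall y, A y -> linform (phi y)) ->
  (forall v, derivable (phi^~ v) x X) -> (forall j, derivable (fun y => a y 0 j) x X) ->
  is_derive x X (fun y => phi y (a y))
    (phi x (\row_j 'D_X (fun y => a y 0 j) x) + 'D_X (phi^~ (a x)) x).
Proof.
move=> lphi dphi da.
have lsum y v : A y -> phi y v = \sum_i v 0 i * phi y (coord_vec i).
  move=> /lphi l; rewrite [in LHS](coord_sum v).
  have l' : vlin (U := R^o) (phi y) by exact: l.
  by rewrite (vlin_sum _ _ _ l'); apply: eq_bigr => i _; rewrite (vlinZ _ _ l').
have e1 : 'D_X (phi^~ (a x)) x = \sum_i a x 0 i * 'D_X (phi^~ (coord_vec i)) x.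
  rewrite (near_eq_derive (g := \sum_i (a x 0 i *: phi^~ (coord_vec i)))).
    rewrite derive_sum => [|i]; last exact: derivableZ.
    by apply: eq_bigr => i _; rewrite deriveZ.
  near=> y; rewrite fct_sumE lsum //; near: y; exact: nearA.
apply: (near_eq_is_derive (f := \sum_i ((fun y => a y 0 i) * phi^~ (coord_vec i)))).
  by near=> y; rewrite fct_sumE [RHS]lsum //; near: y; exact: nearA.
have di i : is_derive x X ((fun y => a y 0 i) * phi^~ (coord_vec i))
   (a x 0 i * 'D_X (phi^~ (coord_vec i)) x + phi x (coord_vec i) * 'D_X (fun y => a y 0 i) x).
  by apply: is_derive_eq; [apply: is_deriveM; exact: derivableP | by []].
apply: is_derive_eq.
rewrite big_split /= -e1 addrC; congr (_ + _).
by rewrite lsum //; apply: eq_bigr => i _; rewrite mxE mulrC.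
Unshelve. all: by end_near. Qed.

Definition DP X : tensor E := fun v => 'D_X (fun y => psip (S y) v) x.
Definition DM X : tensor E := fun v => 'D_X (fun y => psim (S y) v) x.
Definition DJ X u : E := \row_j 'D_X (fun y => Jc (S y) u 0 j) x.

Let dp v X : derivable (fun y => psip (S y) v) x X.
Proof. exact: smooth_derivable oA Ax (sp v). Qed.
Let dm v X : derivable (fun y => psim (S y) v) x X.
Proof. exact: smooth_derivable oA Ax (sm v). Qed.
Let dJ u j X : derivable (fun y => Jc (S y) u 0 j) x X.
Proof. exact: smooth_derivable oA Ax (sJ u j). Qed.
Let dg u v X : derivable (fun y => ip (S y) u v) x X.
Proof. exact: smooth_derivable oA Ax (sg u v). Qed.

Let sk_p y : A y -> skew_form n (psip (S y)).
Proof. by move=> Ay; have [f hf] := Hf Ay; exact: psip_skew (HG Ay) hf. Qed.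
Let sk_m y : A y -> skew_form n (psim (S y)).
Proof. by move=> Ay; have [f hf] := Hf Ay; exact: psim_skew (HG Ay) hf. Qed.

Lemma DP_skew X : skew_form n (DP X).
Proof. by apply: skew_derive => // v; exact: dp. Qed.
Lemma DM_skew X : skew_form n (DM X).
Proof. by apply: skew_derive => // v; exact: dm. Qed.

Lemma DP_lin : vlin DP.
Proof. by move=> c X Y; apply/funext => v; exact: smooth_derive_lin oA Ax (sp v). Qed.
Lemma DM_lin : vlin DM.
Proof. by move=> c X Y; apply/funext => v; exact: smooth_derive_lin oA Ax (sm v). Qed.

Lemma DJ_lin1 u : vlin (DJ^~ u).
Proof.
move=> c X Y; apply/rowP => j; rewrite !mxE.
exact: smooth_derive_lin oA Ax (sJ u j).
Qed.
Lemma DJ_lin2 X : vlin (DJ X).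
Proof.
move=> c u v; apply/rowP => j; rewrite !mxE -derive_lc //.
apply: near_eq_derive; near=> y; rewrite Jlc ?mxE //; apply: HJ.
by near: y; exact: nearA.
Unshelve. all: by end_near. Qed.

Lemma DP_J X u : iprod (J u) (DP X) + iprod (DJ X u) (psip (S x)) = - iprod u (DM X).
Proof.
apply/funext => w; rewrite tensorD tensorN addrC.
have lin y : A y -> linform (fun v : E => psip (S y) (vcons v w)).
  by move=> /sk_p s c u' v'; have := congr1 (@^~ w) (skew_lin0 s c u' v').
have [_ <-] := derive_eval lin (fun v => @dp _ X) (fun j => @dJ u j X).
rewrite [RHS](_ : _ = - 'D_X (fun y => psim (S y) (vcons u w)) x) //.
rewrite -deriveN; last exact: dm.
apply: near_eq_derive; near=> y; have Ay : A y by near: y; exact: nearA.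
have [f hf] := Hf Ay.
have := congr1 (@^~ w) (iprod_II (S y) u (psip (S y))).
rewrite (II_psip (HG Ay) (HJ Ay) hf) tensorN => h.
by rewrite -[LHS]opprK -h.
Unshelve. all: by end_near. Qed.

Lemma DM_J X u : iprod (J u) (DM X) + iprod (DJ X u) (psim (S x)) = iprod u (DP X).
Proof.
apply/funext => w; rewrite tensorD addrC.
have lin y : A y -> linform (fun v : E => psim (S y) (vcons v w)).
  by move=> /sk_m s c u' v'; have := congr1 (@^~ w) (skew_lin0 s c u' v').
have [_ <-] := derive_eval lin (fun v => @dm _ X) (fun j => @dJ u j X).
apply: near_eq_derive; near=> y; have Ay : A y by near: y; exact: nearA.
have [f hf] := Hf Ay.
have := congr1 (@^~ w) (iprod_II (S y) u (psim (S y))).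
rewrite (II_psim (HG Ay) (HJ Ay) hf) tensorN => h.
by apply: oppr_inj; rewrite -h.
Unshelve. all: by end_near. Qed.

Lemma DJ_J X u : DJ X (J u) = - J (DJ X u).
Proof.
apply/rowP => j; rewrite mxE [RHS]mxE; apply/eqP; rewrite -addr_eq0 addrC; apply/eqP.
have lin y : A y -> linform (fun v : E => Jc (S y) v 0 j).
  by move=> /HJ h c u' v'; rewrite Jlc // !mxE.
have [_ <-] := derive_eval lin (fun v => @dJ v j X) (fun k => @dJ u k X).
rewrite -[RHS](derive_cst (- u 0 j : R) x X).
apply: near_eq_derive; near=> y; have Ay : A y by near: y; exact: nearA.
by rewrite (JJ (HJ Ay)) mxE.
Unshelve. all: by end_near. Qed.

Lemma derive_gJ X u v : is_derive x X (fun y => ip (S y) u (Jc (S y) v))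
  (g u (DJ X v) + Dg x S X u (J v)).
Proof.
have lin y : A y -> linform (fun w : E => ip (S y) u w).
  by move=> /HG h c a b; rewrite (gC h) glcl // !(gC h u).
exact: (derive_eval lin (fun z => @dg u z X) (fun k => @dJ v k X)).
Qed.

Lemma Dg_J X u v : Dg x S X (J u) v + Dg x S X u (J v) + g (DJ X u) v + g u (DJ X v) = 0.
Proof.
have d1 := derive_gJ X u v; have d2 := derive_gJ X v u.
have hx := HG Ax.
have := derive_val (is_derive := is_deriveD d1 d2).
rewrite (near_eq_derive (g := cst (0 : R))) ?derive_cst.
  rewrite (gC hx v) (Dg_C oA Ax HG X v) => h; rewrite h; ring.
near=> y; have Ay : A y by near: y; exact: nearA.
rewrite fctE (gC (HG Ay) v) (gJ (HG Ay) (HJ Ay) u v).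
by rewrite subrr.
Unshelve. all: by end_near. Qed.

(** The vectors f are kept constant and are adapted at x only; near x, [Psi_norm] is taken from an
    adapted frame at the nearby point. At x, psi_+(f) = 1 and psi_-(f) = 0, so the derivative of
    |Psi(f)|^2 is twice that of psi_+(f). *)
Lemma DP_f (f : 'I_n -> E) X : adapted_frame (S x) f ->
  DP X (fseq f) = 2^-1 * \sum_(k < n) Dg x S X (f k) (f k).
Proof.
move=> hf; have [q1 q2 _] := hf.
pose H y : 'M[R[i]]_n :=
  \matrix_(k, l) (ip (S y) (f k) (f l) +i* ip (S y) (f k) (Jc (S y) (f l)))%C.
pose D : 'M[R[i]]_n := \matrix_(k, l)
  (Dg x S X (f k) (f l) +i* (g (f k) (DJ X (f l)) + Dg x S X (f k) (J (f l))))%C.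
have H1 : H x = 1%:M.
  by apply/matrixP => k l; rewrite !mxE q1 q2; case: (k == l).
have hD k l : cder x X (fun y => H y k l) (D k l).
  split; rewrite mxE /=.
    by under eq_fun do rewrite mxE /=; exact: derivableP.
  by under eq_fun do rewrite mxE /=; exact: derive_gJ.
have [dre _] := cder_det H1 hD.
have dpf := derivableP (@dp (fseq f) X); have dmf := derivableP (@dm (fseq f) X).
have dn := is_deriveD (is_deriveX 2 dpf) (is_deriveX 2 dmf).
have := derive_val (is_derive := dn).
rewrite [in LHS](near_eq_derive (g := fun y => complex.Re (\det (H y)))).
  rewrite (derive_val (is_derive := dre)) (psip_f hf) (psim_f hf).
  rewrite /mxtrace cRe_sum /DP => h.
  have -> : \sum_(k < n) Dg x S X (f k) (f k) = \sum_i complex.Re (D i i).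
    by apply: eq_bigr => i _; rewrite mxE.
  rewrite h.
  by rewrite /GRing.scale /=; field.
near=> y; have Ay : A y by near: y; exact: nearA.
have [h hh] := Hf Ay.
have sp_y := adapted_frame_span (HG Ay) (HJ Ay) hh.
have := Psi_norm (HG Ay) (HJ Ay) hh sp_y (fseq f).
rewrite fctE => ->; congr (complex.Re (\det _)).
by apply/matrixP => k l; rewrite !mxE !fseqE.
Unshelve. all: by end_near. Qed.

Lemma nabla_psipE : nabla (fun y => ip (S y)) n (fun y => psip (S y)) x =
  Np m (S x) DP (christoffel (fun y => ip (S y)) x).
Proof. by apply/funext => v; rewrite /Np der_def. Qed.

Lemma nabla_psimE : nabla (fun y => ip (S y)) n (fun y => psim (S y)) x =
  Nm m (S x) DM (christoffel (fun y => ip (S y)) x).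
Proof. by apply/funext => v; rewrite /Nm der_def. Qed.

Lemma sum_modules_nabla (e : 'I_n.*2 -> E) (f : 'I_n -> E) :
  orthonormal_basis (S x) e -> adapted_frame (S x) f ->
  sum_modules [:: W1_Xi (S x) e; W2_Xi (S x) e; W3_Xi (S x) e; W4_Xi (S x) e;
                  W5 n (psim (S x))]
    (nabla (fun y => ip (S y)) n (fun y => psip (S y)) x) /\
  sum_modules [:: W1_Xi (S x) e; W2_Xi (S x) e; W3_Xi (S x) e; W4_Xi (S x) e;
                  W5 n (psip (S x))]
    (nabla (fun y => ip (S y)) n (fun y => psim (S y)) x).
Proof.
move=> he hf; have [hg hj] := (HG Ax, HJ Ax).
have fspan := adapted_frame_span hg hj hf.
have hspan := orthonormal_span hg (card_ord _) he.
have cl1 := christoffel_l1 oA Ax HG sg; have cl2 := christoffel_l2 oA Ax HG sg.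
have cc := christoffel_compat oA Ax HG sg.
split.
  rewrite nabla_psipE; apply: (sum_modules_Np hg hj hf fspan he hspan DP_skew DM_skew DP_lin
    cl1 cl2 DJ_lin1 DJ_lin2 DP_J DM_J DJ_J cc Dg_J) => X; exact: DP_f.
rewrite nabla_psimE; apply: (sum_modules_Nm hg hj hf fspan he hspan DP_skew DM_skew DM_lin
  cl1 cl2 DJ_lin1 DJ_lin2 DP_J DM_J DJ_J cc Dg_J) => X; exact: DP_f.
Qed.

End FieldDerivatives.

Lemma chart_image_open (R : realType) (m : nat) (M : smooth_manifold R m)
  (c : chart M) : open (chart_map c @` chart_dom c).
Proof. by case: M c. Qed.

Theorem theorem2p4 (R : realType) (n : nat) (hn : (4 <= n)%N)
    (M : smooth_manifold R n.*2) (U : special_almost_hermitian M)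
    (p : M) (c : chart M) (hp : chart_dom c p)
    (F := U c (chart_map c p))
    (e : 'I_n.*2 -> 'rV[R]_n.*2) (he : orthonormal_basis F e)
    (omega := kahler F) :
  [/\ sum_modules [:: W1_Xi F e; W2_Xi F e; W3_Xi F e; W4_Xi F e; W5 n (psim F)]
        (nabla_psip U c p),
      sum_modules [:: W1_Xi F e; W2_Xi F e; W3_Xi F e; W4_Xi F e; W5 n (psip F)]
        (nabla_psim U c p),
      direct_modules [:: W1_Xi F e; W2_Xi F e; W3_Xi F e; W4_Xi F e; W5 n (psim F)] &
      direct_modules [:: W1_Xi F e; W2_Xi F e; W3_Xi F e; W4_Xi F e; W5 n (psip F)]] /\
  [/\ Xip F e @` GH1 F = Xim F e @` GH1 F,
      Xip F e @` GH2 F = Xim F e @` GH2 F,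
      Xip F e @` GH3 F e = Xim F e @` GH3 F e &
      Xip F e @` GH4 F e = Xim F e @` GH4 F e] /\
  [/\ W1_Xi F e = [set elt_W1 F e b | b in lam F (n - 3)],
      W2_Xi F e =
        [set b | [/\ W_Xi n F b,
                     calL n F b = (fun v => (n - 2)%:R * b v) &
                     wedge n.+1 2 (alternation n b) omega = (fun=> 0)]] &
      sum_modules [:: W1_Xi F e; W2_Xi F e] =
        [set b | W_Xi n F b /\ calL n F b = (fun v => (n - 2)%:R * b v)]] /\
  [/\ W3_Xi F e = [set b | W_Xi n F b /\ alternation n b = (fun=> 0)],
      W4_Xi F e = [set elt_W4 F e (psip F) x | x in setT],
      W4_Xi F e = [set elt_W4 F e (psim F) x | x in setT] &
      sum_modules [:: W3_Xi F e; W4_Xi F e] =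
        [set b | W_Xi n F b /\ calL n F b = (fun v => - (n - 2)%:R * b v)]].
Proof.
rewrite /nabla_psip /nabla_psim {}/omega.
have oA : open (chart_map c @` chart_dom c) by exact: chart_image_open.
have Ax : (chart_map c @` chart_dom c) (chart_map c p).
  by exists p.
case: U @F he => S hS sg sJ sp sm _ /= he.
(* With n = m + 4 the degrees n - 2 and n - 3 compute to m + 2 and m + 1, as the lemmas on the fibre
   require. *)
case: n hn M S p c hp e hS sg sJ sp sm he oA Ax => [|[|[|[|m]]]] // _ M S p c hp e hS sg sJ sp sm he oA Ax.
have [HG HJ [f Hf]] := hS c _ Ax.
have fspan := adapted_frame_span HG HJ Hf.
have hspan := orthonormal_span HG (card_ord _) he.
have [nabP nabM] := sum_modules_nabla oA Ax (hS c) (sg c) (sJ c) (sp c) (sm c) he Hf.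
split; first split=> //.
- by apply: (direct_W HG HJ Hf fspan he hspan); exact: (Lam_psim HG HJ Hf hspan).
- by apply: (direct_W HG HJ Hf fspan he hspan); exact: (Lam_psip HG HJ Hf hspan).
split.
  split; apply: (Xip_Xim_image HG HJ Hf fspan hspan).
  - exact: GH1_uperp.
  - exact: GH1_aJ.
  - exact: GH1_lc.
  - exact: GH2_uperp.
  - exact: GH2_aJ.
  - exact: GH2_lc.
  - exact: GH3_uperp.
  - exact: GH3_aJ.
  - exact: GH3_lc.
  - exact: GH4_uperp.
  - exact: GH4_aJ.
  - exact: GH4_lc.
split; split.
- exact: (W1_E HG HJ Hf fspan he hspan).
- exact: (W2_E HG HJ Hf fspan he hspan).
- exact: (W12_E HG HJ Hf fspan he hspan).
- exact: (W3_E HG HJ Hf fspan he hspan).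
- exact: (W4_psip HG HJ Hf fspan hspan).
- exact: (W4_psim HG HJ Hf fspan hspan).
- exact: (W34_E HG HJ Hf fspan he hspan).
Qed.
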